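(* Let $\mathcal{H}$ be a finite graph family whose decomposition family $\mathcal{M}(\mathcal{H})$ is matching-good. Then $\mathcal{H}$ is spectral-consistent, i.e. $\mathrm{SPEX}(n,\mathcal{H})\subseteq \mathrm{EX}(n,\mathcal{H})$ for all sufficiently large $n$.
   Context: All graphs are finite and simple. A graph family $\mathcal{H}$ is finite if $\max_{H\in\mathcal{H}}|V(H)|$ is bounded (a constant). A graph is $\mathcal{H}$-free if it contains no member of $\mathcal{H}$ as a subgraph. $\mathrm{ex}(n,\mathcal{H})$ is the maximum number of edges of an $n$-vertex $\mathcal{H}$-free graph and $\mathrm{EX}(n,\mathcal{H})$ is the set of $n$-vertex $\mathcal{H}$-free graphs with $\mathrm{ex}(n,\mathcal{H})$ edges. $\rho(G)$ is the spectral radius of the adjacency matrix of $G$; $\mathrm{SPEX}(n,\mathcal{H})$ is the set of $n$-vertex $\mathcal{H}$-free graphs of maximum spectral radius. $\mathcal{H}$ is spectral-consistent if $\mathrm{SPEX}(n,\mathcal{H})\subseteq\mathrm{EX}(n,\mathcal{H})$ for all sufficiently large $n$. Notation: $T_p(n)$ is the $p$-partite Turán graph on $n$ vertices; $E_t$ is the edgeless graph on $t$ vertices; $F\nabla H$ is the join and $F\cup H$ the disjoint union; $K_k$ the complete graph; $M_k$ a matching of $k$ edges ($k$ disjoint copies of $K_2$). $p(\mathcal{H})=\min_{H\in\mathcal{H}}\chi(H)-1$. Decomposition family: for $\mathcal{H}$ with $p(\mathcal{H})=p\ge 2$, $\mathcal{M}(\mathcal{H})$ consists of the minimal (under taking subgraphs)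 graphs $M$ for which there exist $H\in\mathcal{H}$ and a constant $t=t(\mathcal{H})$ with $H\subseteq (M\cup E_t)\nabla T_{p-1}((p-1)t)$. A covering of a graph is a vertex set meeting all edges; $\beta(M)$ is the minimum size of a covering of $M$, and $\beta=\beta(\mathcal{M}(\mathcal{H}))=\min\{\beta(M): M\in\mathcal{M}(\mathcal{H})\}$. An independent covering of a bipartite graph is an independent set meeting all edges; $\gamma(M)$ is the minimum size of one, and $\gamma=\gamma(\mathcal{M}(\mathcal{H}))=\min\{\gamma(M): M\in\mathcal{M}(\mathcal{H})\text{ bipartite}\}$ (bipartite members always exist). If $\beta=\gamma$, set $\mathcal{B}(\mathcal{H})=\{K_\gamma\}$; otherwise $\mathcal{B}(\mathcal{H})=\{M[S]: M\in\mathcal{M}(\mathcal{H}),\ S\text{ a covering of }M,\ |S|<\gamma\}$. $\mathcal{M}(\mathcal{H})$ is matching-good if (i) $p(\mathcal{H})=p\ge2$ and $\mathcal{M}(\mathcal{H})$ contains a matching; and (ii) (for sufficiently large $n$) there is $G^\star\in\mathrm{EX}(n,\mathcal{H})$ with $G^\star=H_1\nabla H_2$, where $H_1\in\mathrm{EX}(\gamma-1,\mathcal{B}(\mathcal{H}))$ and $H_2$ differs from $T_p(n-\gamma+1)$ by $O(1)$ edges (i.e., is obtained from it by adding and deleting a number of edges bounded by a constant independent of $n$). *)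

(* Defs.v *)
From HB Require Import structures.
From mathcomp Require Import all_boot all_order all_algebra.
From mathcomp Require Import complex.
From mathcomp Require Import boolp classical_sets reals.

Set Implicit Arguments.
Unset Strict Implicit.
Unset Printing Implicit Defensive.

Import Order.TTheory GRing.Theory Num.Theory.

(* The null graph (no vertices) is allowed; it occurs as a member of
   EX(gamma - 1, B) when gamma = 1. *)
Record sgraph := SGraph {
  vertex :> finType;
  adj : rel vertex;
  adj_sym : symmetric adj;
  adj_irr : irreflexive adj }.

Definition edges (G : sgraph) : {set {set G}} :=
  ([set [set e.1; e.2] | e in [set e : G * G | adj e.1 e.2]])%SET.

(* [F] is isomorphic to a (not necessarily induced) subgraph of [G] *)
Definition subgraph (F G : sgraph) : Prop :=
  exists2 f : F -> G, injective f & forall x y, adj x y -> adj (f x) (f y).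

Definition edgeless (t : nat) : sgraph :=
  @SGraph 'I_t (fun _ _ => false) (fun _ _ => erefl) (fun _ => erefl).

Lemma complete_sym k : symmetric (fun i j : 'I_k => i != j).
Proof. by move=> i j; rewrite eq_sym. Qed.
Lemma complete_irr k : irreflexive (fun i j : 'I_k => i != j).
Proof. by move=> i; rewrite eqxx. Qed.
Definition complete_graph (k : nat) : sgraph :=
  SGraph (@complete_sym k) (@complete_irr k).

Definition matching_adj k (u v : 'I_k * bool) : bool :=
  (u.1 == v.1) && (u.2 != v.2).
Lemma matching_sym k : symmetric (@matching_adj k).
Proof. by move=> u v; rewrite /matching_adj eq_sym [u.2 == _]eq_sym. Qed.
Lemma matching_irr k : irreflexive (@matching_adj k).
Proof. by move=> u; rewrite /matching_adj !eqxx. Qed.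
Definition matching_graph (k : nat) : sgraph :=
  SGraph (@matching_sym k) (@matching_irr k).

(* The parts are the residue classes modulo [p], so for [p > 0] their sizes
   differ by at most one. *)
Definition turan_adj p n (i j : 'I_n) : bool := i %% p != j %% p.
Lemma turan_sym p n : symmetric (@turan_adj p n).
Proof. by move=> i j; rewrite /turan_adj eq_sym. Qed.
Lemma turan_irr p n : irreflexive (@turan_adj p n).
Proof. by move=> i; rewrite /turan_adj eqxx. Qed.
Definition turan (p n : nat) : sgraph :=
  SGraph (@turan_sym p n) (@turan_irr p n).

Definition sum_adj (cross : bool) (F G : sgraph) (u v : F + G) : bool :=
  match u, v with
  | inl x, inl y => adj x y
  | inr x, inr y => adj x y
  | _, _ => cross
  end.
Lemma sum_sym b F G : symmetric (@sum_adj b F G).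
Proof. by move=> [x|x] [y|y] //=; apply: adj_sym. Qed.
Lemma sum_irr b F G : irreflexive (@sum_adj b F G).
Proof. by move=> [x|x] /=; apply: adj_irr. Qed.
Definition graph_union (F G : sgraph) : sgraph :=
  SGraph (@sum_sym false F G) (@sum_irr false F G).
Definition graph_join (F G : sgraph) : sgraph :=
  SGraph (@sum_sym true F G) (@sum_irr true F G).

Definition induced_adj (G : sgraph) (S : {set G}) (u v : {x : G | x \in S}) :
  bool := adj (val u) (val v).
Lemma induced_sym G S : symmetric (@induced_adj G S).
Proof. by move=> u v; apply: adj_sym. Qed.
Lemma induced_irr G S : irreflexive (@induced_adj G S).
Proof. by move=> u; apply: adj_irr. Qed.
Definition induced (G : sgraph) (S : {set G}) : sgraph :=
  SGraph (@induced_sym G S) (@induced_irr G S).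

(* Least element of a set of naturals; 0 if the set is empty. *)
Definition natmin (P : nat -> Prop) : nat :=
  xget 0 (fun n => P n /\ forall m, P m -> n <= m).

Definition colorable (G : sgraph) (k : nat) : Prop :=
  exists f : G -> 'I_k, forall x y, adj x y -> f x != f y.

Definition chromatic (G : sgraph) : nat := natmin (colorable G).

Definition bipartite (G : sgraph) : Prop := colorable G 2.

Definition covering (G : sgraph) (S : {set G}) : Prop :=
  forall x y, adj x y -> (x \in S) || (y \in S).

Definition independent (G : sgraph) (S : {set G}) : Prop :=
  forall x y, x \in S -> y \in S -> ~~ adj x y.

Definition cover_number (G : sgraph) : nat :=
  natmin (fun k => exists2 S : {set G}, covering S & #|S| = k).

Definition indep_cover_number (G : sgraph) : nat :=
  natmin (fun k =>
    exists2 S : {set G}, independent S /\ covering S & #|S| = k).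

Definition graph_family := sgraph -> Prop.

Definition finite_family (H : graph_family) : Prop :=
  exists c : nat, forall F, H F -> #|F| <= c.

Definition graph_free (H : graph_family) (G : sgraph) : Prop :=
  forall F, H F -> ~ subgraph F G.

Definition EX (n : nat) (H : graph_family) : graph_family := fun G =>
  [/\ #|G| = n, graph_free H G &
      forall G' : sgraph, #|G'| = n -> graph_free H G' ->
        #|edges G'| <= #|edges G|].

Section Spectral.
Variable R : realType.
Local Open Scope ring_scope.

Definition adjacency (G : sgraph) : 'M[R[i]]_#|G| :=
  \matrix_(i, j) (adj (enum_val i) (enum_val j))%:R.

(* The set is finite, and non-empty unless [G] is the null graph, so that the
   supremum is a maximum; [sup] of the empty set is 0. *)
Definition spectral_radius (G : sgraph) : R :=
  sup [set Normc.normc l | l in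
        [set l : R[i] | eigenvalue (adjacency G) l]]%classic.

Definition SPEX (n : nat) (H : graph_family) : graph_family := fun G =>
  [/\ #|G| = n, graph_free H G &
      forall G' : sgraph, #|G'| = n -> graph_free H G' ->
        spectral_radius G' <= spectral_radius G].

Definition spectral_consistent (H : graph_family) : Prop :=
  exists N : nat, forall n : nat, (N <= n)%N ->
    forall G, SPEX n H G -> EX n H G.

End Spectral.

Definition family_p (H : graph_family) : nat :=
  natmin (fun k => exists2 F, H F & chromatic F = k) - 1.

Definition pre_decomposition (H : graph_family) : graph_family := fun M =>
  exists (F : sgraph) (t : nat), H F /\
    subgraph F (graph_join (graph_union M (edgeless t))
                           (turan (family_p H - 1) ((family_p H - 1) * t))).

(* Minimality up to isomorphism: two finite graphs that embed in each other
   are isomorphic. *)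
Definition decomposition (H : graph_family) : graph_family := fun M =>
  pre_decomposition H M /\
  forall M', pre_decomposition H M' -> subgraph M' M -> subgraph M M'.

Definition family_beta (H : graph_family) : nat :=
  natmin (fun k => exists2 M, decomposition H M & cover_number M = k).

Definition family_gamma (H : graph_family) : nat :=
  natmin (fun k => exists2 M, decomposition H M /\ bipartite M &
                              indep_cover_number M = k).

Definition B_family (H : graph_family) : graph_family := fun F =>
  if family_beta H == family_gamma H then F = complete_graph (family_gamma H)
  else exists (M : sgraph) (S : {set M}),
         [/\ decomposition H M, covering S, #|S| < family_gamma H
           & F = induced S].

(* After identifying the vertex sets along some bijection, the edge sets of
   [F] and [G] differ in at most [c] pairs. *)
Definition edit_close (c : nat) (F G : sgraph) : Prop :=
  exists2 f : F -> G, bijective f &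
    #|([set [set e.1; e.2] | e in
         [set e : F * F | adj e.1 e.2 != adj (f e.1) (f e.2)]])%SET| <= c.

Definition matching_good (H : graph_family) : Prop :=
  [/\ 2 <= family_p H,
      exists k, decomposition H (matching_graph k) &
      exists c N : nat, forall n, N <= n ->
        exists H1 H2 : sgraph,
          [/\ EX n H (graph_join H1 H2),
              EX (family_gamma H - 1) (B_family H) H1 &
              edit_close c H2 (turan (family_p H) (n - family_gamma H + 1))]].

(* Main.v *)
(* Let [G] have the largest spectral radius [r] among the [n]-vertex [H]-free
   graphs, with leading eigenvector [x] normalised by [sum x^2 = n], and put
   [p = k + 1], [s = gamma - 1]. The extremal graph [G*] gives the lower bound
   [r >= (1 - 1/p) n + s (lam - 1/lam) - o(1)], where [lam = p / (p - 1)].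
   As [G] contains no large complete [(p+1)]-partite graph, it has [o(n^(p+1))]
   cliques of size [p+1], and the Moon-Moser inequality for clique densities
   weighted by [x] shows that [x] is close to 1 on average and that [G] is close
   to a complete [p]-partite graph. Few vertices see a positive proportion of
   every part, and any [gamma] of them have few common neighbours, so the
   lower bound on [r] forces exactly [s] vertices (the set [W]) to be joined to
   almost everything, while the others see almost nothing in their own part.
   Changing the neighbourhood of a single vertex [z] to a set [A] in which every
   bounded subset has many common neighbours preserves [H]-freeness, so
   [sum_A x <= r x_z]. This makes all but [O(1)] vertices exactly joined to [W]
   and to the other parts; moving one such vertex between two parts would
   increase [r] unless the part sizes differ by at most one.
   Then [G] and [G*] agree outside a core of bounded size. With [y] the leading
   eigenvector of [G*], the sum over the core of [(A* - A)_uv x_u y_v] has the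
   sign of [r* - r]. Here [x] and [y] are nearly [lam] on [W] and nearly 1
   elsewhere, [W] is completely joined to the rest in [G*], and [W] spans in [G]
   a [B]-free graph, hence at most as many edges as in [G*]. So if [G] had fewer
   edges than [G*], then [r* > r]. *)
Require Import Defs.
From mathcomp Require Import all_boot all_order all_algebra.
From mathcomp Require Import complex boolp classical_sets reals topology normedtype derive.
From mathcomp Require Import fintype finset ring lra zify.

Set Implicit Arguments.
Unset Strict Implicit.
Unset Printing Implicit Defensive.

Import Order.TTheory GRing.Theory Num.Theory numFieldNormedType.Exports.
Local Open Scope ring_scope.
Implicit Types (R : realType) (G : sgraph) (H : graph_family).

(** * The spectral radius *)

(** The lower bound on [r] is sharp up to an additive [o(1)], so in [qform x = r n] every loss of
    order [n] is visible. Stability alone leaves [o(n^2)] wrong pairs; the matching in the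
    decomposition family removes this obstacle, since the inner edges of a class without [m]
    disjoint edges are covered by [2 m] vertices. The number [lam] comes from [r x_u] being nearly
    the degree of [u]: a vertex seeing everything gets weight [n / r], near [p / (p - 1)]. A vertex
    seeing the fraction [pi] of all transversals of the parts gets at most about [1 + pi / k], and
    these fractions sum to little more than [s], because [gamma] vertices with many common
    transversals would yield a forbidden graph. The gain needed for the lower bound then leaves only
    fractions near 0 or 1. Class sizes must be balanced exactly, as a misplaced vertex would change
    about [n] pairs and no bounded core would remain. In the last step the eigenvectors are known
    only up to a small error, but the core is bounded and the edge difference is an integer, so a
    fixed gap beats the error. *)

Definition nb R G (x : G -> R) (v : G) : R :=
  \sum_(u | adj v u) x u.

Definition qform R G (x : G -> R) : R :=
  \sum_v x v * nb x v.

Lemma qformE R G (x : G -> R) :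
  qform x = \sum_u \sum_(v | adj u v) x u * x v.
Proof. by apply: eq_bigr => u _; rewrite /nb big_distrr. Qed.

Lemma continuous_sumr R (T : topologicalType) (I : Type)
    (r : seq I) (P : pred I) (f : I -> T -> R) :
  (forall i, continuous (f i)) ->
  continuous (fun t => \sum_(i <- r | P i) f i t).
Proof.
move=> cf; elim: r => [|i r IH].
  by under eq_fun do rewrite big_nil; move=> t; apply: cvg_cst.
under eq_fun do rewrite big_cons.
case: (P i) => // t.
by apply: cvgD; [apply: cf | apply: IH].
Qed.

(** The unit sphere is closed in a compact cube and [qform] is continuous, so a maximum exists;
    homogeneity extends the bound to every [y]. Functions on [G] are passed to row vectors, where
    boxes are compact. *)
Lemma qform_max R G : (0 < #|G|)%N ->
  exists2 x : G -> R, \sum_v x v ^+ 2 = 1 &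
    forall y : G -> R, qform y <= qform x * \sum_v y v ^+ 2.
Proof.
move=> G0; set n := #|G|.
pose F (r : 'rV[R]_n) : G -> R := fun v => r ord0 (enum_rank v).
pose q (r : 'rV[R]_n) := qform (F r).
pose nrm (r : 'rV[R]_n) := \sum_v F r v ^+ 2.
have cF v : continuous (fun r => F r v) by apply: coord_continuous.
have cM (f g : 'rV[R]_n -> R) : continuous f -> continuous g ->
    continuous (fun r => f r * g r).
  by move=> cf cg t; exact: (cvgM (cf t) (cg t)).
have cq : continuous q.
  apply: continuous_sumr => v; apply: cM => //.
  by apply: continuous_sumr => u; apply: cF.
have cn : continuous nrm by apply: continuous_sumr => v; apply: (cM _ _ (cF v)).
pose A := [set r | nrm r = 1]%classic.
have [v0 _] : exists v0 : G, True.
  by move/card_gt0P: G0 => [v0 _]; exists v0.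
have A0 : (A !=set0)%classic.
  exists (\row_j (j == enum_rank v0)%:R); rewrite /A /= /nrm (bigD1 v0) //=.
  rewrite big1 ?addr0 /F ?mxE ?eqxx ?expr1n// => v vv0.
  by rewrite mxE (inj_eq enum_rank_inj) (negbTE vv0) expr0n.
have Fle r v : F r v ^+ 2 <= nrm r.
  by rewrite /nrm (bigD1 v) //= lerDl sumr_ge0 // => u _; rewrite sqr_ge0.
have cA : compact A.
  have box : compact
      [set v : 'rV[R]_n | forall i, (v ord0 i \in `[(-1), 1])%R]%classic.
    have := @rV_compact R n (fun=> `[(-1), 1]%classic)
      (fun=> @segment_compact R (-1) 1).
    by congr compact; apply/seteqP; split=> w /= h i; exact: h.
  apply: subclosed_compact box _.
    have -> : A = (nrm @^-1` [set 1])%classic by [].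
    by apply: (continuous_closedP _).1 => //; exact: closed_eq.
  move=> r /= rA i; have := Fle r (enum_val i).
  rewrite rA /F enum_valK => h; rewrite in_itv /= -ler_norml.
  by rewrite -(@ler_pXn2r _ 2) ?nnegrE // expr1n real_normK ?num_real.
have [r rA rmax] := EVT_max_rV A0 cA (continuous_subspaceT cq).
have r1 : nrm r = 1 by exact: set_mem rA.
exists (F r) => // y.
have [y0|/eqP y0] := eqVneq (\sum_v y v ^+ 2) 0.
  have yz v : y v = 0.
    apply/eqP; rewrite -sqrf_eq0.
    have := (psumr_eq0P (fun v _ => sqr_ge0 (y v)) y0) v isT.
    by move=> ->.
  by rewrite y0 mulr0 /qform big1 // => v _; rewrite yz mul0r.
have N0 : 0 < \sum_v y v ^+ 2.
  rewrite lt_neqAle eq_sym; apply/andP; split; first by apply/eqP.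
  by apply: sumr_ge0 => v _; apply: sqr_ge0.
set N := \sum_v y v ^+ 2 in N0 *.
pose s := (Num.sqrt N)^-1.
have s2 : s ^+ 2 = N^-1 by rewrite exprVn sqr_sqrtr // ltW.
pose r' : 'rV[R]_n := \row_j (s * y (enum_val j)).
have Fr' v : F r' v = s * y v by rewrite /F mxE enum_rankK.
have r'A : r' \in A.
  apply: mem_set; rewrite /A /= /nrm; under eq_bigr do rewrite Fr' exprMn.
  by rewrite -big_distrr /= s2 mulVf // gt_eqF.
have := rmax _ r'A; rewrite /q.
have -> : qform (F r') = s ^+ 2 * qform y.
  rewrite !qformE big_distrr /=; apply: eq_bigr => u _.
  rewrite big_distrr /=; apply: eq_bigr => v _.
  by rewrite !Fr' expr2; ring.
by rewrite s2 mulrC ler_pdivrMr.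
Qed.

(** There is no term in [t ^+ 2], since [v] is not adjacent to itself. *)
Lemma qform_perturb R G (x : G -> R) (t : R) (v : G) :
  qform (fun u => x u + t * (u == v)%:R) = qform x + 2 * t * nb x v.
Proof.
pose e (u : G) : R := (u == v)%:R.
have nbE u : nb (fun u => x u + t * (u == v)%:R) u = nb x u + t * (adj u v)%:R.
  rewrite /nb big_split /= -big_distrr /=; congr (_ + t * _).
  rewrite big_mkcond (bigD1 v) //= eqxx big1 ?addr0 //.
    by case: (adj u v).
  by move=> w /negbTE ->; case: ifP.
rewrite /qform; under eq_bigr do rewrite nbE mulrDl !mulrDr.
rewrite !big_split /=.
have -> : \sum_i t * (i == v)%:R * nb x i = t * nb x v.
  rewrite (bigD1 v) //= eqxx big1 ?addr0 ?mulr1 // => w /negbTE ->.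
  by rewrite mulr0 mul0r.
have -> : \sum_i t * (i == v)%:R * (t * (adj i v)%:R) = 0.
  rewrite (bigD1 v) //= adj_irr big1 ?addr0 ?mulr0 // => w /negbTE ->.
  by rewrite mulr0 mul0r.
have -> : \sum_i x i * (t * (adj i v)%:R) = t * nb x v.
  rewrite /nb big_distrr /= [RHS]big_mkcond /=; apply: eq_bigr => u _.
  by rewrite adj_sym; case: (adj v u); rewrite ?mulr1 ?mulr0 // mulrC.
by ring.
Qed.

Lemma sqr_perturb R G (x : G -> R) (t : R) (v : G) :
  \sum_u (x u + t * (u == v)%:R) ^+ 2 = \sum_u x u ^+ 2 + 2 * t * x v + t ^+ 2.
Proof.
rewrite (bigD1 v) //= [in RHS](bigD1 v) //= eqxx.
rewrite (eq_bigr (fun u => x u ^+ 2)) => [|u /negbTE ->].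
  by rewrite /=; ring.
by rewrite mulr0 addr0.
Qed.

Lemma qform_norm_le R G (x : G -> R) :
  qform x <= qform (fun v => `|x v|).
Proof.
rewrite !qformE; apply: ler_sum => u _; apply: ler_sum => v _.
by rewrite -normrM ler_norm.
Qed.

(* [q] cannot exceed the multiple [m |y|^2] along the line [x + t e_v]. *)
Lemma qform_max_eigen R G (x : G -> R) (m : R) :
  (forall y : G -> R, qform y <= m * \sum_v y v ^+ 2) ->
  qform x = m * \sum_v x v ^+ 2 ->
  forall v, nb x v = m * x v.
Proof.
move=> hm hx v; set d := nb x v - m * x v.
have key t : 2 * t * d <= m * t ^+ 2.
  have := hm (fun u => x u + t * (u == v)%:R).
  rewrite qform_perturb sqr_perturb hx /d => h.
  by nra.
apply/eqP; rewrite -subr_eq0; apply/eqP; rewrite -/d.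
(* [key] is used at [t = d] when [m <= 0], and otherwise at [t = d / m], where
   [2 * t * d - m * t ^+ 2] is largest; both force [d = 0]. *)
have [m0|m0] := lerP m 0.
  have := key d; have := sqr_ge0 d => h1 h2.
  apply/eqP; rewrite -sqrf_eq0; apply/eqP; nra.
have := key (d / m); rewrite expr_div_n => h.
have e1 : m * (d ^+ 2 / m ^+ 2) = d ^+ 2 / m by field; rewrite gt_eqF.
have e2 : 2 * (d / m) * d = 2 * (d ^+ 2 / m) by field; rewrite gt_eqF.
rewrite e1 e2 in h.
have h3 : d ^+ 2 / m <= 0 by lra.
have h4 : d ^+ 2 <= 0 by move: h3; rewrite ler_pdivrMr // mul0r.
by apply/eqP; rewrite -sqrf_eq0 eq_le h4 sqr_ge0.
Qed.

(** Strict positivity of the entries would require connectedness; where it matters it is derived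
    from degree bounds. *)
Definition perron R G (x : G -> R) (r : R) :=
  [/\ forall v, 0 <= x v, \sum_v x v ^+ 2 = #|G|%:R &
      forall v, nb x v = r * x v].

Definition rayleigh R G (r : R) :=
  forall y : G -> R, qform y <= r * \sum_v y v ^+ 2.

(** Absolute values do not lower [qform] and keep the norm, so [|x0|] is again a maximiser, hence an
    eigenvector by the first-order condition. *)
Lemma perron_exists R G : (0 < #|G|)%N ->
  exists (x : G -> R) (r : R), [/\ perron x r, rayleigh G r & 0 <= r].
Proof.
move=> G0; have [x0 x01 hx0] := qform_max R G0.
have h1 : qform x0 = qform (fun v => `|x0 v|).
  apply/eqP; rewrite eq_le qform_norm_le /=.
  apply: le_trans (hx0 _) _.
  by under eq_bigr do rewrite real_normK ?num_real //; rewrite x01 mulr1.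
set m := qform x0 in hx0 h1.
have n0 : 0 < #|G|%:R :> R by rewrite ltr0n.
have s0 : 0 < Num.sqrt #|G|%:R :> R by rewrite sqrtr_gt0.
have eg v : nb (fun v => `|x0 v|) v = m * `|x0 v|.
  apply: (qform_max_eigen (x := fun v => `|x0 v|)) => //.
  by under eq_bigr do rewrite real_normK ?num_real //; rewrite x01 mulr1.
exists (fun v => Num.sqrt #|G|%:R * `|x0 v|), m; split=> //.
- split=> [v||v].
  + by rewrite mulr_ge0 // ltW.
  + under eq_bigr do rewrite exprMn real_normK ?num_real //.
    by rewrite -big_distrr /= x01 mulr1 sqr_sqrtr // ltW.
  + by rewrite /nb -big_distrr /= -/(nb _ v) eg; ring.
- rewrite h1 qformE; apply: sumr_ge0 => u _; apply: sumr_ge0 => v _.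
  exact: mulr_ge0.
Qed.

Lemma normc_sum_le R (I : finType) (P : pred I) (f : I -> R[i]) :
  Normc.normc (\sum_(i | P i) f i) <= \sum_(i | P i) Normc.normc (f i).
Proof.
elim/big_ind2: _ => //; first by rewrite Normc.normc0.
move=> a b c d h1 h2; apply: le_trans (le_normcD _ _) _.
exact: lerD.
Qed.

Lemma normc_ge0 R (z : R[i]) : 0 <= Normc.normc z.
Proof. by case: z => a b /=; apply: sqrtr_ge0. Qed.

(** For a complex eigenvector [z] with eigenvalue [l], the moduli satisfy [|l| |z_v| <= nb |z| v].
    Pairing with [|z|] and the Rayleigh bound give [|l| <= r], while [x] shows that [r] is itself an
    eigenvalue. *)
Lemma spectral_radiusP R G (x : G -> R) (r : R) :
  (0 < #|G|)%N -> perron x r -> rayleigh G r -> 0 <= r ->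
  spectral_radius R G = r.
Proof.
move=> G0 [x0 x1 xe] hr r0.
set E := [set Normc.normc l | l in
        [set l : R[i] | eigenvalue (adjacency R G) l]]%classic.
have mulE (z : 'rV[R[i]]_#|G|) (v : G) :
    (z *m adjacency R G) ord0 (enum_rank v) =
    \sum_(u | adj u v) z ord0 (enum_rank u).
  rewrite mxE (reindex (@enum_rank G)) /=; last by apply/onW_bij/enum_rank_bij.
  rewrite [RHS]big_mkcond /=; apply: eq_bigr => u _.
  by rewrite mxE !enum_rankK; case: (adj u v); rewrite ?mulr1 ?mulr0.
have rE : E r.
  exists (r%:C)%C; last first.
    by rewrite /= expr0n /= addr0 sqrtr_sqr ger0_norm.
  rewrite /=; apply/eigenvalueP.
  exists (\row_j ((x (enum_val j))%:C)%C).
    apply/rowP => j; rewrite -[j]enum_valK mulE !mxE enum_rankK.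
    rewrite (eq_bigr (fun u => ((x u)%:C)%C)) => [|u _]; last by rewrite mxE enum_rankK.
    have -> : \sum_(u | adj u (enum_val j)) ((x u)%:C)%C = ((nb x (enum_val j))%:C)%C.
      rewrite /nb (raddf_sum (real_complex R)) /=; apply: eq_bigl => u.
      exact: adj_sym.
    by rewrite xe rmorphM.
  apply/eqP => /rowP h.
  have : \sum_v x v ^+ 2 = 0.
    apply: big1 => v _; have := h (enum_rank v); rewrite !mxE enum_rankK.
    by move=> [->]; rewrite expr0n.
  by rewrite x1 => /eqP; rewrite pnatr_eq0 => /eqP n0; move: G0; rewrite n0.
have ubE : (ubound E r)%classic.
  move=> _ [l /= /eigenvalueP[z zl z0] <-].
  pose y (v : G) := Normc.normc (z ord0 (enum_rank v)).
  have ly v : Normc.normc l * y v <= nb y v.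
    have := mulE z v; rewrite zl mxE => e.
    rewrite /y -Normc.normcM e; apply: le_trans (normc_sum_le _ _) _.
    by rewrite /nb le_eqVlt; apply/orP; left; apply/eqP; apply: eq_bigl => u; apply: adj_sym.
  have h1 : Normc.normc l * \sum_v y v ^+ 2 <= qform y.
    rewrite big_distrr /= /qform; apply: ler_sum => v _.
    by have := ly v; have : 0 <= y v by [apply: normc_ge0]; nra.
  have h2 := le_trans h1 (hr y).
  move: h2; rewrite ler_pM2r //.
  rewrite lt_neqAle eq_sym; apply/andP; split; last by apply: sumr_ge0 => v _; apply: sqr_ge0.
  apply/eqP => s0; case/eqP: z0; apply/rowP => j; rewrite mxE.
  apply: Normc.eq0_normc.
  have := (psumr_eq0P (fun v _ => sqr_ge0 (y v)) s0) (enum_val j) isT.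
  by rewrite /y enum_valK => /eqP; rewrite sqrf_eq0 => /eqP.
apply/eqP; rewrite eq_le; apply/andP; split.
  by apply: ge_sup => //; exists r.
by apply: ub_le_sup => //; exists r.
Qed.

Lemma perron_spectral R G : (0 < #|G|)%N ->
  rayleigh G (spectral_radius R G) /\
  exists x : G -> R, perron x (spectral_radius R G).
Proof.
move=> G0; have [x [r [h1 h2 h3]]] := perron_exists R G0.
by rewrite (spectral_radiusP G0 h1 h2 h3); split=> //; exists x.
Qed.

(** * Complete partite subgraphs *)

Lemma sum_indicator (R : pzRingType) (T : finType) (A : {pred T}) :
  \sum_i (i \in A)%:R = #|A|%:R :> R.
Proof.
rewrite -sum1_card natr_sum [RHS]big_mkcond /=; apply: eq_bigr => i _.
by case: (i \in A).
Qed.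

Definition delf r (T : finType) (i : 'I_r.+1) (Q : {ffun 'I_r.+1 -> T}) :
  {ffun 'I_r -> T} := [ffun j => Q (lift i j)].

Definition insf r (T : finType) (i : 'I_r.+1) (v : T) (Q : {ffun 'I_r -> T}) :
  {ffun 'I_r.+1 -> T} := [ffun j => if unlift i j is Some k then Q k else v].

Lemma insfE r (T : finType) (i : 'I_r.+1) (v : T) Q : insf i v Q i = v.
Proof. by rewrite ffunE unlift_none. Qed.

Lemma insf_lift r (T : finType) (i : 'I_r.+1) (v : T) Q j :
  insf i v Q (lift i j) = Q j.
Proof. by rewrite ffunE liftK. Qed.

Lemma delfK r (T : finType) (i : 'I_r.+1) (Q : {ffun 'I_r.+1 -> T}) :
  insf i (Q i) (delf i Q) = Q.
Proof.
by apply/ffunP => j; rewrite ffunE; case: unliftP => [k|] ->; rewrite ?ffunE.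
Qed.

Lemma insfK r (T : finType) (i : 'I_r.+1) (v : T) Q : delf i (insf i v Q) = Q.
Proof. by apply/ffunP => j; rewrite ffunE insf_lift. Qed.

Lemma big_insf (V : Type) (idx : V) (op : Monoid.com_law idx) r (T : finType)
    (i : 'I_r.+1) (F : {ffun 'I_r.+1 -> T} -> V) :
  \big[op/idx]_Q F Q = \big[op/idx]_(Q : {ffun 'I_r -> T})
                         \big[op/idx]_(v : T) F (insf i v Q).
Proof.
rewrite pair_big /= (reindex (fun q => insf i q.2 q.1)) //=.
exists (fun Q => (delf i Q, Q i)) => [[Q v] _|Q _] /=.
  by rewrite insfK insfE.
by rewrite delfK.
Qed.

Lemma leq_exp_ffact m t : ((m - t) ^ t <= m ^_ t)%N.
Proof.
(* The base [m - t] moves with [t], so the induction runs with a fixed base [m - k]. *)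
suff H : forall k, (t <= k)%N -> ((m - k) ^ t <= m ^_ t)%N by apply: H.
elim: t => // t IH k tk; rewrite ffactnSr expnSr.
by apply: leq_mul; [apply: IH; apply: ltnW | apply: leq_sub2l; apply: ltnW].
Qed.

Lemma leq_ffact_expn m t : (m ^_ t <= m ^ t)%N.
Proof.
elim: t => // t IH; rewrite ffactnSr expnSr.
by apply: leq_mul => //; apply: leq_subr.
Qed.

Lemma exists_nat_ge R (a : R) : exists N : nat, forall n, (N <= n)%N -> a <= n%:R.
Proof.
exists (Num.bound a) => n hn.
apply: le_trans (ler_norm a) _; apply: ltW.
apply: lt_le_trans (_ : (Num.bound a)%:R <= _); last by rewrite ler_nat.
by have := archi_boundP (normr_ge0 a); rewrite /Num.bound normr_id.
Qed.

(* Erdos: a dense [r]-partite [r]-uniform hypergraph contains a complete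
   [r]-partite one, by averaging over the [t]-sets in the first coordinate. *)
Lemma dense_complete_partite R (r t : nat) (d : R) : 0 < d ->
  exists N, forall (T : finType) (P : {set {ffun 'I_r -> T}}), (N <= #|T|)%N ->
    d * #|T|%:R ^+ r <= #|P|%:R ->
    exists S : 'I_r -> {set T}, (forall i, #|S i| = t) /\
      forall Q : {ffun 'I_r -> T}, (forall i, Q i \in S i) -> Q \in P.
Proof.
elim: r d => [|r IH] d d0.
  exists 0%N => T P _; rewrite expr0 mulr1 => hP.
  have /card_gt0P[Q0 Q0P] : (0 < #|P|)%N by rewrite -(ltr_nat R); apply: lt_le_trans hP.
  exists (fun=> set0); split=> [[]//|Q _].
  by rewrite (_ : Q = Q0) //; apply/ffunP => -[].
(* At least [(d / 2) n ^ r] tuples extend in at least [d n / 2] ways, and each then contains at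
   least [(d n / 4) ^ t / t!] of the at most [n ^ t / t!] sets of size [t]. [d1] is half of the
   resulting average density, for a strict contradiction. *)
set d1 := (d / 4) * (d / 4) ^+ t.
have d1_gt0 : 0 < d1 by rewrite /d1 mulr_gt0 ?exprn_gt0 ?divr_gt0.
have [N1 hN1] := IH d1 d1_gt0.
have [N2 hN2] := exists_nat_ge (4 * t%:R / d).
exists (maxn 1 (maxn N1 N2)) => T P; set n := #|T|.
rewrite !geq_max => /andP[n1 /andP[nN1 nN2]] hP.
pose D (Q : {ffun 'I_r -> T}) := [set v | insf ord0 v Q \in P]%SET.
pose PA (A : {set T}) := [set Q | A \subset D Q]%SET.
have n0 : 0 < n%:R :> R by rewrite ltr0n.
have cardF : #|{: {ffun 'I_r -> T}}| = (n ^ r)%N by rewrite card_ffun card_ord.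
have sumD : #|P| = (\sum_Q #|D Q|)%N.
  rewrite -sum1_card big_mkcond /= (big_insf _ ord0) /=.
  apply: eq_bigr => Q _; rewrite -sum1_card [RHS]big_mkcond /=.
  by apply: eq_bigr => v _; rewrite inE.
have [[A /eqP At hA]|noA] :=
    pselect (exists2 A : {set T}, #|A| == t & d1 * n%:R ^+ r <= #|PA A|%:R).
  have [S [St hS]] := hN1 T (PA A) nN1 hA.
  exists (fun i => if unlift ord0 i is Some j then S j else A).
  split=> [i|Q hQ]; first by case: unliftP.
  have /hS : forall i, delf ord0 Q i \in S i.
    by move=> i; rewrite ffunE; have := hQ (lift ord0 i); rewrite liftK.
  rewrite inE => /subsetP/(_ (Q ord0)).
  by have := hQ ord0; rewrite unlift_none => -> /(_ isT); rewrite inE delfK.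
exfalso.
have up : (\sum_(A : {set T} | #|A| == t) #|PA A|)%N%:R * (t`!)%:R
          <= d1 * n%:R ^+ r * n%:R ^+ t :> R.
  apply: (@le_trans _ _ ((\sum_(A : {set T} | #|A| == t) d1 * n%:R ^+ r) * (t`!)%:R)).
    rewrite ler_wpM2r // natr_sum; apply: ler_sum => A At; rewrite leNgt.
    by apply/negP => h; apply: noA; exists A => //; apply: ltW.
  set e := d1 * _; have e0 : 0 <= e by rewrite /e mulr_ge0 ?exprn_ge0 // ltW.
  rewrite sumr_const -[e *+ _]mulr_natr -[e * _ * _]mulrA; apply: ler_wpM2l => //.
  rewrite -natrM -natrX ler_nat.
  have -> : #|[pred A : {set T} | #|A| == t]| = 'C(n, t).
    rewrite -(card_draws T t); apply: eq_card => A; by rewrite !inE.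
  by rewrite bin_ffact leq_ffact_expn.
have lowsum : (\sum_(A : {set T} | #|A| == t) #|PA A|)%N = (\sum_Q 'C(#|D Q|, t))%N.
  rewrite (eq_bigr (fun A : {set T} => \sum_Q (A \subset D Q : nat))%N) => [|A _].
    rewrite exchange_big /=; apply: eq_bigr => Q _.
    rewrite -cards_draws -sum1_card big_mkcond [RHS]big_mkcond /=.
    by apply: eq_bigr => A _; rewrite !inE andbC; case: eqP; case: (A \subset D Q).
  rewrite -sum1_card big_mkcond /=; apply: eq_bigr => Q _.
  by rewrite inE; case: (A \subset D Q).
pose good := [set Q | d * n%:R / 2 <= #|D Q|%:R]%SET.
have hgood : d / 2 * n%:R ^+ r <= #|good|%:R.
  have : #|P|%:R <= n%:R * #|good|%:R + (d * n%:R / 2) * n%:R ^+ r :> R.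
    rewrite sumD natr_sum.
    have -> : n%:R * #|good|%:R = \sum_Q (Q \in good)%:R * n%:R :> R.
      by rewrite -big_distrl /= sum_indicator mulrC.
    have -> : (d * n%:R / 2) * n%:R ^+ r = \sum_(Q : {ffun 'I_r -> T}) (d * n%:R / 2).
      by rewrite sumr_const cardF -[RHS]mulr_natr natrX.
    rewrite -big_split /=; apply: ler_sum => Q _; rewrite inE.
    case: (lerP (d * n%:R / 2)) => h /=.
      rewrite mul1r; apply: le_trans (_ : n%:R <= _).
        by rewrite ler_nat max_card.
      by nra.
    by rewrite mul0r add0r ltW.
  move=> h; have := le_trans hP h; rewrite exprS => h'.
  have : n%:R * (d / 2 * n%:R ^+ r) <= n%:R * #|good|%:R.
    have -> : n%:R * (d / 2 * n%:R ^+ r) = d * (n%:R * n%:R ^+ r) - d * n%:R / 2 * n%:R ^+ r by field.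
    by rewrite lerBlDr.
  by rewrite ler_pM2l.
have tn : t%:R <= d * n%:R / 4.
  have := hN2 n nN2; rewrite ler_pdivrMr // => h; lra.
have low : (d / 2 * n%:R ^+ r) * (d * n%:R / 4) ^+ t
          <= (\sum_Q 'C(#|D Q|, t))%N%:R * (t`!)%:R :> R.
  apply: (@le_trans _ _ (#|good|%:R * (d * n%:R / 4) ^+ t)).
    by rewrite ler_wpM2r ?exprn_ge0 //; nra.
  rewrite -natrM big_distrl /= natr_sum.
  rewrite -sum1_card natr_sum big_distrl /= big_mkcond /=.
  apply: ler_sum => Q _; case: ifP => [|_]; last by rewrite ler0n.
  rewrite inE mul1r bin_ffact => h.
  apply: (@le_trans _ _ ((#|D Q| - t) ^ t)%N%:R); last by rewrite ler_nat leq_exp_ffact.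
  rewrite natrX; apply: lerXn2r; rewrite ?nnegrE //; first by nra.
  rewrite natrB; first by lra.
  by rewrite -(ler_nat R); have := mulr_gt0 d0 n0; lra.
rewrite -lowsum in low; have := le_trans low up.
rewrite /d1 !exprMn.
set a := n%:R ^+ r; set b := (d / 4) ^+ t; set c := n%:R ^+ t => h.
have a0 : 0 < a by apply: exprn_gt0.
have b0 : 0 < b by rewrite exprn_gt0 // divr_gt0.
have c0 : 0 < c by apply: exprn_gt0.
have e : (d * n%:R / 4) ^+ t = b * c.
  by rewrite /b /c -exprMn; congr (_ ^+ _); ring.
move: h; have -> : d ^+ t * n%:R ^+ t * 4^-1 ^+ t = b * c by rewrite -e !exprMn.
have -> : d ^+ t * 4^-1 ^+ t = b by rewrite -exprMn.
have : 0 < d * (a * b * c) by rewrite !mulr_gt0.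
by move=> h1 h2; lra.
Qed.

(** * Clique densities *)

Definition cliq k G (Q : {ffun 'I_k -> G}) : bool :=
  [forall i, forall j, (i != j) ==> adj (Q i) (Q j)].

Definition comn k G (Q : {ffun 'I_k -> G}) (v : G) : bool :=
  [forall i, adj (Q i) v].

Definition wt R k G (w : G -> R) (Q : {ffun 'I_k -> G}) : R :=
  \prod_i w (Q i).

Definition cn R k G (w : G -> R) (Q : {ffun 'I_k -> G}) : R :=
  \sum_(v | comn Q v) w v.

(** For weights of sum 1 this is the probability that [k] independent random vertices are pairwise
    adjacent; cliques are ordered, as functions on ['I_k]. *)
Definition clw R G (w : G -> R) k : R :=
  \sum_(Q : {ffun 'I_k -> G} | cliq Q) wt w Q.

Lemma cliqP k G (Q : {ffun 'I_k -> G}) :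
  reflect (forall i j, i != j -> adj (Q i) (Q j)) (cliq Q).
Proof.
apply: (iffP forallP) => [h i j ij|h i]; last first.
  by apply/forallP => j; apply/implyP; apply: h.
by have /forallP/(_ j)/implyP := h i; apply.
Qed.

Lemma comnP k G (Q : {ffun 'I_k -> G}) v :
  reflect (forall i, adj (Q i) v) (comn Q v).
Proof. exact: forallP. Qed.

Lemma cliq_insf k G (i : 'I_k.+1) v (Q : {ffun 'I_k -> G}) :
  cliq (insf i v Q) = cliq Q && comn Q v.
Proof.
apply/cliqP/andP => [h|[/cliqP hQ /comnP hv]].
  split; first apply/cliqP => a b ab.
    have := h (lift i a) (lift i b); rewrite !insf_lift; apply.
    by rewrite (inj_eq lift_inj).
  apply/comnP => a; have := h (lift i a) i; rewrite insf_lift insfE; apply.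
  by rewrite eq_sym neq_lift.
move=> a b; case: (unliftP i a) => [a'|] ->; case: (unliftP i b) => [b'|] ->;
  rewrite ?insf_lift ?insfE ?eqxx //.
- by rewrite (inj_eq lift_inj); apply: hQ.
- by rewrite adj_sym.
Qed.

Lemma comn_insf k G (i : 'I_k.+1) v (Q : {ffun 'I_k -> G}) u :
  comn (insf i v Q) u = comn Q u && adj v u.
Proof.
apply/comnP/andP => [h|[/comnP h1 h2] j].
  split; last by have := h i; rewrite insfE.
  by apply/comnP => j; have := h (lift i j); rewrite insf_lift.
by case: (unliftP i j) => [j'|] ->; rewrite ?insf_lift ?insfE.
Qed.

Lemma wt_insf R k G (w : G -> R) (i : 'I_k.+1) v
    (Q : {ffun 'I_k -> G}) : wt w (insf i v Q) = wt w Q * w v.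
Proof.
rewrite /wt (bigD1_ord i) //= insfE mulrC; congr (_ * _).
by apply: eq_bigr => j _; rewrite insf_lift.
Qed.

Lemma wt_ge0 R k G (w : G -> R) (Q : {ffun 'I_k -> G}) :
  (forall v, 0 <= w v) -> 0 <= wt w Q.
Proof. by move=> w0; apply: prodr_ge0. Qed.

Lemma cn_le1 R k G (w : G -> R) (Q : {ffun 'I_k -> G}) :
  (forall v, 0 <= w v) -> \sum_v w v = 1 -> cn w Q <= 1.
Proof.
move=> w0 w1; rewrite -w1 /cn big_mkcond /=; apply: ler_sum => v _.
by case: ifP.
Qed.

Lemma big_cliqS R k G (i : 'I_k.+1) (w : G -> R)
    (F : {ffun 'I_k.+1 -> G} -> R) :
  \sum_(Q | cliq Q) wt w Q * F Q =
  \sum_(Q : {ffun 'I_k -> G} | cliq Q) wt w Q *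
     \sum_(v | comn Q v) w v * F (insf i v Q).
Proof.
rewrite big_mkcond (big_insf _ i) /= [RHS]big_mkcond /=.
apply: eq_bigr => Q _; case: ifP => cQ; last first.
  by apply: big1 => v _; rewrite cliq_insf cQ.
rewrite big_distrr /= [RHS]big_mkcond /=; apply: eq_bigr => v _.
by rewrite cliq_insf cQ wt_insf mulrA.
Qed.

Lemma clwS R G (w : G -> R) k :
  clw w k.+1 = \sum_(Q : {ffun 'I_k -> G} | cliq Q) wt w Q * cn w Q.
Proof.
rewrite /clw; under eq_bigr do rewrite -[wt w _]mulr1.
rewrite (big_cliqS ord0); apply: eq_bigr => Q _; congr (_ * _).
by apply: eq_bigr => v _; rewrite mulr1.
Qed.

Lemma clw_delf R k G (i : 'I_k.+1) (w : G -> R)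
    (F : {ffun 'I_k -> G} -> R) :
  \sum_(Q | cliq Q) wt w Q * F (delf i Q) =
  \sum_(Q : {ffun 'I_k -> G} | cliq Q) wt w Q * (cn w Q * F Q).
Proof.
rewrite (big_cliqS i); apply: eq_bigr => Q _; congr (_ * _).
by rewrite /cn big_distrl /=; apply: eq_bigr => v _; rewrite insfK.
Qed.

Lemma clw_ge0 R G (w : G -> R) k :
  (forall v, 0 <= w v) -> 0 <= clw w k.
Proof. by move=> w0; apply: sumr_ge0 => Q _; apply: wt_ge0. Qed.

Lemma clw0 R G (w : G -> R) : clw w 0 = 1.
Proof.
pose Q0 : {ffun 'I_0 -> G} := [ffun i : 'I_0 => False_rect G (notF (ltn_ord i))].
rewrite /clw (bigD1 Q0) /=; last by apply/cliqP => -[].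
rewrite /wt big_ord0 big1 ?addr0 // => Q /andP[_ /eqP []].
by apply/ffunP => -[].
Qed.

Lemma clw1 R G (w : G -> R) : clw w 1 = \sum_v w v.
Proof.
rewrite clwS -[RHS]mul1r -[X in _ = X * _](clw0 w) /clw big_distrl /=.
apply: eq_bigr => Q _; congr (_ * _); apply: eq_bigl => v.
by apply/comnP => -[].
Qed.

Lemma clw2 R G (w : G -> R) :
  clw w 2 = \sum_u \sum_(v | adj u v) w u * w v.
Proof.
rewrite clwS (eq_bigr (fun Q => wt w Q * cn w Q)) // (big_cliqS ord0).
rewrite -[RHS]mul1r -[X in _ = X * _](clw0 w) /clw big_distrl /=.
apply: eq_bigr => Q _; congr (_ * _).
rewrite [LHS]big_mkcond /=; apply: eq_bigr => v _.
rewrite (_ : comn Q v); last by apply/comnP => -[].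
rewrite /cn big_distrr /=; apply: eq_bigl => u.
by rewrite comn_insf andbC; case: (adj v u) => //=; apply/comnP => -[].
Qed.

(** The polynomial [sum w (c - t)^2] in [t] is nonnegative; it is evaluated at its minimum
    [t = B / A]. *)
Lemma weighted_cauchy R (I : finType) (P : pred I) (w c : I -> R) :
  (forall i, P i -> 0 <= w i) ->
  (\sum_(i | P i) w i * c i) ^+ 2 <=
  (\sum_(i | P i) w i) * \sum_(i | P i) w i * c i ^+ 2.
Proof.
move=> w0; set A := \sum_(i | P i) w i; set B := \sum_(i | P i) w i * c i.
set C := \sum_(i | P i) w i * c i ^+ 2.
have h t : 0 <= C - 2 * t * B + t ^+ 2 * A.
  have -> : C - 2 * t * B + t ^+ 2 * A = \sum_(i | P i) w i * (c i - t) ^+ 2.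
    rewrite /C /B /A !big_distrr /= -sumrB -big_split /=.
    by apply: eq_bigr => i _; ring.
  by apply: sumr_ge0 => i Pi; rewrite mulr_ge0 ?sqr_ge0 ?w0.
have A0 : 0 <= A by apply: sumr_ge0.
have [A1|A1] := lerP A 0.
  have Az : A = 0 by apply/eqP; rewrite eq_le A1 A0.
  have Bz : B = 0.
    apply: big1 => i Pi; have -> := (psumr_eq0P w0 Az) i Pi.
    by rewrite mul0r.
  by rewrite Az Bz mul0r expr0n.
have := h (B / A).
have -> : C - 2 * (B / A) * B + (B / A) ^+ 2 * A = C - B ^+ 2 / A.
  by field; rewrite gt_eqF.
by rewrite subr_ge0 ler_pdivrMr // mulrC.
Qed.

(* For a clique [Q] of size [k+1], a vertex is adjacent to at most one of the
   sets [Q \ q_i], unless it is adjacent to all of [Q]. *)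
Lemma sum_cn_delf R k G (w : G -> R)
    (Q : {ffun 'I_k.+1 -> G}) :
  \sum_v w v + k%:R * cn w Q - \sum_i cn w (delf i Q) =
  \sum_v w v * (1 + k%:R * (comn Q v)%:R - \sum_i (comn (delf i Q) v)%:R).
Proof.
rewrite /cn [X in k%:R * X]big_mkcond /= [in LHS]big_distrr /= -big_split /=.
rewrite (eq_bigr (fun i => \sum_v w v * (comn (delf i Q) v)%:R)) => [|i _].
  rewrite exchange_big /= -sumrB; apply: eq_bigr => v _.
  rewrite mulrBr [in RHS]big_distrr /=; congr (_ - _).
  by case: (comn Q v); rewrite /=; ring.
rewrite big_mkcond; apply: eq_bigr => v _.
by case: (comn _ v); rewrite ?mulr1 ?mulr0.
Qed.

(** Equality holds in each case: for [v] adjacent to all of [Q] the right side is [1 + k - (k + 1)],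
    for exactly one set [Q] minus a point it is [1 - 1], and for none it is 1. *)
Lemma comn_delf_count R k G (Q : {ffun 'I_k.+1 -> G}) v :
  (~~ [exists i, comn (delf i Q) v])%:R <=
  1 + k%:R * (comn Q v)%:R - \sum_i (comn (delf i Q) v)%:R :> R.
Proof.
have comE i : comn (delf i Q) v -> (forall j, j != i -> adj (Q j) v).
  move=> /comnP h j ij; case: (unliftP i j) => [j'|] e; last by rewrite e eqxx in ij.
  by have := h j'; rewrite ffunE -e.
have [cQ|ncQ] := boolP (comn Q v).
  have h i : comn (delf i Q) v.
    by apply/comnP => j; rewrite ffunE; apply: (comnP _ _ cQ).
  rewrite (eq_bigr (fun=> 1)) => [|i _]; last by rewrite h.
  rewrite sumr_const card_ord -natr1.
  have -> : [exists i, comn (delf i Q) v] by apply/existsP; exists ord0.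
  by rewrite /=; lra.
have [/existsP[i hi]|ne] := boolP [exists i, comn (delf i Q) v].
  rewrite (bigD1 i) //= hi big1 /= ?mulr0 => [|j ji]; first by lra.
  apply/eqP; rewrite pnatr_eq0 eqb0; apply: contra ncQ => hj.
  apply/comnP => l; have [->|li] := eqVneq l i; last exact: comE li.
  by apply: (comE j hj); rewrite eq_sym.
rewrite big1 /= ?mulr0 => [|j _]; first by lra.
apply/eqP; rewrite pnatr_eq0 eqb0; apply: contra ne => hj.
by apply/existsP; exists j.
Qed.

(** Cauchy-Schwarz over [k]-cliques bounds the square of the first moment of [cn] by its second
    moment [S2]. Counted through [(k+1)]-cliques with one vertex deleted, [k.+1 * S2] is bounded by
    summing [comn_delf_count]. *)
Lemma moon_moser R G (w : G -> R) k :
  (forall v, 0 <= w v) -> \sum_v w v = 1 ->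
  k.+1%:R * clw w k.+1 ^+ 2 <= clw w k * (clw w k.+1 + k%:R * clw w k.+2).
Proof.
move=> w0 w1.
set S2 := \sum_(Q : {ffun 'I_k -> G} | cliq Q) wt w Q * cn w Q ^+ 2.
have h1 : clw w k.+1 ^+ 2 <= clw w k * S2.
  by rewrite clwS; apply: weighted_cauchy => Q _; apply: wt_ge0.
have h2 : k.+1%:R * S2 <= clw w k.+1 + k%:R * clw w k.+2.
  have -> : k.+1%:R * S2 = \sum_(Q : {ffun 'I_k.+1 -> G} | cliq Q) wt w Q *
      \sum_i cn w (delf i Q).
    under eq_bigr do rewrite big_distrr /=.
    rewrite exchange_big /= (eq_bigr (fun=> S2)) => [|i _].
      by rewrite sumr_const card_ord mulr_natl.
    by rewrite (clw_delf i); apply: eq_bigr => Q _; rewrite expr2.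
  have -> : clw w k.+1 + k%:R * clw w k.+2 =
      \sum_(Q : {ffun 'I_k.+1 -> G} | cliq Q) wt w Q * (1 + k%:R * cn w Q).
    rewrite (clwS w k.+1) big_distrr /= /clw -big_split /=; apply: eq_bigr => Q _.
    by ring.
  apply: ler_sum => Q _; apply: ler_wpM2l; first exact: wt_ge0.
  rewrite -subr_ge0; have := sum_cn_delf w Q; rewrite w1 => ->.
  apply: sumr_ge0 => v _.
  by apply: mulr_ge0 => //; apply: le_trans (comn_delf_count _ _ _).
have := clw_ge0 k w0 => h3; have : 0 <= k.+1%:R :> R by [].
by move=> h4; nra.
Qed.

Lemma clw_le R G (w : G -> R) k :
  (forall v, 0 <= w v) -> \sum_v w v = 1 -> clw w k.+1 <= clw w k.
Proof.
move=> w0 w1; rewrite clwS /clw; apply: ler_sum => Q _.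
by rewrite ler_piMr ?wt_ge0 ?cn_le1.
Qed.

(** By Moon-Moser, the lower bound on the ratio of successive clique weights falls by only
    [1 - clw w 2] at each step. *)
Lemma clw_ratio R G (w : G -> R) k :
  (forall v, 0 <= w v) -> \sum_v w v = 1 ->
  clw w k * (1 - k%:R * (1 - clw w 2)) <= clw w k.+1.
Proof.
move=> w0 w1; elim: k => [|k IH]; first by rewrite clw0 clw1 w1; lra.
case: k IH => [|k] IH; first by rewrite clw1 w1; lra.
have := moon_moser k.+1 w0 w1.
have := clw_ge0 k.+3 w0; have := clw_ge0 k.+2 w0; have := clw_ge0 k.+1 w0.
have := clw_le k.+1 w0 w1; move: IH; rewrite -(natr1 k.+1).
have : 0 < k.+1%:R :> R by rewrite ltr0n.
set q := k.+1%:R; set A := clw w k.+1; set B := clw w k.+2; set C := clw w k.+3.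
set e := clw w 2 => q0 IH BA A0 B0 C0 MM.
have [B1|B1] := lerP B 0.
  have -> : B = 0 by apply/eqP; rewrite eq_le B1.
  by rewrite mul0r.
have A1 : 0 < A by apply: lt_le_trans B1 BA.
rewrite -(ler_pM2l A1) -(ler_pM2l q0).
have : B * (A * (1 - q * (1 - e))) <= B * B by rewrite ler_pM2l.
by move=> h; nra.
Qed.

(** A clique [Q] of size [k+1] that is at least as good as the average splits the graph: [v] gets
    colour [i] if it is adjacent to all of [Q] but [q_i]. Vertices without a colour weigh at most
    [L Q], and an edge inside colour [i] extends [Q] minus [q_i] to a [(k+2)]-clique. *)
Lemma clique_partition R G (w : G -> R) k :
  (forall v, 0 <= w v) -> \sum_v w v = 1 ->
  0 < clw w k.+1 ->
  exists f : G -> 'I_k.+1,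
    (\sum_u \sum_(v | adj u v && (f u == f v)) w u * w v) * clw w k.+1 <=
    2 * clw w k.+1 * (1 - k.+1%:R * (1 - k%:R * (1 - clw w 2)))
    + 4 * k.+1%:R * clw w k.+2.
Proof.
move=> w0 w1 T0.
pose inn (Q : {ffun 'I_k -> G}) : R :=
  \sum_(u | comn Q u) \sum_(v | comn Q v && adj u v) w u * w v.
have inn0 Q : 0 <= inn Q.
  by apply: sumr_ge0 => u _; apply: sumr_ge0 => v _; apply: mulr_ge0.
have innT : \sum_(Q : {ffun 'I_k -> G} | cliq Q) wt w Q * inn Q = clw w k.+2.
  rewrite clwS (big_cliqS ord0); apply: eq_bigr => Q _; congr (_ * _).
  apply: eq_bigr => u _; rewrite /cn big_distrr /=; apply: eq_bigl => v.
  by rewrite comn_insf.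
pose L (Q : {ffun 'I_k.+1 -> G}) : R := 1 + k%:R * cn w Q - \sum_i cn w (delf i Q).
pose bad Q := 2 * L Q + \sum_i inn (delf i Q).
have LE Q : \sum_(v | ~~ [exists i, comn (delf i Q) v]) w v <= L Q.
  have := sum_cn_delf w Q; rewrite w1 /L => ->; rewrite big_mkcond /=.
  apply: ler_sum => v _; have := comn_delf_count R Q v; case: ifP => /= h h'.
    by have := w0 v; nra.
  by apply: mulr_ge0.
set S2 := \sum_(Q : {ffun 'I_k -> G} | cliq Q) wt w Q * cn w Q ^+ 2.
have sumL : \sum_(Q | cliq Q) wt w Q * L Q = clw w k.+1 + k%:R * clw w k.+2 - k.+1%:R * S2.
  have -> : k.+1%:R * S2 = \sum_(Q : {ffun 'I_k.+1 -> G} | cliq Q) wt w Q *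
      \sum_i cn w (delf i Q).
    under eq_bigr do rewrite big_distrr /=.
    rewrite exchange_big /= (eq_bigr (fun=> S2)) => [|i _].
      by rewrite sumr_const card_ord mulr_natl.
    by rewrite (clw_delf i); apply: eq_bigr => Q _; rewrite expr2.
  rewrite (clwS w k.+1) big_distrr /= /clw -big_split /= -sumrB.
  by apply: eq_bigr => Q _; rewrite /L; ring.
have sumI : \sum_(Q | cliq Q) wt w Q * (\sum_i inn (delf i Q)) <= k.+1%:R * clw w k.+2.
  under eq_bigr do rewrite big_distrr /=.
  rewrite exchange_big /=.
  apply: (@le_trans _ _ (\sum_(i < k.+1) clw w k.+2)); last first.
    by rewrite sumr_const card_ord mulr_natl.
  apply: ler_sum => i _; rewrite (clw_delf i) -innT; apply: ler_sum => Q _.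
  by rewrite ler_wpM2l ?wt_ge0 // ler_piMl ?cn_le1.
have S2E : clw w k.+1 * (1 - k%:R * (1 - clw w 2)) <= S2.
  have h1 : clw w k.+1 ^+ 2 <= clw w k * S2.
    by rewrite clwS; apply: weighted_cauchy => Q _; apply: wt_ge0.
  have h2 := clw_ratio k w0 w1.
  have h3 : 0 < clw w k by apply: lt_le_trans T0 (clw_le k w0 w1).
  rewrite -(ler_pM2l h3); apply: le_trans h1.
  by rewrite expr2; nra.
have [Q cQ hQ] : exists2 Q : {ffun 'I_k.+1 -> G}, cliq Q &
   bad Q * clw w k.+1 <= 2 * clw w k.+1 * (1 - k.+1%:R * (1 - k%:R * (1 - clw w 2)))
    + 4 * k.+1%:R * clw w k.+2.
  set B := 2 * _ * _ + _.
  (* If every clique exceeded [B], the nonnegative weighted excesses would have a sum at most 0, so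
     all clique weights, and hence [clw w k.+1], would vanish. *)
  apply: contrapT => noQ.
  have gt Q : cliq Q -> B < bad Q * clw w k.+1.
    by move=> cQ; rewrite ltNge; apply/negP => h; apply: noQ; exists Q.
  have s0 : \sum_(Q : {ffun 'I_k.+1 -> G} | cliq Q)
      wt w Q * (bad Q * clw w k.+1 - B) = 0.
    apply/eqP; rewrite eq_le; apply/andP; split; last first.
      by apply: sumr_ge0 => Q cQ; rewrite mulr_ge0 ?wt_ge0 ?subr_ge0 ?ltW ?gt.
    have -> : \sum_(Q | cliq Q) wt w Q * (bad Q * clw w k.+1 - B) =
        (\sum_(Q | cliq Q) wt w Q * bad Q - B) * clw w k.+1.
      have e : B * clw w k.+1 = \sum_(Q : {ffun 'I_k.+1 -> G} | cliq Q) wt w Q * B.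
        by rewrite /clw mulrC big_distrl.
      rewrite mulrBl e [in RHS]big_distrl /= -sumrB.
      by apply: eq_bigr => Q _; ring.
    have -> : \sum_(Q | cliq Q) wt w Q * bad Q = 2 * (\sum_(Q | cliq Q) wt w Q * L Q) +
        \sum_(Q | cliq Q) wt w Q * (\sum_i inn (delf i Q)).
      by rewrite big_distrr /= -big_split /=; apply: eq_bigr => Q _; rewrite /bad; ring.
    have c0 := clw_ge0 k.+2 w0.
    have hk : 0 <= k%:R :> R by [].
    have h : k.+1%:R * (clw w k.+1 * (1 - k%:R * (1 - clw w 2))) <= k.+1%:R * S2.
      by rewrite ler_wpM2l.
    rewrite pmulr_lle0 // sumL /B; rewrite -(natr1 k) in h sumI *.
    by move: h sumI; set t2 := 1 - clw w 2; nra.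
  have : clw w k.+1 = 0.
    apply: big1 => Q cQ; apply/eqP.
    have pos Q' : cliq Q' -> 0 <= wt w Q' * (bad Q' * clw w k.+1 - B).
      by move=> cQ'; rewrite mulr_ge0 ?wt_ge0 ?subr_ge0 ?ltW ?gt.
    have /eqP := (psumr_eq0P pos s0) Q cQ.
    by rewrite mulf_eq0 subr_eq0 [_ == B]gt_eqF ?gt // orbF.
  by move=> z; rewrite z ltxx in T0.
(* Vertices in [lo] fall into class [ord0] by default; their edges are charged to [2 * W]. *)
pose f v := if [pick i | comn (delf i Q) v] is Some i then i else ord0.
exists f; apply: le_trans hQ; rewrite ler_pM2r //.
pose lo v := ~~ [exists i, comn (delf i Q) v].
have fP v : ~~ lo v -> comn (delf (f v) Q) v.
  rewrite negbK => /existsP[i hi]; rewrite /f; case: pickP => // /(_ i).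
  by rewrite hi.
pose W := \sum_(v | lo v) w v.
apply: (@le_trans _ _ (2 * W + \sum_i inn (delf i Q))); last first.
  by rewrite lerD2r ler_wpM2l // LE.
have -> : 2 * W = \sum_u \sum_v ((lo u)%:R + (lo v)%:R) * (w u * w v).
  have e1 : W = \sum_v (lo v)%:R * w v.
    by rewrite /W big_mkcond; apply: eq_bigr => v _; case: (lo v); rewrite ?mul1r ?mul0r.
  under eq_bigr => u _ do (rewrite (eq_bigr (fun v => (lo u)%:R * w u * w v + w u * ((lo v)%:R * w v)));
     last by (move=> v _; ring)).
  under eq_bigr => u _ do rewrite big_split /= -!big_distrr /= w1 mulr1 -e1.
  by rewrite big_split /= -e1 -big_distrl /= w1; ring.
have -> : \sum_i inn (delf i Q) = \sum_u \sum_v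
    \sum_i ((comn (delf i Q) u && (comn (delf i Q) v && adj u v))%:R * (w u * w v)).
  under [RHS]eq_bigr => u _ do rewrite exchange_big /=.
  rewrite [RHS]exchange_big /=; apply: eq_bigr => i _; rewrite /inn big_mkcond /=.
  apply: eq_bigr => u _; case: (comn _ u) => /=; last first.
    by rewrite big1 // => v _; rewrite mul0r.
  rewrite big_mkcond /=; apply: eq_bigr => v _.
  by case: (_ && _); rewrite ?mul1r ?mul0r.
rewrite -big_split /=; apply: ler_sum => u _; rewrite big_mkcond -big_split /=.
apply: ler_sum => v _; have wuv : 0 <= w u * w v by apply: mulr_ge0.
have sge (i0 : 'I_k.+1) (b : 'I_k.+1 -> bool) : b i0 ->
    w u * w v <= \sum_i (b i)%:R * (w u * w v).
  move=> bi; rewrite (bigD1 i0) //= bi mul1r lerDl; apply: sumr_ge0 => i _.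
  by rewrite mulr_ge0.
have s0 (b : 'I_k.+1 -> bool) : 0 <= \sum_i (b i)%:R * (w u * w v).
  by apply: sumr_ge0 => i _; rewrite mulr_ge0.
case: ifP => [/andP[auv /eqP fuv]|_]; last first.
  by apply: addr_ge0; [apply: mulr_ge0 => //; apply: addr_ge0 | apply: s0].
have [lu|lu] := boolP (lo u); first by have := s0 (fun i => comn (delf i Q) u && (comn (delf i Q) v && adj u v)); case: (lo v) => /=; lra.
have [lv|lv] := boolP (lo v); first by have := s0 (fun i => comn (delf i Q) u && (comn (delf i Q) v && adj u v)) => /=; lra.
rewrite /= add0r mul0r add0r; apply: (sge (f u)).
by rewrite fP // fuv fP // auv.
Qed.

(** * Spectral stability *)

Definition has_complete_partite G r t :=
  exists S : 'I_r -> {set G}, (forall i, #|S i| = t) /\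
    forall i j u v, i != j -> u \in S i -> v \in S j -> adj u v.

Lemma sqr_sum_le R (I : finType) (P : pred I) (c : I -> R) :
  (\sum_(i | P i) c i) ^+ 2 <= #|P|%:R * \sum_(i | P i) c i ^+ 2.
Proof.
have := @weighted_cauchy R I P (fun=> 1) c (fun _ _ => ler01).
rewrite sumr_const; congr (_ ^+ 2 <= _ * _); apply: eq_bigr => i _;
by rewrite mul1r.
Qed.

(** In a complete [r]-partite configuration of clique tuples, two vertices of different classes
    extend to a tuple, whose other entries exist as [t > 0], and so they are adjacent. *)
Lemma few_cliques R (r t : nat) (d : R) : (0 < t)%N -> 0 < d ->
  exists N, forall G : sgraph, (N <= #|G|)%N -> ~ has_complete_partite G r t ->
    #|[set Q : {ffun 'I_r -> G} | cliq Q]|%:R <= d * #|G|%:R ^+ r.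
Proof.
move=> t0 d0; have [N hN] := dense_complete_partite r t d0.
exists N => G NG noK; rewrite leNgt; apply/negP => h; apply: noK.
have [S [St hS]] := hN _ _ NG (ltW h); exists S; split=> // i j u v ij uS vS.
have /choice[z hz] : forall l, exists z, z \in S l.
  by move=> l; apply/card_gt0P; rewrite St.
pose Q := [ffun l => if l == i then u else if l == j then v else z l].
have : Q \in [set Q : {ffun 'I_r -> G} | cliq Q]%SET.
  by apply: hS => l; rewrite ffunE; case: eqP => [->|_] //; case: eqP => [->|].
rewrite inE => /cliqP/(_ i j ij); rewrite !ffunE !eqxx.
by rewrite eq_sym (negbTE ij).
Qed.

(** The last identity reduces closeness of [x] to the constant 1 to showing that the sum of [x] is
    nearly [#|G|]. *)
Lemma perron_facts R G (x : G -> R) (r : R) :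
  perron x r ->
  [/\ qform x = r * #|G|%:R, \sum_v x v <= #|G|%:R &
      \sum_v (x v - 1) ^+ 2 = 2 * #|G|%:R - 2 * \sum_v x v].
Proof.
move=> [x0 x1 xe]; split.
- by rewrite -x1 big_distrr /=; apply: eq_bigr => v _; rewrite xe expr2; ring.
- have := sqr_sum_le predT x; rewrite x1 => h.
  have n0 : 0 <= #|G|%:R :> R by [].
  have Y0 : 0 <= \sum_v x v by apply: sumr_ge0.
  rewrite -(@ler_pXn2r _ 2) ?nnegrE //.
- have -> : \sum_v (x v - 1) ^+ 2 = \sum_v x v ^+ 2 - 2 * \sum_v x v + \sum_(v : G) 1.
    by rewrite big_distrr /= -sumrB -big_split /=; apply: eq_bigr => v _; ring.
  by rewrite x1 sumr_const; ring.
Qed.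

Lemma nb_le_sum R G (x : G -> R) (v : G) :
  (forall u, 0 <= x u) -> nb x v <= \sum_u x u.
Proof.
by move=> x0; rewrite /nb big_mkcond; apply: ler_sum => u _; case: ifP.
Qed.

(** Serves to fix small constants: the arguments are thresholds to stay below, repeated when fewer
    than four are required. *)
Lemma exists_pos_le4 R (a b c d : R) : 0 < a -> 0 < b -> 0 < c -> 0 < d ->
  exists h, [/\ 0 < h, h <= a, h <= b, h <= c & h <= d].
Proof.
move=> a0 b0 c0 d0; exists (Num.min a (Num.min b (Num.min c d))).
by rewrite !lt_min a0 b0 c0 d0 !ge_min !lexx !orbT.
Qed.

(* With the weights [w = x / sum x] the edge density [clw w 2] equals
   [r n / (sum x)^2 >= r / n], so few [(k+2)]-cliques make Moon-Moser tight. *)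
Lemma spectral_stability R (k t : nat) (C e : R) :
  (0 < k)%N -> (0 < t)%N -> 0 < e ->
  exists N, forall G (x : G -> R) (r : R), (N <= #|G|)%N ->
    ~ has_complete_partite G k.+2 t -> perron x r ->
    (1 - k.+1%:R^-1) * #|G|%:R - C <= r ->
  [/\ \sum_v `|x v - 1| <= e * #|G|%:R,
      r <= (1 - k.+1%:R^-1 + e) * #|G|%:R &
      exists f : G -> 'I_k.+1,
       \sum_u \sum_(v | adj u v && (f u == f v)) 1 <= e * #|G|%:R ^+ 2].
Proof.
move=> k0 t0 e0; set p : R := k.+1%:R.
have pE : k.+1%:R = p by [].
have p2 : 2 <= p by rewrite /p (ler_nat R 2).
clearbody p.
have pi0 : 0 < p^-1 by rewrite invr_gt0; lra.
have pip : p * p^-1 = 1 by rewrite divff // gt_eqF //; lra.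
have pi2 : p^-1 <= 2^-1 by rewrite lef_pV2 // posrE; lra.
set a := 1 - p^-1.
have a2 : 2^-1 <= a by rewrite /a; lra.
pose e1 := e / 8.
have e10 : 0 < e1 by rewrite /e1; lra.
have p0 : 0 < p by lra.
have e20 : 0 < e1 ^+ 2 by apply: exprn_gt0.
have p20 : 0 < p ^+ 2 by apply: exprn_gt0.
have [h [h0 h1 h2 h3 _]] := exists_pos_le4
  (divr_gt0 (ltr0n R 1) (mulr_gt0 (ltr0n R 2) p20)) (divr_gt0 e20 (ltr0n R 8))
  (divr_gt0 e0 (mulr_gt0 (ltr0n R 8) p20)) p20.
rewrite ler_pdivlMr ?mulr_gt0 // in h1.
rewrite ler_pdivlMr ?mulr_gt0 // in h3.
have [nu [nu0 nu1 nu2 nu3 _]] := exists_pos_le4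
  (divr_gt0 e0 (ltr0n R 2)) (divr_gt0 e20 (ltr0n R 8))
  (divr_gt0 e0 (mulr_gt0 (ltr0n R 16) p0)) p0.
rewrite ler_pdivlMr ?mulr_gt0 // in nu3.
(* Each of the [k+1] successive clique ratios will be at least [p^-1 / 2], so [c0] bounds
   [clw w k.+1] from below. *)
pose c0 := (p^-1 / 2) ^+ k.+1.
have c00 : 0 < c0 by rewrite exprn_gt0 // divr_gt0.
(* Entries of [w] are at most [8 / n], so at most [d n ^ k.+2] cliques of size [k+2] weigh at most
   [nu * c0] together. *)
pose d := nu * c0 / 8 ^+ k.+2.
have d0 : 0 < d by rewrite !mulr_gt0 // invr_gt0 exprn_gt0.
have [N1 hN1] := few_cliques k.+2 t0 d0.
have [N2 hN2] := exists_nat_ge (4 * C).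
have [N3 hN3] := exists_nat_ge (C / h).
exists (maxn 1 (maxn N1 (maxn N2 N3))) => G x r.
rewrite !geq_max => /andP[nn0 /andP[nN1 /andP[nN2 nN3]]] noK px hr.
have := perron_facts px; have [x0 x1 xe] := px.
set n : R := #|G|%:R in hr hN1 hN2 hN3 x1 * => -[qx Yn sqx].
have n0 : 0 < n by rewrite ltr0n.
have hC1 : 4 * C <= n by apply: hN2.
have hC2 : C <= h * n by have := hN3 _ nN3; rewrite ler_pdivrMr // mulrC.
set Y := \sum_v x v in Yn sqx.
have Y0 : 0 <= Y by apply: sumr_ge0.
have rn : n / 4 <= r by move: hr hC1 a2 n0; clear; nra.
have r0 : 0 < r by move: rn n0; clear; lra.
have rY : r * n <= Y ^+ 2.
  rewrite -qx /qform expr2 {1}/Y big_distrl /=; apply: ler_sum => v _.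
  by apply: ler_wpM2l => //; apply: nb_le_sum.
have Yn2 : n / 2 <= Y.
  rewrite -(@ler_pXn2r _ 2) ?nnegrE //; first by move: rY rn n0; clear; nra.
  by apply: divr_ge0 => //; apply: ltW.
have Y1 : 0 < Y by move: Yn2 n0; clear; lra.
have x4 v : x v <= 4.
  have := nb_le_sum v x0; rewrite xe -/Y => hv.
  have : n / 4 * x v <= n by apply: le_trans (le_trans hv Yn); apply: ler_wpM2r.
  by move: n0; clear; nra.
pose w v := x v / Y.
have w0 v : 0 <= w v by apply: divr_ge0.
have w1 : \sum_v w v = 1 by rewrite -big_distrl /= divff // gt_eqF.
have w8 v : w v <= 8 / n.
  by rewrite ler_pdivrMr // mulrAC ler_pdivlMr //; have := x4 v; move: n0 Yn2; clear; nra.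
set T2 := clw w 2.
have T2E : T2 * Y ^+ 2 = r * n.
  rewrite /T2 clw2 -qx qformE big_distrl /=; apply: eq_bigr => u _.
  by rewrite big_distrl /=; apply: eq_bigr => v _; rewrite /w; field; rewrite gt_eqF.
have T2lo : 1 - T2 <= p^-1 + h.
  have : r <= T2 * n.
    rewrite -(ler_pM2r n0) -T2E -mulrA; apply: ler_wpM2l; first exact: clw_ge0.
    by move: Y0 Yn n0; clear; nra.
  move=> h'; have : a * n - h * n <= T2 * n by move: hr hC2 h'; clear; lra.
  by rewrite -mulrBl ler_pM2r // /a; clear; lra.
have Tp1 : clw w k.+2 <= nu * c0.
  apply: (@le_trans _ _ (\sum_(Q : {ffun 'I_k.+2 -> G} | cliq Q) (8 / n) ^+ k.+2)).
    apply: ler_sum => Q _; rewrite /wt -[X in _ <= _ ^+ X](card_ord k.+2) -prodr_const.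
    by apply: ler_prod => i _; rewrite w0 w8.
  have e8 : 0 < (8 / n) ^+ k.+2 by rewrite exprn_gt0 // divr_gt0.
  have -> : nu * c0 = d * n ^+ k.+2 * (8 / n) ^+ k.+2.
    rewrite /d expr_div_n; field.
    by rewrite !gt_eqF ?exprn_gt0.
  rewrite sumr_const -[_ *+ #|_|]mulr_natl ler_pM2r //.
  apply: le_trans (hN1 G nN1 noK); rewrite ler_nat.
  by apply: eq_leq; apply: eq_card => Q; rewrite inE.
have Tj j : (j <= k.+1)%N -> (p^-1 / 2) ^+ j <= clw w j.
  elim: j => [_|j IH jk]; first by rewrite clw0.
  rewrite exprSr; apply: le_trans (clw_ratio j w0 w1).
  have jR : j%:R <= p - 1 by rewrite -pE -natr1 addrK ler_nat.
  have hj : p^-1 / 2 <= 1 - j%:R * (1 - T2).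
    have : j%:R * (1 - T2) <= (p - 1) * (p^-1 + h).
      apply: (@le_trans _ _ (j%:R * (p^-1 + h))); first exact: ler_wpM2l.
      by apply: ler_wpM2r => //; move: h0 pi0; clear; lra.
    by move: h1 h0 p2 pip; rewrite expr2; clear; nra.
  apply: ler_pM => //; first by rewrite exprn_ge0 // divr_ge0 // ltW.
    by rewrite divr_ge0 // ltW.
  by apply: IH; apply: ltnW.
have Tp := Tj k.+1 (leqnn _); rewrite -/c0 in Tp.
set A := clw w k.+1 in Tp; have A0 : 0 < A by apply: lt_le_trans Tp.
have TpA : clw w k.+2 <= nu * A by apply: le_trans Tp1 _; rewrite ler_pM2l.
(* Few [(k+2)]-cliques cap the edge density: the ratio bound for [k.+1] yields
   [1 - p * (1 - T2) <= nu]. *)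
have T2hi : T2 <= a + nu.
  have := le_trans (clw_ratio k.+1 w0 w1) TpA.
  rewrite -/A mulrC ler_pM2r // pE -/T2 => h'.
  have : 1 - T2 >= p^-1 * (1 - nu).
    by rewrite -(ler_pM2l p0) mulrA pip; move: h'; clear; lra.
  by rewrite /a; move: nu0 pi0 pi2; clear; nra.
have rhi : r <= (a + nu) * n.
  have : T2 * Y ^+ 2 <= (a + nu) * n ^+ 2.
    apply: ler_pM => //; first exact: clw_ge0.
      by rewrite exprn_ge0.
    by rewrite ler_pXn2r // nnegrE // ltW.
  by rewrite T2E expr2 mulrA ler_pM2r.
(* As [r n = T2 Y ^ 2] with [T2 <= a + nu] and [r >= (a - h) n], the sum [Y] is nearly [n]; by
   [perron_facts], [x] is then close to 1. *)
have Ylo : n * (1 - 2 * (h + nu)) <= Y.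
  have y1 : r * n <= (a + nu) * (Y * n).
    rewrite -T2E; apply: ler_pM; rewrite ?exprn_ge0 ?clw_ge0 //.
    by rewrite expr2 ler_pM2l.
  have y2 : (a - h) * n <= (a + nu) * Y.
    rewrite -(ler_pM2r n0); apply: le_trans (_ : r * n <= _).
      by rewrite ler_pM2r //; move: hr hC2; clear; lra.
    by rewrite -mulrA.
  have y3 : (a + nu) * (n * (1 - 2 * (h + nu))) <= (a - h) * n.
    rewrite mulrCA [leRHS]mulrC ler_pM2l //.
    have : 0 <= nu * (h + nu) by rewrite mulr_ge0 ?addr_ge0 // ltW.
    have : 2^-1 * (h + nu) <= a * (h + nu) by rewrite ler_pM2r //; move: h0 nu0; clear; lra.
    by clear; lra.
  by have := le_trans y3 y2; rewrite ler_pM2l //; move: a2 nu0; clear; lra.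
have Dle : \sum_v `|x v - 1| <= e1 * n.
  rewrite -(@ler_pXn2r _ 2) ?nnegrE //; last 2 first.
  - by apply: sumr_ge0.
  - by apply: mulr_ge0; apply: ltW.
  apply: le_trans (sqr_sum_le predT _) _.
  under eq_bigr do rewrite real_normK ?num_real //.
  rewrite sqx exprMn; have -> : #|(predT : pred G)|%:R = n by [].
  rewrite [n ^+ 2]expr2 mulrA mulrC ler_pM2r //.
  by move: Ylo n0 h2 nu2; clear; nra.
split.
- by apply: le_trans Dle _; rewrite ler_pM2r // /e1; move: e0; clear; lra.
- by apply: le_trans rhi _; rewrite ler_pM2r // lerD2l; move: e0 nu1; clear; lra.
have [f hf] := clique_partition w0 w1 A0; exists f.
set S := (X in X * _ <= _) in hf.
have Sle : S <= 2 * p ^+ 2 * h + 4 * p * nu.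
  have hk : k%:R = p - 1 :> R by rewrite -pE -natr1 addrK.
  have b1 : 1 - p * (1 - k%:R * (1 - T2)) <= p ^+ 2 * h.
    rewrite hk; have : (p - 1) * (1 - T2) <= (p - 1) * (p^-1 + h).
      by apply: ler_wpM2l => //; move: p2; clear; lra.
    rewrite -(ler_pM2l p0); move: pip p2 h0; rewrite expr2; clear; nra.
  rewrite -(ler_pM2r A0); apply: le_trans hf _.
  rewrite -/A pE -/T2.
  have : 2 * A * (1 - p * (1 - k%:R * (1 - T2))) <= 2 * A * (p ^+ 2 * h).
    by rewrite ler_wpM2l //; move: A0; clear; lra.
  have : 4 * p * clw w k.+2 <= 4 * p * (nu * A) by rewrite ler_wpM2l //; move: p0; clear; lra.
  by clear; lra.
pose Sx := \sum_u \sum_(v | adj u v && (f u == f v)) x u * x v.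
have SxE : Sx = S * Y ^+ 2.
  rewrite /Sx /S big_distrl /=; apply: eq_bigr => u _; rewrite big_distrl /=.
  by apply: eq_bigr => v _; rewrite /w; field; rewrite gt_eqF.
have Sx1 : Sx <= (2 * p ^+ 2 * h + 4 * p * nu) * n ^+ 2.
  rewrite SxE; apply: ler_pM; rewrite ?exprn_ge0 //.
    by apply: sumr_ge0 => u _; apply: sumr_ge0 => v _; apply: mulr_ge0.
  by rewrite ler_pXn2r // nnegrE // ltW.
apply: (@le_trans _ _ (Sx + 2 * n * \sum_v `|x v - 1|)); last first.
  have : 2 * n * \sum_v `|x v - 1| <= 2 * n * (e1 * n) by rewrite ler_wpM2l // mulr_ge0 // ltW.
  have n20 : 0 < n ^+ 2 by rewrite exprn_gt0.
  have : (2 * p ^+ 2 * h + 4 * p * nu) * n ^+ 2 <= (e / 2) * n ^+ 2 by rewrite ler_pM2r //; move: h3 nu3 e0; clear; lra.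
  have : 0 < e * n ^+ 2 by apply: mulr_gt0.
  by move: Sx1; rewrite /e1; move: (Sx) (\sum_v `|x v - 1|) => S' D'; clear; lra.
(* This converts the weighted count of inner edges back into the plain count, at a cost controlled
   by the distance of [x] from 1. *)
have step u v : 1 <= x u * x v + (`|x u - 1| + x u * `|x v - 1|).
  have := ler_norm (1 - x u); have := ler_norm (1 - x v).
  rewrite -(normrN (x u - 1)) -(normrN (x v - 1)) !opprB.
  have := x0 u; move: (x u) (x v) (`|x u - 1|) (`|x v - 1|) => a1 a2' a3 a4; clear; nra.
apply: (@le_trans _ _ (\sum_u \sum_(v | adj u v && (f u == f v))
     (x u * x v + (`|x u - 1| + x u * `|x v - 1|)))).
  by apply: ler_sum => u _; apply: ler_sum => v _.
rewrite /Sx.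
apply: (@le_trans _ _ (Sx + \sum_u \sum_v (`|x u - 1| + x u * `|x v - 1|))).
  rewrite /Sx -big_split /=; apply: ler_sum => u _; rewrite big_split /= lerD2l.
  rewrite big_mkcond; apply: ler_sum => v _; case: ifP => // _.
  by rewrite addr_ge0 // mulr_ge0.
rewrite lerD2l.
have -> : \sum_u \sum_v (`|x u - 1| + x u * `|x v - 1|) = (n + Y) * \sum_v `|x v - 1|.
  under eq_bigr => u _ do rewrite big_split /= sumr_const -big_distrr /=.
  rewrite big_split /= -big_distrl /= -/Y sumrMnl mulrDl; congr (_ + _).
  by rewrite -mulr_natl.
by apply: ler_wpM2r; [apply: sumr_ge0 | move: Yn; clear; lra].
Qed.

(** * Embedding forbidden graphs *)

(** [natmin] is 0 on the empty set, so a positive value certifies that the minimum is attained. *)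
Lemma natminP (P : nat -> Prop) m : natmin P = m -> (0 < m)%N -> P m.
Proof.
rewrite /natmin; case: xgetP => [n -> [Pn _] <- //|_ <-]; by rewrite ltnn.
Qed.

Definition partite G p c (S : 'I_p -> {set G}) :=
  (forall i, (c <= #|S i|)%N) /\
  (forall i j u v, i != j -> u \in S i -> v \in S j -> adj u v).

(** A vertex [v] outside [A] goes to the part of its colour, at the index [enum_rank v]. Distinct
    vertices use distinct indices and every part has at least [#|F|] points, so the map is
    injective. *)
Lemma embed_partite (F G : sgraph) p (A : {set F}) (phi : F -> G) (col : F -> 'I_p)
    (S : 'I_p -> {set G}) :
  {in A &, injective phi} ->
  (forall u v, u \in A -> v \in A -> adj u v -> adj (phi u) (phi v)) ->
  (forall u v, u \notin A -> v \notin A -> adj u v -> col u != col v) ->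
  partite #|F| S ->
  (forall u v, u \in A -> v \notin A -> phi u \notin S (col v)) ->
  (forall u v y, u \in A -> v \notin A -> adj u v -> y \in S (col v) ->
     adj (phi u) y) ->
  subgraph F G.
Proof.
move=> phi_inj phi_hom colP [cS aS] phiS phi_cpl.
pose g v := if v \in A then phi v else nth (phi v) (enum (S (col v))) (enum_rank v).
have gS v : v \notin A -> g v \in S (col v).
  move=> vA; rewrite /g (negbTE vA) -mem_enum; apply: mem_nth.
  by rewrite -cardE; apply: leq_trans (cS _).
exists g => [u v|u v uv].
  have [uA|uA] := boolP (u \in A); have [vA|vA] := boolP (v \in A).
  - by rewrite /g uA vA; apply: phi_inj.
  - move=> e; have := phiS u v uA vA.
    have <- : g u = phi u by rewrite /g uA.
    by rewrite e gS.
  - move=> e; have := phiS v u vA uA.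
    have <- : g v = phi v by rewrite /g vA.
    by rewrite -e gS.
  move=> e; have cuv : col u = col v.
    apply/eqP; apply/negPn/negP => ne.
    by have := aS _ _ _ _ ne (gS u uA) (gS v vA); rewrite e adj_irr.
  move: e; rewrite /g (negbTE uA) (negbTE vA) cuv.
  have sz w : (enum_rank (w : F) < size (enum (S (col v))))%N.
    by rewrite -cardE; apply: leq_trans (cS _).
  rewrite (set_nth_default (phi v)) // => /eqP.
  by rewrite nth_uniq ?enum_uniq // => /eqP/val_inj/enum_rank_inj.
have [uA|uA] := boolP (u \in A); have [vA|vA] := boolP (v \in A).
- by rewrite /g uA vA; apply: phi_hom.
- by rewrite {1}/g uA; apply: phi_cpl (gS v vA).
- by rewrite adj_sym {1}/g vA; apply: phi_cpl (gS u uA); rewrite // adj_sym.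
- by apply: aS (gS u uA) (gS v vA); apply: colP.
Qed.

(** The covering [B] of [M] is placed by [psi]. The rest of [M] together with the isolated vertices
    is independent and goes into class [i0]; the [k] parts of the Turan graph go to the other
    classes by [lift i0]. The value [y0] only fills [phi] off [A]. *)
Lemma embed_pre_decomposition H (M G : sgraph) k c (y0 : G)
    (i0 : 'I_k.+1) (B : {set M}) (psi : M -> G) (S : 'I_k.+1 -> {set G}) :
  (forall F, H F -> (#|F| <= c)%N) -> family_p H = k.+1 -> (0 < k)%N ->
  pre_decomposition H M ->
  {in B &, injective psi} ->
  (forall u v, u \in B -> v \in B -> adj u v -> adj (psi u) (psi v)) ->
  covering B -> partite c S ->
  (forall b, b \in B -> psi b \notin S i0) ->
  (forall b j y, b \in B -> j != i0 -> y \in S j -> adj (psi b) y) ->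
  (forall b v y, b \in B -> v \notin B -> adj b v -> y \in S i0 -> adj (psi b) y) ->
  ~ graph_free H G.
Proof.
move=> Hc pE k0 [F [t [HF]]]; rewrite pE subn1 /= => -[f f_inj f_hom].
move=> psi_inj psi_hom covB [cS aS] psi0 psi1 psi2 free; apply: (free F HF).
pose inB (x : F) := if f x is inl (inl b) then b \in B else false.
pose A := [set x | inB x].
pose phi (x : F) := if f x is inl (inl b) then psi b else y0.
pose col (x : F) : 'I_k.+1 :=
  if f x is inr j then lift i0 (Ordinal (ltn_pmod (j : 'I_(k * t)) k0)) else i0.
have AP x : x \in A -> exists2 b, f x = inl (inl b) & b \in B.
  by rewrite inE /inB; case: (f x) => // -[] // b bB; exists b.
have nAP x b : x \notin A -> f x = inl (inl b) -> b \notin B.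
  by rewrite inE /inB => + e; rewrite e.
have phiE x b : f x = inl (inl b) -> phi x = psi b by rewrite /phi => ->.
apply: (@embed_partite F G _ A phi col S) => //.
- move=> u v /AP[b fu bB] /AP[d fv dB]; rewrite (phiE _ _ fu) (phiE _ _ fv).
  by move=> /(psi_inj _ _ bB dB) e; apply: f_inj; rewrite fu fv e.
- move=> u v /AP[b fu bB] /AP[d fv dB] /f_hom; rewrite fu fv (phiE _ _ fu) (phiE _ _ fv).
  exact: psi_hom.
- move=> u v uA vA /f_hom; rewrite /col.
  case fu: (f u) => [[b|b]|b]; case fv: (f v) => [[d|d]|d] //=.
  + by move/covB; rewrite (negbTE (nAP _ _ uA fu)) (negbTE (nAP _ _ vA fv)).
  + by rewrite neq_lift.
  + by rewrite neq_lift.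
  + by rewrite eq_sym neq_lift.
  + by rewrite eq_sym neq_lift.
  + by rewrite (inj_eq lift_inj) /turan_adj -val_eqE.
- by split=> // i; apply: leq_trans (cS i); apply: Hc.
- move=> u v /AP[b fu bB] vA; rewrite (phiE _ _ fu).
  have [->|ne] := eqVneq (col v) i0; first exact: psi0.
  by apply/negP => h; have := psi1 _ _ _ bB ne h; rewrite adj_irr.
- move=> u v y /AP[b fu bB] vA /f_hom; rewrite (phiE _ _ fu) fu /col.
  case fv: (f v) => [[d|d]|d] //=.
  + by move=> bd; apply: (psi2 _ d) => //; apply: nAP fv.
  + by move=> _; apply: psi1 => //; rewrite eq_sym neq_lift.
Qed.

Lemma set_injection (T U : finType) (A : {set T}) (B : {set U}) (y0 : U) :
  (#|A| <= #|B|)%N ->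
  exists2 f : T -> U, {in A &, injective f} & forall a, a \in A -> f a \in B.
Proof.
move=> AB; have sz a : a \in A -> (index a (enum A) < size (enum B))%N.
  by move=> aA; rewrite -cardE; apply: leq_trans AB; rewrite cardE index_mem mem_enum.
exists (fun a => nth y0 (enum B) (index a (enum A))) => [a b aA bA /eqP|a aA].
  rewrite nth_uniq ?enum_uniq ?sz // => /eqP e.
  by rewrite -[a](nth_index a (s := enum A)) ?mem_enum // e nth_index // mem_enum.
by rewrite -mem_enum mem_nth ?sz.
Qed.

(** A minimum independent covering has no inner edges to preserve, so any [gamma] vertices of [J]
    can host it. *)
Lemma no_gamma_join H G k c (J : {set G})
    (S : 'I_k.+1 -> {set G}) :
  (forall F, H F -> (#|F| <= c)%N) -> family_p H = k.+1 -> (0 < k)%N ->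
  (0 < family_gamma H)%N -> graph_free H G ->
  (family_gamma H <= #|J|)%N -> partite c S ->
  ~ (forall i u v, u \in J -> v \in S i -> adj u v).
Proof.
move=> Hc pE k0 g0 free gJ pS cJ.
have [M [dM bM] gM] := natminP erefl g0.
have := natminP gM; rewrite -/(family_gamma H) => /(_ g0)[B [iB cB] Bg].
have /card_gt0P[y0 _] : (0 < #|J|)%N by apply: leq_trans gJ.
have BJ : (#|B| <= #|J|)%N by rewrite Bg.
have [psi psi_inj psiJ] := set_injection y0 BJ.
apply: (@embed_pre_decomposition H M G k c y0 ord0 B psi S) => //.
- by case: dM.
- by move=> u v uB vB uv; have := iB u v uB vB; rewrite uv.
- move=> b bB; apply/negP => h; have := cJ _ _ _ (psiJ b bB) h.
  by rewrite adj_irr.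
- by move=> b j y bB _; apply: cJ; apply: psiJ.
- by move=> b v y bB _ _; apply: cJ; apply: psiJ.
Qed.

(** The covering is the whole matching, so class [i0] receives isolated vertices only and the
    matching needs no adjacency to it. *)
Lemma no_matching_join H G k m c (i0 : 'I_k.+1)
    (psi : 'I_m * bool -> G) (S : 'I_k.+1 -> {set G}) :
  (forall F, H F -> (#|F| <= c)%N) -> family_p H = k.+1 -> (0 < k)%N ->
  decomposition H (matching_graph m) -> (0 < c)%N -> graph_free H G ->
  injective psi -> (forall i, adj (psi (i, false)) (psi (i, true))) ->
  partite c S -> (forall b, psi b \notin S i0) ->
  ~ (forall b j y, j != i0 -> y \in S j -> adj (psi b) y).
Proof.
move=> Hc pE k0 [dM _] c0 free psi_inj psi_adj pS psi0 psi1.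
have /card_gt0P[y0 _] : (0 < #|S i0|)%N by apply: leq_trans (pS.1 i0).
apply: (@embed_pre_decomposition H (matching_graph m) G k c y0 i0 [set: _] psi S) => //.
- by move=> u v _ _; apply: psi_inj.
- move=> [a b] [a' b'] _ _ /andP[/= /eqP <-].
  by case: b; case: b' => //= _; rewrite // adj_sym.
- by move=> u v _; rewrite inE.
- by move=> b j y _; apply: psi1.
- by move=> b v y _; rewrite inE.
Qed.

(** If [beta = gamma], the only member of [B_family H] is complete on [gamma] vertices, too many for
    [W]. Otherwise a copy in [W] of the graph induced by a covering of [M] finds the rest of [M] in
    a class, and a member of [H] appears. *)
Lemma induced_B_free H G k c (W : {set G})
    (S : 'I_k.+1 -> {set G}) :
  (forall F, H F -> (#|F| <= c)%N) -> family_p H = k.+1 -> (0 < k)%N ->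
  (0 < c)%N -> graph_free H G ->
  (#|W| < family_gamma H)%N -> partite c S ->
  (forall i u v, u \in W -> v \in S i -> adj u v) ->
  graph_free (B_family H) (induced W).
Proof.
move=> Hc pE k0 c0 free Wg pS cW F; rewrite /B_family.
have /card_gt0P[y0 _] : (0 < #|S ord0|)%N by apply: leq_trans (pS.1 ord0).
case: eqP => [_ -> [f f_inj _]|_ [M [B [dM cB Bg ->]]] [f f_inj f_hom]].
  have := leq_card f f_inj; rewrite /= card_ord card_sig.
  rewrite (_ : #|[pred x | _]| = #|W|); first by rewrite leqNgt Wg.
  by apply: eq_card.
pose psi (b : M) : G := if insub b is Some x then val (f x) else y0.
have psiE (b : M) (bB : b \in B) : psi b = val (f (Sub b bB)).
  by rewrite /psi insubT.
have psiW b : b \in B -> psi b \in W by move=> bB; rewrite psiE; apply: valP.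
apply: (@embed_pre_decomposition H M G k c y0 ord0 B psi S) => //.
- by case: dM.
- by move=> u v uB vB; rewrite !psiE => /val_inj/f_inj [].
- by move=> u v uB vB uv; rewrite !psiE; apply: f_hom.
- move=> b bB; apply/negP => h; have := cW _ _ _ (psiW b bB) h.
  by rewrite adj_irr.
- by move=> b j y bB _; apply: cW; apply: psiW.
- by move=> b v y bB _ _; apply: cW; apply: psiW.
Qed.

(** One part serves as the joined set [J], the other [k+1] parts as the classes. *)
Lemma no_complete_partite H G k c t :
  (forall F, H F -> (#|F| <= c)%N) -> family_p H = k.+1 -> (0 < k)%N ->
  (0 < family_gamma H)%N -> graph_free H G ->
  (c <= t)%N -> (family_gamma H <= t)%N -> ~ has_complete_partite G k.+2 t.
Proof.
move=> Hc pE k0 g0 free ct gt [S [St aS]].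
apply: (@no_gamma_join H G k c (S ord0) (fun i => S (lift ord0 i))) => //.
- by rewrite St.
- split=> [i|i j u v ij]; first by rewrite St.
  by apply: aS; rewrite (inj_eq lift_inj).
- by move=> i u v; apply: aS; rewrite neq_lift.
Qed.

(** * Rewiring a vertex *)

Definition rewire_adj G (z : G) (A : {set G}) (u v : G) : bool :=
  if u == z then (v != z) && (v \in A)
  else if v == z then u \in A else adj u v.

Lemma rewire_sym G z (A : {set G}) : symmetric (rewire_adj z A).
Proof.
move=> u v; rewrite /rewire_adj.
by case: (eqVneq u z) => [->|uz]; case: (eqVneq v z) => //= _; rewrite adj_sym.
Qed.

Lemma rewire_irr G z (A : {set G}) : irreflexive (rewire_adj z A).
Proof.
by move=> u; rewrite /rewire_adj; case: (eqVneq u z) => //= _; rewrite adj_irr.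
Qed.

(** The vertex type is that of [G], so the same weight functions and sets serve both graphs. *)
Definition rewire G (z : G) (A : {set G}) : sgraph :=
  SGraph (rewire_sym z A) (rewire_irr z A).

Definition cnbr G (Q : {set G}) : {set G} :=
  [set y | [forall q in Q, adj q y]].

Lemma cnbrP G (Q : {set G}) y :
  reflect (forall q, q \in Q -> adj q y) (y \in cnbr Q).
Proof. by rewrite inE; apply: forall_inP. Qed.

(* A vertex [y] adjacent to the neighbours of [z] in a copy of [F] can take
   over the role of [z]. *)
Lemma rewire_free H G c (z : G) (A : {set G}) :
  (forall F, H F -> (#|F| <= c)%N) -> graph_free H G -> z \notin A ->
  (forall Q : {set G}, Q \subset A -> (#|Q| <= c)%N -> (c < #|cnbr Q|)%N) ->
  graph_free H (rewire z A).
Proof.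
move=> Hc free zA hA F HF [f f_inj f_hom]; apply: (free F HF).
have [/existsP[a /eqP fa]|nz] := boolP [exists a, f a == z]; last first.
  exists f => // u v /f_hom; rewrite /= /rewire_adj.
  have nez w : f w != z by apply: contra nz => e; apply/existsP; exists w.
  by rewrite !(negbTE (nez _)).
pose Q : {set G} := [set f b | b in [set b | adj a b]].
have QA : Q \subset A.
  apply/subsetP => _ /imsetP[b + ->]; rewrite inE => /f_hom.
  by rewrite /= /rewire_adj fa eqxx => /andP[].
have Qc : (#|Q| <= c)%N.
  apply: leq_trans (leq_imset_card _ _) _; apply: leq_trans (Hc F HF).
  exact: max_card.
(* The copy of [F] has at most [c] vertices, so the strict bound [c < #|cnbr Q|] leaves a common
   neighbour outside it. *)
have [y yQ yf] : exists2 y : G, y \in cnbr Q & y \notin [set f b | b in F].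
  have lt : (#|[set f b | b in F]| < #|cnbr Q|)%N.
    apply: leq_ltn_trans (hA Q QA Qc).
    by apply: leq_trans (leq_imset_card _ _) (Hc F HF).
  have /subsetPn[y y1 y2] : ~~ (cnbr Q \subset [set f b | b in F]).
    by apply/negP => /subset_leq_card; rewrite leqNgt lt.
  by exists y.
have yfb b : f b != y by apply: contra yf => /eqP <-; apply: imset_f.
have fz b : b != a -> f b != z by apply: contra => /eqP e; rewrite -(inj_eq f_inj) e fa.
pose g b : G := if b == a then y else f b.
exists g => [u v|u v uv]; rewrite /g.
  have [->|ua] := eqVneq u a; have [->|va] := eqVneq v a => //.
  - by move=> e; have := yfb v; rewrite -e eqxx.
  - by move=> e; have := yfb u; rewrite e eqxx.
  - exact: f_inj.
have [ua|ua] := eqVneq u a; have [va|va] := eqVneq v a.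
- by move: uv; rewrite ua va adj_irr.
- rewrite adj_sym; apply: (cnbrP _ _ yQ); apply/imsetP; exists v => //.
  by rewrite inE -ua.
- apply: (cnbrP _ _ yQ); apply/imsetP; exists u => //.
  by rewrite inE adj_sym -va.
- have := f_hom _ _ uv; rewrite /= /rewire_adj.
  by rewrite (negbTE (fz _ ua)) (negbTE (fz _ va)).
Qed.

Lemma nb_rewire R G (z : G) (A : {set G}) (x : G -> R) (u : G) :
  z \notin A ->
  @nb R (rewire z A) x u =
  if u == z then \sum_(v in A) x v
  else nb x u + ((u \in A)%:R - (adj u z)%:R) * x z.
Proof.
move=> zA; rewrite /nb /=; case: (eqVneq u z) => [->|uz].
  apply: eq_bigl => v; rewrite /rewire_adj eqxx.
  by case: (eqVneq v z) => [->|//]; rewrite (negbTE zA).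
rewrite big_mkcond (bigD1 z) //= [\sum_(v | adj u v) _]big_mkcond /=.
rewrite [X in _ = X + _](bigD1 z) //= /rewire_adj (negbTE uz) eqxx.
rewrite (eq_bigr (fun v => if adj u v then x v else 0)) => [|v vz].
  by case: (u \in A); case: (adj u z) => /=; ring.
by rewrite (negbTE vz).
Qed.

(** Stated for two vectors: with [y = x] it feeds Rayleigh quotients, and with eigenvectors of the
    two graphs it compares their radii. *)
Lemma rewire_form R G (z : G) (A : {set G}) (x y : G -> R) :
  z \notin A ->
  \sum_u y u * @nb R (rewire z A) x u =
  \sum_u y u * nb x u + x z * (\sum_(v in A) y v - nb y z)
     + y z * (\sum_(v in A) x v - nb x z).
Proof.
move=> zA.
have e1 : \sum_(v in A) y v = \sum_(u | u != z) y u * (u \in A)%:R.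
  rewrite [RHS]big_mkcond [LHS]big_mkcond; apply: eq_bigr => u _.
  case: (eqVneq u z) => [->|_] /=; first by rewrite (negbTE zA).
  by case: (u \in A); rewrite ?mulr1 ?mulr0.
have e2 : nb y z = \sum_(u | u != z) y u * (adj u z)%:R.
  rewrite /nb [RHS]big_mkcond [LHS]big_mkcond; apply: eq_bigr => u _.
  case: (eqVneq u z) => [->|_] /=; first by rewrite adj_irr.
  by rewrite adj_sym; case: (adj u z); rewrite ?mulr1 ?mulr0.
rewrite (bigD1 z) //= [X in _ = X + _ + _](bigD1 z) //= nb_rewire // eqxx.
have -> : \sum_(u | u != z) y u * @nb R (rewire z A) x u =
   \sum_(u | u != z) (y u * nb x u + x z * (y u * (u \in A)%:R) -
   x z * (y u * (adj u z)%:R)).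
  by apply: eq_bigr => u uz; rewrite nb_rewire // (negbTE uz); ring.
by rewrite sumrB big_split /= -!big_distrr /= -e1 -e2; ring.
Qed.

Lemma SPEX_rewire R H G n c (z : G)
    (A : {set G}) (x : G -> R) :
  (forall F, H F -> (#|F| <= c)%N) -> SPEX R n H G ->
  perron x (spectral_radius R G) -> 0 < spectral_radius R G -> z \notin A ->
  (forall Q : {set G}, Q \subset A -> (#|Q| <= c)%N -> (c < #|cnbr Q|)%N) ->
  \sum_(v in A) x v <= spectral_radius R G * x z.
Proof.
move=> Hc [Gn free Gmax] px; set r := spectral_radius R G => r0 zA hA.
have G0 : (0 < #|G|)%N by apply/card_gt0P; exists z.
have free' := rewire_free Hc free zA hA.
have [ray _] := @perron_spectral R (rewire z A) G0.
have rle := Gmax (rewire z A) Gn free'; rewrite -/r in rle.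
have [qx _ _] := perron_facts px; have [x0 x1 xe] := px.
rewrite leNgt; apply/negP => lt.
set SA := \sum_(v in A) x v in lt.
pose d := SA - r * x z; have d0 : 0 < d by rewrite /d subr_gt0.
(* Testing with [x] alone gives only [x z * d <= 0], which is void if [x z = 0]. Adding [d / r] at
   [z] leaves the positive surplus [d * (d / r)]. *)
have := ray (fun u => x u + (d / r) * (u == z)%:R).
rewrite (@qform_perturb R (rewire z A)) (@sqr_perturb R (rewire z A)) nb_rewire // eqxx -/SA x1.
have -> : @qform R (rewire z A) x = _ := rewire_form x x zA.
rewrite -/(qform x) qx xe -/r -/SA.
set N := _%:R + _ + _.
have N0 : 0 <= N.
  rewrite /N -x1 -(@sqr_perturb R (rewire z A)).
  by apply: sumr_ge0 => u _; apply: sqr_ge0.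
move=> h; have := le_trans h (ler_wpM2r N0 rle); rewrite /N -/r.
have -> : SA = d + r * x z by rewrite /d; ring.
have -> : r * (#|G|%:R + 2 * (d / r) * x z + (d / r) ^+ 2) =
   r * #|G|%:R + 2 * d * x z + d * (d / r) by field; rewrite gt_eqF.
have -> : 2 * (d / r) * (d + r * x z) = 2 * (d * (d / r)) + 2 * d * x z.
  by field; rewrite gt_eqF.
have : 0 < d * (d / r) by rewrite mulr_gt0 ?divr_gt0.
have : 0 <= x z * d by rewrite mulr_ge0 // ltW.
move: (d * (d / r)) => w; clear; lra.
Qed.

(** * The extremal graph *)

Lemma card_edges G :
  (#|[set e : G * G | adj e.1 e.2]| = 2 * #|edges G|)%N.
Proof.
set P := [set e : G * G | adj e.1 e.2].
rewrite -sum1_card (partition_big_imset (fun e : G * G => [set e.1; e.2])) /=.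
rewrite -/(edges G) (eq_bigr (fun=> 2)) => [|A].
  by rewrite sum_nat_const mulnC.
case/imsetP => -[u v]; rewrite inE /= => uv ->.
have uv' : u != v by apply: contraTneq uv => ->; rewrite adj_irr.
rewrite (eq_bigl (mem [set (u, v); (v, u)])) => [|[a b]].
  by rewrite sum1_card cards2 xpair_eqE (negbTE uv').
rewrite !inE /= !xpair_eqE; apply/andP/orP => [[ab /eqP e]|].
  have ne : a != b by apply: contraTneq ab => ->; rewrite adj_irr.
  have : a \in [set u; v] by rewrite -e !inE eqxx.
  have : b \in [set u; v] by rewrite -e !inE eqxx orbT.
  rewrite !inE => /orP[]/eqP eb /orP[]/eqP ea; move: ne; rewrite ea eb ?eqxx //.
  - by right.
  - by left.
move=> [] /andP[/eqP-> /eqP->]; split=> //; first by rewrite adj_sym.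
by rewrite setUC.
Qed.

(** [X] is the exceptional set: adjacency is prescribed for every pair not contained in [W :|: X],
    and is arbitrary inside. *)
Definition clean G k (W X : {set G}) (f : G -> 'I_k.+1) :=
  [disjoint W & X] /\
  forall z, z \notin W -> z \notin X -> forall u, adj z u = (u \in W) || (f u != f z).

Definition cls G k (W : {set G}) (f : G -> 'I_k.+1) (i : 'I_k.+1) :
  {set G} := [set v | (v \notin W) && (f v == i)].

(** Passing from [N] to [N + 1] enlarges the class exactly when [N] has residue [i], that is, when
    [p] divides [N + (p - i)]. *)
Lemma card_modn_class p N i : (0 < p)%N -> (i < p)%N ->
  #|[set j : 'I_N | (j %% p)%N == i]| = ((N + (p.-1 - i)) %/ p)%N.
Proof.
move=> p0 ip.
rewrite -sum1_card big_mkcond /=.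
rewrite (eq_bigr (fun j : 'I_N => ((j %% p)%N == i : nat))) => [|j _]; last first.
  by rewrite inE; case: eqP.
elim: N => [|N IH]; first by rewrite big_ord0 divn_small //; lia.
rewrite big_ord_recr /= IH addSn divnS // addnC; congr (_ + _)%N.
congr nat_of_bool; rewrite -addnS.
have -> : (N + (p.-1 - i).+1 = N + (p - i))%N by lia.
have e : (N + (p - i) + i = N + p)%N by lia.
rewrite /dvdn; apply/eqP/eqP => h.
  have : (N + (p - i) = N + (p - N %% p))%N by rewrite h.
  move=> ->; rewrite {1}(divn_eq N p).
  have lt := ltn_pmod N p0.
  have -> : (N %/ p * p + N %% p + (p - N %% p) = N %/ p * p + p)%N by lia.
  by rewrite modnDr modnMl.
have : (N + (p - i) + i = 0 + i %[mod p])%N by rewrite -modnDml h.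
by rewrite e modnDr add0n (modn_small ip).
Qed.

Lemma card_modn_balanced p N i j : (i < p)%N -> (j < p)%N ->
  (#|[set l : 'I_N | (l %% p)%N == i]| <= #|[set l : 'I_N | (l %% p)%N == j]|.+1)%N.
Proof.
move=> ip jp; have p0 : (0 < p)%N by apply: leq_ltn_trans ip.
rewrite !card_modn_class // -addn1.
have -> : ((N + (p.-1 - j)) %/ p + 1 = (N + (p.-1 - j) + p) %/ p)%N.
  by rewrite [RHS]divnDr ?dvdnn // divnn p0.
by apply: leq_div2r; lia.
Qed.

(* Ordered pairs are counted, so every edge of [G] inside [A] counts twice. *)
Definition einner R G (A : {set G}) : R :=
  \sum_(u in A) \sum_(v in A) (adj u v)%:R.

Lemma einner_setT R G :
  \sum_(u : G) \sum_(v : G) (adj u v)%:R = 2 * #|edges G|%:R :> R.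
Proof.
rewrite -natrM -card_edges -sum_indicator pair_big /=.
by apply: eq_bigr => -[u v] _; rewrite inE.
Qed.

Lemma einner_induced R G (A : {set G}) :
  einner R A = 2 * #|edges (induced A)|%:R.
Proof.
rewrite -einner_setT /einner.
rewrite (reindex_omap (fun u : induced A => val u) insub) /=; last first.
  by move=> u uA; rewrite insubT.
rewrite (eq_bigl predT) => [|u]; last by rewrite (valP u) valK eqxx.
apply: eq_bigr => u _.
rewrite (reindex_omap (fun u : induced A => val u) insub) /=; last first.
  by move=> v vA; rewrite insubT.
by rewrite (eq_bigl predT) => [|v] //; rewrite (valP v) valK eqxx.
Qed.

Definition balanced G k (W : {set G}) (f : G -> 'I_k.+1) :=
  forall i j, (#|cls W f i| <= #|cls W f j|.+1)%N.

(** [X] consists of the endpoints of the at most [c] edited pairs, and colours are residues in the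
    Turan graph. The last clause records that [H1], which spans [W], has the most edges among
    [B]-free graphs of its order. *)
Lemma matching_good_clean R H k :
  family_p H = k.+1 -> (0 < family_gamma H)%N -> matching_good H ->
  exists K N, forall n, (N <= n)%N -> exists G (W X : {set G}) (f : G -> 'I_k.+1),
    [/\ EX n H G, clean W X f & balanced W f] /\
    [/\ #|W| = (family_gamma H).-1, (#|X| <= K)%N,
        forall u v, u \in W -> v \notin W -> adj u v &
        forall L : sgraph, #|L| = (family_gamma H).-1 -> graph_free (B_family H) L ->
          2 * #|edges L|%:R <= einner R W].
Proof.
move=> pE g0 [_ _ [c [N hN]]]; exists (2 * c)%N, N => n /hN[H1 [H2 [exG exH1 [g g_bij gc]]]].
set E := ([set [set e.1; e.2] | e in _])%SET in gc.
pose Xc := cover E; pose G := graph_join H1 H2.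
pose W : {set G} := [set u | if u is inl _ then true else false].
pose X : {set G} := [set (inr v : G) | v in Xc].
pose f (u : G) : 'I_k.+1 :=
  if u is inr v then Ordinal (ltn_pmod (g v : 'I__) (ltn0Sn k)) else ord0.
have [H1c H1f H1m] := exH1.
have card1 : #|W| = #|H1|.
  rewrite (_ : W = [set inl v | v in H1]).
    by rewrite card_imset //; apply: inl_inj.
  apply/setP => -[v|v]; rewrite inE; apply/esym.
    by apply/imsetP; exists v.
  by apply/negbTE/negP => /imsetP[].
exists G, W, X, f; split; split=> //.
- split.
    apply/pred0P => -[v|v] /=; rewrite !inE //=.
    by apply/negbTE/negP => /imsetP[].
  move=> [v|v]; rewrite inE //= => _ vX [u|u]; rewrite inE //=.
  have vXc : v \notin Xc by apply: contra vX => ?; apply: imset_f.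
  apply/idP/idP; apply: contraTT; last first.
  + move=> nadj; apply/negP => /= ne.
    case/negP: vXc; apply/bigcupP; exists [set v; u]; last by rewrite !inE eqxx.
    apply/imsetP; exists (v, u) => //; rewrite inE /= (negbTE nadj) /= /turan_adj.
    by rewrite pE; move: ne; rewrite -val_eqE /= eq_sym => ->.
  + rewrite negbK => /eqP /(congr1 val) /= e; apply/negP => ad.
    case/negP: vXc; apply/bigcupP; exists [set v; u]; last by rewrite !inE eqxx.
    apply/imsetP; exists (v, u) => //; rewrite inE /= ad /turan_adj.
    by rewrite pE e eqxx.
- have cE i : #|cls W f i| = #|[set l : 'I_(n - family_gamma H + 1) | (l %% k.+1)%N == i]|.
    have -> : cls W f i = [set inr v | v in [set v | (g v %% k.+1)%N == i]].
      apply/setP => -[v|v]; rewrite !inE /=; apply/esym.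
        by apply/negbTE/negP => /imsetP[].
      by rewrite mem_imset ?inE; [rewrite -val_eqE | apply: inr_inj].
    rewrite card_imset; last exact: inr_inj.
    rewrite -(card_imset _ (bij_inj g_bij)); congr #|pred_of_set _|.
    apply/setP => l; rewrite inE; have [h hg gh] := g_bij.
    apply/imsetP/idP => [[v + ->]|li]; first by rewrite inE.
    by exists (h l); rewrite ?inE gh.
  by move=> i j; rewrite !cE; apply: card_modn_balanced.
- by rewrite card1 H1c subn1.
- apply: leq_trans (leq_imset_card _ _) _.
  apply: leq_trans (_ : (\sum_(A in E) #|A| <= _)%N).
    by apply: leq_card_cover.
  apply: leq_trans (_ : (\sum_(A in E) 2 <= _)%N); last by rewrite sum_nat_const mulnC leq_mul2l gc.
  apply: leq_sum => A /imsetP[e _ ->]; rewrite cards2; by case: (_ != _).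
- by move=> [u|u] [v|v]; rewrite !inE.
- move=> L Lc Lf; rewrite (_ : einner R W = 2 * #|edges H1|%:R).
    by rewrite ler_pM2l // ler_nat; apply: H1m; rewrite ?Lc ?subn1.
  rewrite -einner_setT /einner big_sumType /= [X in _ + X]big1 => [|v]; last by rewrite inE.
  rewrite addr0; apply: eq_big => [v|v _]; first by rewrite inE.
  rewrite big_sumType /= [X in _ + X]big1 => [|u]; last by rewrite inE.
  by rewrite addr0; apply: eq_bigl => u; rewrite inE.
Qed.

Lemma sum_cls R G k (W : {set G}) (f : G -> 'I_k.+1) (F : G -> R) :
  \sum_(u | u \notin W) F u = \sum_i \sum_(u in cls W f i) F u.
Proof.
rewrite (partition_big f predT) //=; apply: eq_bigr => i _.
by apply: eq_bigl => u; rewrite inE.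
Qed.

Lemma card_notin R G (W : {set G}) :
  \sum_(u | u \notin W) 1 = #|G|%:R - #|W|%:R :> R.
Proof.
rewrite sumr_const -natrB ?max_card //; congr _%:R.
by rewrite -(cardsC W) addKn; apply: eq_card => u; rewrite !inE.
Qed.

(** [k.+1] times the sum of squares minus the square of the sum is half the sum of all
    [(c i - c j) ^+ 2], each at most 1. *)
Lemma balanced_sum_sqr R G k (W : {set G}) (f : G -> 'I_k.+1) :
  balanced W f ->
  k.+1%:R * \sum_i #|cls W f i|%:R ^+ 2 <=
  (#|G|%:R - #|W|%:R) ^+ 2 + k.+1%:R ^+ 2 :> R.
Proof.
move=> bal; pose c i : R := #|cls W f i|%:R.
have mE : #|G|%:R - #|W|%:R = \sum_i c i.
  by rewrite -card_notin (sum_cls W f); apply: eq_bigr => i _; rewrite sumr_const.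
have h : \sum_i \sum_j (c i - c j) ^+ 2 <= k.+1%:R ^+ 2.
  apply: (@le_trans _ _ (\sum_(i < k.+1) \sum_(j < k.+1) 1)).
    apply: ler_sum => i _; apply: ler_sum => j _.
    have := bal i j; rewrite -(ler_nat R) -natr1 => b1.
    have := bal j i; rewrite -(ler_nat R) -natr1 => b2.
    by rewrite /c; move: b1 b2; clear; nra.
  by rewrite !sumr_const !card_ord -mulrnA -natrX lexx.
have e : \sum_i \sum_j (c i - c j) ^+ 2 = 2 * (k.+1%:R * \sum_i c i ^+ 2 - (\sum_i c i) ^+ 2).
  have -> : \sum_i \sum_j (c i - c j) ^+ 2 = \sum_i (k.+1%:R * c i ^+ 2 + \sum_j c j ^+ 2 - 2 * c i * \sum_j c j).
    apply: eq_bigr => i _.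
    rewrite (eq_bigr (fun j => (c i ^+ 2 + c j ^+ 2) - 2 * c i * c j)) => [|j _]; last by ring.
    by rewrite sumrB big_split /= sumr_const card_ord -[c i ^+ 2 *+ _]mulr_natl -big_distrr.
  rewrite sumrB big_split /= -big_distrr -big_distrl /= -big_distrr /= sumr_const card_ord.
  by rewrite -[_ *+ k.+1]mulr_natl; ring.
rewrite mE; rewrite e in h.
have : 0 <= k.+1%:R ^+ 2 :> R by rewrite exprn_ge0.
by move: h; rewrite /c; clear; lra.
Qed.

(** All pairs between classes are edges except possibly pairs inside [X], which cost at most
    [#|X| ^ 2]; edges inside [W] are dropped. *)
Lemma clean_lower_form R G k (W X : {set G})
    (f : G -> 'I_k.+1) (l : R) : 0 <= l ->
  clean W X f -> (forall u v, u \in W -> v \notin W -> adj u v) ->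
  (#|G|%:R - #|W|%:R) ^+ 2 - \sum_i #|cls W f i|%:R ^+ 2 - #|X|%:R ^+ 2
   + 2 * l * #|W|%:R * (#|G|%:R - #|W|%:R) <=
  qform (fun v => if v \in W then l else 1).
Proof.
move=> l0 [dWX cl] jW.
pose z (v : G) : R := if v \in W then l else 1.
pose a (v : G) : R := (v \notin W)%:R.
pose b (v : G) : R := (v \in W)%:R.
pose c (v : G) : R := (v \in X)%:R.
have suma : \sum_v a v = #|G|%:R - #|W|%:R.
  by rewrite -card_notin [RHS]big_mkcond /=; apply: eq_bigr => v _; rewrite /a; case: (v \in W).
have sumb : \sum_v b v = #|W|%:R by rewrite sum_indicator.
have sumc : \sum_v c v = #|X|%:R by rewrite sum_indicator.
rewrite qformE -suma -sumb -sumc.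
have eqf : \sum_i #|cls W f i|%:R ^+ 2 = \sum_u \sum_v a u * a v * (f u == f v)%:R.
  have -> : \sum_u \sum_v a u * a v * (f u == f v)%:R =
      \sum_(u | u \notin W) #|cls W f (f u)|%:R.
    rewrite [RHS]big_mkcond /=; apply: eq_bigr => u _; rewrite /a.
    case: (u \in W) => /=; first by rewrite big1 // => v _; ring.
    rewrite -sum_indicator; apply: eq_bigr => v _; rewrite inE eq_sym.
    by case: (v \in W); case: (_ == _) => /=; ring.
  rewrite (sum_cls W f); apply: eq_bigr => i _.
  rewrite (eq_bigr (fun=> #|cls W f i|%:R)) => [|u].
    by rewrite sumr_const expr2 -[RHS]mulr_natl.
  by rewrite inE => /andP[_ /eqP ->].
have sq (t : G -> R) : (\sum_v t v) ^+ 2 = \sum_u \sum_v t u * t v.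
  by rewrite expr2 big_distrl /=; apply: eq_bigr => u _; rewrite big_distrr.
rewrite eqf !sq.
have -> : 2 * l * (\sum_v b v) * (\sum_v a v) = \sum_u \sum_v (l * (b u * a v + a u * b v)).
  have e1 : (\sum_v b v) * \sum_v a v = \sum_u \sum_v b u * a v.
    by rewrite big_distrl /=; apply: eq_bigr => u _; rewrite big_distrr.
  have e2 : \sum_u \sum_v a u * b v = \sum_u \sum_v b u * a v.
    by rewrite exchange_big /=; apply: eq_bigr => u _; apply: eq_bigr => v _; ring.
  under [RHS]eq_bigr => u _ do rewrite -big_distrr /= big_split /=.
  by rewrite -big_distrr /= big_split /= e2 -e1; ring.
rewrite -!sumrB -big_split /=; apply: ler_sum => u _.
rewrite -!sumrB -big_split /= [leRHS]big_mkcond; apply: ler_sum => v _.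
have XW w : w \in X -> w \notin W.
  by move=> wX; apply/negP => wW; move/pred0P: dWX => /(_ w) /=; rewrite wW wX.
rewrite /a /b /c.
have [uW|uW] := boolP (u \in W); have [vW|vW] := boolP (v \in W).
- have := XW u; rewrite uW; case: (u \in X) => [/(_ isT)//|_].
  by case: ifP => _ /=; rewrite ?mulr_ge0 //; nra.
- have := XW u; rewrite uW; case: (u \in X) => [/(_ isT)//|_].
  by rewrite jW //=; lra.
- have := XW v; rewrite vW; case: (v \in X) => [/(_ isT)//|_].
  by rewrite adj_sym jW //=; lra.
have [uX|uX] := boolP (u \in X).
  have [vX|vX] := boolP (v \in X); first by case: ifP; case: (_ == _) => /=; lra.
  rewrite adj_sym cl // (negbTE uW) /=.
  by case: (_ == _) => /=; lra.
rewrite cl // (negbTE vW) /= eq_sym.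
by case: (_ == _) => /=; lra.
Qed.

(** The test vector equals [l = a^-1] on [W], the weight [n / r] of a vertex joined to everything
    when [r] is near [a n]. Its quotient is about [a m + l s] with [m = n - s], which is the claimed
    bound. *)
Lemma clean_spectral_lower R (k s K : nat) (e : R) :
  (0 < k)%N -> 0 < e ->
  exists N, forall G (W X : {set G}) (f : G -> 'I_k.+1), (N <= #|G|)%N ->
    clean W X f -> balanced W f -> #|W| = s -> (#|X| <= K)%N ->
    (forall u v, u \in W -> v \notin W -> adj u v) ->
    (1 - k.+1%:R^-1) * #|G|%:R +
      s%:R * ((1 - k.+1%:R^-1)^-1 - (1 - k.+1%:R^-1)) - e <= spectral_radius R G.
Proof.
move=> k0 e0; set a : R := 1 - k.+1%:R^-1.
have p0 : 0 < k.+1%:R :> R by rewrite ltr0n.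
have a0 : 0 < a by rewrite /a subr_gt0 invf_lt1 // (ltr_nat R 1).
pose l := a^-1; have l0 : 0 < l by rewrite invr_gt0.
have al : a * l = 1 by rewrite mulfV // gt_eqF.
(* The error terms are [l^3 s^2] from the norm on [W], [k.+1] from unequal class sizes and [K^2]
   from pairs inside [X]; for large [n] the term [e * m] exceeds them. *)
pose C := l ^+ 3 * s%:R ^+ 2 + k.+1%:R + K%:R ^+ 2.
have [N hN] := exists_nat_ge (C / e + s%:R).
exists (maxn s.+1 N) => G W X f; rewrite geq_max => /andP[nS nN] cl bal Ws XK jW.
have G0 : (0 < #|G|)%N by apply: leq_ltn_trans nS.
have [ray _] := perron_spectral R G0.
have := le_trans (clean_lower_form (ltW l0) cl jW) (ray _).
have -> : \sum_v (if v \in W then l else 1) ^+ 2 = (#|G|%:R - s%:R) + s%:R * l ^+ 2.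
  rewrite (bigID (mem W)) /= addrC; congr (_ + _).
    rewrite -Ws -card_notin; apply: eq_bigr => v /negbTE ->; by rewrite expr1n.
  rewrite (eq_bigr (fun=> l ^+ 2)) => [|v ->] //.
  by rewrite sumr_const -Ws mulr_natl.
have := balanced_sum_sqr R bal; rewrite Ws.
set n : R := #|G|%:R; set r := spectral_radius R G; set Q := \sum_i _.
have hn : C / e + s%:R <= n by apply: hN.
have nS' : s%:R + 1 <= n by rewrite natr1 ler_nat.
have XK2 : #|X|%:R ^+ 2 <= K%:R ^+ 2 :> R by rewrite ler_pXn2r ?nnegrE // ler_nat.
set m := n - s%:R => hQ hr.
have m0 : 0 < m by rewrite /m; move: nS'; clear; lra.
have hm : C <= e * m.
  have : C / e <= m by rewrite /m; move: hn; clear; lra.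
  by rewrite ler_pdivrMr // mulrC.
have hQ' : Q <= (1 - a) * m ^+ 2 + k.+1%:R.
  have -> : 1 - a = k.+1%:R^-1 by rewrite /a; ring.
  rewrite -(ler_pM2l p0) mulrDr mulrA divff ?gt_eqF // mul1r -expr2 //.
have nm : n = m + s%:R by rewrite /m; ring.
suff : (a * m + l * s%:R - e) * (m + s%:R * l ^+ 2) <= r * (m + s%:R * l ^+ 2).
  rewrite ler_pM2r; last by rewrite ltr_pwDl // mulr_ge0 // exprn_ge0 // ltW.
  by rewrite nm -/l; lra.
apply: le_trans hr.
have s0 : 0 <= s%:R :> R by [].
have e1 : (a * m + l * s%:R - e) * (m + s%:R * l ^+ 2) = a * m ^+ 2 + (a * l) * l * s%:R * m
   + l * s%:R * m + l ^+ 3 * s%:R ^+ 2 - e * m - e * (s%:R * l ^+ 2) by ring.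
have : 0 <= e * (s%:R * l ^+ 2) by rewrite mulr_ge0 ?mulr_ge0 ?exprn_ge0 // ltW.
rewrite e1 al; move: hm hQ' XK2; rewrite /C; clear; lra.
Qed.

(** * Approximate structure of spectral extremal graphs *)

Lemma subset_of_card (T : finType) (B : {set T}) c : (c <= #|B|)%N ->
  exists2 A : {set T}, A \subset B & #|A| = c.
Proof.
move=> cB; exists [set x in take c (enum B)].
  by apply/subsetP => x; rewrite inE => /mem_take; rewrite mem_enum.
rewrite cardsE (card_uniqP _) ?take_uniq ?enum_uniq // size_take -cardE.
by case: ltnP => // Bc; apply/eqP; rewrite eqn_leq Bc cB.
Qed.

Definition nonadj G (B : {set G}) (u : G) : {set G} :=
  [set v in B | ~~ adj u v].

Lemma card_cnbr G (B Q : {set G}) M :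
  (forall q, q \in Q -> (#|nonadj B q| <= M)%N) ->
  (#|B| <= #|B :&: cnbr Q| + #|Q| * M)%N.
Proof.
move=> hM; rewrite -(cardsID (cnbr Q) B) leq_add2l.
have sub : B :\: cnbr Q \subset \bigcup_(q in Q) nonadj B q.
  apply/subsetP => v; rewrite inE => /andP[vQ vB]; move: vQ; rewrite inE.
  rewrite negb_forall => /existsP[q]; rewrite negb_imply => /andP[qQ nq].
  by apply/bigcupP; exists q => //; rewrite inE vB.
apply: leq_trans (subset_leq_card sub) _.
apply: leq_trans (_ : (\sum_(q in Q) #|nonadj B q| <= _)%N).
  elim/big_ind2: _ => [|A a A' a' h h'|] //; first by rewrite cards0.
  by apply: leq_trans (leq_card_setU _ _) (leq_add h h').
by rewrite -sum_nat_const; apply: leq_sum => q /hM.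
Qed.

(** Parts are chosen one class at a time, in the common neighbourhood of [J] and of the parts
    already chosen. These are at most [#|J| + p * c] vertices, each missing at most [M] of the next
    class. *)
Lemma greedy_list G p c (i0 : 'I_p) (J : {set G}) (B : 'I_p -> {set G}) M
    (l : seq 'I_p) :
  (forall j u, j != i0 -> u \in J -> (#|nonadj (B j) u| <= M)%N) ->
  (forall i j u, i != i0 -> j != i0 -> i != j -> u \in B i ->
     (#|nonadj (B j) u| <= M)%N) ->
  (forall j, j != i0 -> ((#|J| + p * c) * M + c <= #|B j|)%N) ->
  uniq l -> i0 \notin l ->
  exists S : 'I_p -> {set G},
    (forall j, j \in l -> [/\ S j \subset B j, #|S j| = c &
       forall u v, u \in J -> v \in S j -> adj u v]) /\
    (forall i j u v, i \in l -> j \in l -> i != j -> u \in S i -> v \in S j -> adj u v).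
Proof.
move=> hJ hB hc; elim: l => [_ _|j l IH]; first by exists (fun=> set0); split.
rewrite /= inE negb_or eq_sym => /andP[jl ul] /andP[ji0 i0l].
have [S [S1 S2]] := IH ul i0l.
pose J' := J :|: \bigcup_(i in [set i in l]) S i.
have J'c : (#|J'| <= #|J| + p * c)%N.
  apply: leq_trans (leq_card_setU _ _) _; rewrite leq_add2l.
  apply: leq_trans (_ : (\sum_(i in [set i in l]) c <= _)%N).
    apply: (@leq_trans (\sum_(i in [set i in l]) #|S i|)).
      elim/big_ind2: _ => [|A a A' a' h h'|] //; first by rewrite cards0.
      by apply: leq_trans (leq_card_setU _ _) (leq_add h h').
    by apply: leq_sum => i; rewrite inE => /S1[_ ->].
  by rewrite sum_nat_const leq_mul2r -[p in (_ <= p)%N]card_ord max_card orbT.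
have nJ' q : q \in J' -> (#|nonadj (B j) q| <= M)%N.
  case/setUP => [qJ|/bigcupP[i il qS]]; first exact: hJ.
  rewrite inE in il; have [/subsetP sB _ _] := S1 i il.
  apply: (hB i) => //; last exact: sB.
    by apply: contraNneq i0l => <-.
  by apply: contraNneq jl => <-.
have big : (c <= #|B j :&: cnbr J'|)%N.
  have := card_cnbr nJ'; have := hc j ji0 => h1 h2.
  have h3 : (#|J'| * M <= (#|J| + p * c) * M)%N by rewrite leq_mul2r J'c orbT.
  by move: h1 h2 h3; clear; lia.
have [A /subsetP sA Ac] := subset_of_card big.
have AP v : v \in A -> v \in B j /\ forall q, q \in J' -> adj q v.
  by move=> /sA; rewrite inE => /andP[vB /cnbrP].
exists (fun i => if i == j then A else S i); split=> [i|i i' u v].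
  rewrite inE; case: eqVneq => [-> _|_ /= /S1 //]; split=> //.
    by apply/subsetP => v /AP[].
  by move=> u v uJ /AP[_]; apply; rewrite inE uJ.
have inJ' i0' w : i0' \in l -> w \in S i0' -> w \in J'.
  by move=> il wS; rewrite inE; apply/orP; right; apply/bigcupP; exists i0'; rewrite ?inE.
rewrite !inE; case: (eqVneq i j) => [->|ij] /=; case: (eqVneq i' j) => [->|i'j] //=.
- by move=> _ il _ /AP[_ h] vS; rewrite adj_sym; apply: h; apply: inJ' vS.
- by move=> il _ _ uS /AP[_]; apply; apply: inJ' uS.
- exact: S2.
Qed.

(** The part [S0] in the class [i0] is prescribed, since [J] may see little of that class; it is
    treated as an addition to [J]. *)
Lemma greedy_partite G p c (i0 : 'I_p) (J S0 : {set G})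
    (B : 'I_p -> {set G}) M :
  (forall j u, j != i0 -> u \in J -> (#|nonadj (B j) u| <= M)%N) ->
  (forall j u, j != i0 -> u \in S0 -> (#|nonadj (B j) u| <= M)%N) ->
  (forall i j u, i != i0 -> j != i0 -> i != j -> u \in B i ->
     (#|nonadj (B j) u| <= M)%N) ->
  #|S0| = c ->
  (forall j, j != i0 -> ((#|J| + c + p * c) * M + c <= #|B j|)%N) ->
  exists S : 'I_p -> {set G}, [/\ partite c S, S i0 = S0 &
    forall j u v, j != i0 -> u \in J -> v \in S j -> adj u v].
Proof.
move=> hJ hS0 hB Sc hc.
have hJ' j u : j != i0 -> u \in J :|: S0 -> (#|nonadj (B j) u| <= M)%N.
  by move=> ji; rewrite inE => /orP[]; [apply: hJ | apply: hS0].
have hc' j : j != i0 -> ((#|J :|: S0| + p * c) * M + c <= #|B j|)%N.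
  move=> /hc; apply: leq_trans; rewrite leq_add2r leq_mul2r leq_add2r.
  by rewrite -Sc leq_card_setU orbT.
have ul : uniq (enum (predC1 i0)) by apply: enum_uniq.
have i0l : i0 \notin enum (predC1 i0) by rewrite mem_enum !inE eqxx.
have [S [S1 S2]] := greedy_list hJ' hB hc' ul i0l.
have inl j : j != i0 -> j \in enum (predC1 i0) by rewrite mem_enum.
exists (fun i => if i == i0 then S0 else S i); split; last 2 first.
- by rewrite eqxx.
- move=> j u v ji uJ; rewrite (negbTE ji) => vS.
  by have [_ _] := S1 j (inl j ji); apply=> //; rewrite inE uJ.
split=> [i|i j u v ij].
  case: eqVneq => [_|ii]; first by rewrite Sc.
  by have [_ -> _] := S1 i (inl i ii).
case: (eqVneq i i0) => [ii|ii]; case: (eqVneq j i0) => [jj|jj].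
- by rewrite ii jj eqxx in ij.
- by move=> uS vS; have [_ _] := S1 j (inl j jj); apply=> //; rewrite inE uS orbT.
- move=> uS vS; have [_ _ h] := S1 i (inl i ii).
  by rewrite adj_sym; apply: h => //; rewrite inE vS orbT.
- by apply: S2 => //; apply: inl.
Qed.

(** If a matching of [m] edges inside [A] cannot be extended, its [2 * m] endpoints meet every edge
    in [A]. *)
Lemma matching_or_cover G (A : {set G}) m :
  (exists2 psi : 'I_m * bool -> G, injective psi /\ (forall b, psi b \in A) &
     forall i, adj (psi (i, false)) (psi (i, true))) \/
  (exists2 C : {set G}, (C \subset A) && (#|C| <= 2 * m)%N &
     forall u v, u \in A -> v \in A -> adj u v -> (u \in C) || (v \in C)).
Proof.
elim: m => [|m [[psi [psi_inj psiA] psi_adj]|[C /andP[CA Cm] hC]]].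
- by left; exists (fun b : 'I_0 * bool => False_rect G (notF (ltn_ord b.1)));
    [split; case=> -[] | case].
- pose C := [set psi b | b in [set: 'I_m * bool]].
  have [/existsP[e /and4P[uA vA uv /norP[uC vC]]]|nex] :=
    boolP [exists e : G * G, [&& e.1 \in A, e.2 \in A, adj e.1 e.2 & ~~ ((e.1 \in C) || (e.2 \in C))]].
    left; case: e uA vA uv uC vC => u v /= uA vA uv uC vC.
    have uv' : u != v by apply: contraTneq uv => ->; rewrite adj_irr.
    have pu b : psi b != u by apply: contra uC => /eqP <-; apply: imset_f.
    have pv b : psi b != v by apply: contra vC => /eqP <-; apply: imset_f.
    exists (fun b => if unlift ord_max b.1 is Some j then psi (j, b.2) else
                     if b.2 then v else u).
      split=> [[i b] [j d] /=|[i b] /=].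
        case: unliftP => [i'|] ->; case: unliftP => [j'|] -> //.
        - by move=> /psi_inj [-> ->].
        - by case: d => e; [have := pv (i', b) | have := pu (i', b)]; rewrite e eqxx.
        - by case: b => e; [have := pv (j', d) | have := pu (j', d)]; rewrite -e eqxx.
        - by case: b; case: d => // e; rewrite e eqxx in uv'.
      by case: unliftP => [i'|] _ //; case: b.
    by move=> i /=; case: unliftP => [i'|] _.
  right; exists C.
    apply/andP; split; first by apply/subsetP => _ /imsetP[b _ ->].
    apply: leq_trans (leq_imset_card _ _) _.
    by rewrite cardsT card_prod card_ord card_bool; lia.
  move=> u v uA vA uv; move: nex; rewrite negb_exists => /forallP/(_ (u, v)) /=.
  by rewrite uA vA uv negbK.
- by right; exists C => //; rewrite CA; apply: leq_trans Cm _; lia.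
Qed.

(** * Degrees and transversals relative to a partition *)

Section RealCounts.
Context (R : realType).

Definition rdeg G (u : G) : R := #|[set v | adj u v]|%:R.

Definition part G k (f : G -> 'I_k.+1) i : {set G} := [set v | f v == i].

Definition mis G k (f : G -> 'I_k.+1) (u : G) : {set G} :=
  [set v | (f u != f v) && ~~ adj u v].

Definition inn G k (f : G -> 'I_k.+1) (u : G) : {set G} :=
  [set v | adj u v && (f u == f v)].

Lemma rdegE G (u : G) : rdeg u = \sum_(v | adj u v) 1.
Proof. by rewrite sumr_const /rdeg cardsE. Qed.

Lemma sum_dist_ge G (x : G -> R) (A : {set G}) :
  #|A|%:R - \sum_v `|x v - 1| <= \sum_(v in A) x v.
Proof.
rewrite -sum_indicator lerBlDr [X in _ <= X + _]big_mkcond /= -big_split /=.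
apply: ler_sum => v _; have := ler_norm (1 - x v); rewrite -normrN opprB.
by case: (v \in A) => /=; have := normr_ge0 (x v - 1); lra.
Qed.

(** The degree is the neighbour sum of the constant 1. This estimate translates degree bounds into
    bounds on entries of [x] and back. *)
Lemma degree_close G (x : G -> R) (r : R) (u : G) : perron x r ->
  `|r * x u - rdeg u| <= \sum_v `|x v - 1|.
Proof.
case=> _ _ xe; rewrite -xe /nb rdegE -sumrB.
apply: le_trans (ler_norm_sum _ _ _) _.
by rewrite big_mkcond; apply: ler_sum => v _; case: ifP.
Qed.

Lemma card_part_sum G k (f : G -> 'I_k.+1) :
  \sum_i #|part f i|%:R = #|G|%:R :> R.
Proof.
rewrite -natr_sum; congr _%:R; rewrite -sum1_card (partition_big f predT) //=.
by apply: eq_bigr => i _; rewrite sum1_card cardsE.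
Qed.

Lemma sum_card_part G k (f : G -> 'I_k.+1) :
  \sum_u #|part f (f u)|%:R = \sum_i #|part f i|%:R ^+ 2 :> R.
Proof.
rewrite (partition_big f predT) //=; apply: eq_bigr => i _.
rewrite (eq_bigr (fun=> #|part f i|%:R)) => [|u /eqP ->] //.
by rewrite sumr_const expr2 -[LHS]mulr_natl cardsE.
Qed.

Lemma degree_split G k (f : G -> 'I_k.+1) (u : G) :
  rdeg u + #|mis f u|%:R + #|part f (f u)|%:R = #|G|%:R + #|inn f u|%:R.
Proof.
rewrite /rdeg -!natrD; congr _%:R; rewrite -!sum1_card.
rewrite ![\sum_(i in _) 1%N]big_mkcond /= -!big_split /=; apply: eq_bigr => v _.
by rewrite !inE [f v == _]eq_sym; case: (adj u v); case: (_ == _).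
Qed.

(** The missing cross pairs and the variance of the part sizes are both nonnegative, and by
    [degree_split] their total is [(1 - 1/p) n^2] plus the inner pairs minus the degree sum. That
    total is at most [4 * e * n^2]. *)
Lemma partition_counts G k (f : G -> 'I_k.+1) (x : G -> R) (r e : R) :
  perron x r -> (0 < #|G|)%N ->
  (1 - k.+1%:R^-1 - e) * #|G|%:R <= r ->
  \sum_v `|x v - 1| <= e * #|G|%:R ->
  \sum_u #|inn f u|%:R <= e * #|G|%:R ^+ 2 ->
  \sum_u #|mis f u|%:R <= 4 * e * #|G|%:R ^+ 2 /\
  forall i, (#|part f i|%:R - #|G|%:R / k.+1%:R) ^+ 2 <= 4 * e * #|G|%:R ^+ 2.
Proof.
move=> px G0 hr hD hI; have [qx Yn _] := perron_facts px.
have [x0 x1 xe] := px.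
have p0 : 0 < k.+1%:R :> R by rewrite ltr0n.
set n : R := #|G|%:R in hr hD hI qx Yn *.
set D := \sum_v `|x v - 1| in hD; set Y := \sum_v x v in Yn.
have n0 : 0 < n by rewrite ltr0n.
have Y0 : 0 <= Y by apply: sumr_ge0.
have YD : n - D <= Y.
  have := sum_dist_ge x [set: G]; rewrite cardsT; congr (_ <= _).
  by apply: eq_bigl => v; rewrite inE.
have rn : r <= n.
  rewrite -(ler_pM2r n0) -qx /qform; apply: (@le_trans _ _ (Y * Y)).
    rewrite {1}/Y big_distrl /=; apply: ler_sum => v _.
    by apply: ler_wpM2l => //; apply: nb_le_sum.
  by apply: ler_pM.
have D0 : 0 <= D by apply: sumr_ge0.
have dsum : r * n - 2 * n * D <= \sum_(u : G) rdeg u.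
  have h : r * Y - n * D <= \sum_(u : G) rdeg u.
    have -> : r * Y - n * D = \sum_u (r * x u - D).
      by rewrite sumrB -big_distrr /= sumr_const mulr_natl.
    apply: ler_sum => u _; have := degree_close u px; rewrite ler_norml -/D.
    by case/andP => _; lra.
  apply: le_trans h.
  have [r0|r0] := lerP 0 r.
    have : r * (n - D) <= r * Y by apply: ler_wpM2l.
    have : r * D <= n * D by apply: ler_wpM2r.
    by clear; lra.
  have : r * n <= r * Y by rewrite ler_nM2l.
  have : 0 <= n * D by rewrite mulr_ge0 // ltW.
  by clear; lra.
have hsum : \sum_(u : G) rdeg u + \sum_u #|mis f u|%:R + \sum_i #|part f i|%:R ^+ 2 =
    n ^+ 2 + \sum_u #|inn f u|%:R.
  rewrite -sum_card_part -!big_split /=.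
  rewrite (eq_bigr (fun u => n + #|inn f u|%:R)) => [|u _]; last exact: degree_split.
  by rewrite big_split /= sumr_const expr2 -[n *+ _]mulr_natl.
pose P2 : R := \sum_i #|part f i|%:R ^+ 2; rewrite -/P2 in hsum.
have P2E : \sum_i (#|part f i|%:R - n / k.+1%:R) ^+ 2 = P2 - k.+1%:R^-1 * n ^+ 2.
  rewrite (eq_bigr (fun i => #|part f i|%:R ^+ 2 + (n / k.+1%:R) ^+ 2 - 2 * n / k.+1%:R * #|part f i|%:R)).
    rewrite sumrB big_split /= sumr_const card_ord -big_distrr /= card_part_sum -/n.
    rewrite -/P2.
    rewrite -[_ *+ k.+1]mulr_natl; move: p0; move: (k.+1%:R : R) => q q0.
    by field; rewrite gt_eqF.
  by move=> i _; move: p0; move: (k.+1%:R : R) => q q0; field; rewrite gt_eqF.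
have P2lo : 0 <= P2 - k.+1%:R^-1 * n ^+ 2.
  by rewrite -P2E; apply: sumr_ge0 => i _; apply: sqr_ge0.
have m0 : 0 <= \sum_u #|mis f u|%:R :> R by apply: sumr_ge0.
have h1 : (1 - k.+1%:R^-1 - e) * n ^+ 2 <= r * n by rewrite expr2 mulrA ler_pM2r.
have h2 : n * D <= e * n ^+ 2 by rewrite mulrC expr2 mulrA ler_pM2r.
split.
  move: hsum dsum P2lo h1 h2 hI; move: (P2) (k.+1%:R^-1 : R) => P2' ip.
  by clear; lra.
move=> i; apply: (@le_trans _ _ (P2 - k.+1%:R^-1 * n ^+ 2)); last first.
  move: hsum dsum m0 h1 h2 hI; move: (P2) (k.+1%:R^-1 : R) => P2' ip.
  by clear; lra.
rewrite -P2E (bigD1 i) //= lerDl; apply: sumr_ge0 => j _; exact: sqr_ge0.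
Qed.

Lemma markov_card (T : finType) (g : T -> nat) (t : R) : 0 < t ->
  #|[set u | t < (g u)%:R]|%:R * t <= \sum_u (g u)%:R.
Proof.
move=> t0; rewrite -sum_indicator big_distrl /=; apply: ler_sum => u _.
rewrite inE; case: ltrP => [h|_]; last by rewrite mul0r.
by rewrite mul1r ltW.
Qed.

Lemma card_cnbr_real G (B Q : {set G}) (M : R) : 0 <= M ->
  (forall q, q \in Q -> #|nonadj B q|%:R <= M) ->
  #|B|%:R <= #|B :&: cnbr Q|%:R + #|Q|%:R * M.
Proof.
move=> M0 hM; have [N NM hN] : exists2 N : nat, N%:R <= M & forall q, q \in Q -> (#|nonadj B q| <= N)%N.
  exists (Num.truncn M); first by rewrite truncn_le.
  by move=> q qQ; rewrite truncn_ge_nat // hM.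
have := card_cnbr hN; rewrite -(ler_nat R) natrD natrM => h.
by apply: le_trans h _; rewrite lerD2l ler_wpM2l.
Qed.

Lemma nonadj_mis G k (f : G -> 'I_k.+1) (B : {set G}) j u :
  B \subset part f j -> f u != j -> (#|nonadj B u| <= #|mis f u|)%N.
Proof.
move=> /subsetP Bj uj; apply: subset_leq_card; apply/subsetP => v.
by rewrite !inE => /andP[/Bj]; rewrite inE => /eqP -> ->; rewrite uj.
Qed.

(** Rewiring [z] to the typical vertices outside one part, here [ord0], preserves [H]-freeness, so
    [SPEX_rewire] bounds [r * x z] below by the weight of these vertices. *)
Lemma min_degree H G m c k (f : G -> 'I_k.+1)
    (x : G -> R) (t : R) :
  (forall F, H F -> (#|F| <= c)%N) -> SPEX R m H G ->
  perron x (spectral_radius R G) -> 0 < spectral_radius R G ->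
  0 < t -> 1 <= t * #|G|%:R ->
  #|part f ord0|%:R <= (k.+1%:R^-1 + t) * #|G|%:R ->
  c%:R * (t * #|G|%:R) + c%:R < #|part f ord0|%:R ->
  #|[set u | t * #|G|%:R < #|mis f u|%:R]|%:R <= t * #|G|%:R ->
  \sum_v `|x v - 1| <= t * #|G|%:R ->
  forall z, (1 - k.+1%:R^-1 - 4 * t) * #|G|%:R <= spectral_radius R G * x z.
Proof.
move=> Hc sp px r0 t0 n1 hp1 hp2 hT hD z.
set n : R := #|G|%:R in n1 hp1 hp2 hT hD *.
pose A := [set u | [&& u != z, f u != ord0 & #|mis f u|%:R <= t * n]].
apply: (@le_trans _ _ (\sum_(v in A) x v)).
  apply: le_trans (sum_dist_ge _ _).
  have : n <= #|A|%:R + #|[set z]|%:R + #|part f ord0|%:R + #|[set u | t * n < #|mis f u|%:R]|%:R.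
    set Z := [set u | t * n < #|mis f u|%:R].
    have h : (#|G| <= #|A| + #|[set z]| + #|part f ord0| + #|Z|)%N.
      have sub : [set: G] \subset A :|: [set z] :|: part f ord0 :|: Z.
        apply/subsetP => u _; rewrite !inE [t * n < _]ltNge.
        by case: (u == z); case: (f u == _); case: (_ <= _).
      rewrite -cardsT; apply: leq_trans (subset_leq_card sub) _.
      do 2 (apply: leq_trans (leq_card_setU _ _) _; rewrite leq_add2r).
      exact: leq_card_setU.
    by rewrite -!natrD ler_nat.
  rewrite cards1; move: hp1 hT hD n1; clear.
  by move: (k.+1%:R^-1 : R) => ip; lra.
apply: (SPEX_rewire Hc sp px r0); first by rewrite !inE eqxx.
move=> Q /subsetP QA Qc; have tn0 : 0 <= t * n by rewrite mulr_ge0 // ltW.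
have hQ q : q \in Q -> #|nonadj (part f ord0) q|%:R <= t * n.
  move=> /QA; rewrite inE => /and3P[_ q0]; apply: le_trans.
  by rewrite ler_nat (nonadj_mis _ q0).
have := card_cnbr_real tn0 hQ => h.
have Qc' : #|Q|%:R * (t * n) <= c%:R * (t * n) by rewrite ler_wpM2r // ler_nat.
have : c%:R < #|part f ord0 :&: cnbr Q|%:R :> R by move: h Qc' hp2; clear; lra.
by rewrite ltr_nat => /leq_trans -> //; apply: subset_leq_card; apply: subsetIr.
Qed.

(** If every part met the common neighbourhood of [J] in more than [d n] vertices, the typical ones
    among them, those in [T], would allow a greedy choice of [k+1] parts joined to [J], against
    [no_gamma_join]. *)
Lemma common_small H G c k (f : G -> 'I_k.+1)
    (J : {set G}) (t d : R) :
  (forall F, H F -> (#|F| <= c)%N) -> family_p H = k.+1 -> (0 < k)%N ->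
  (0 < family_gamma H)%N -> graph_free H G ->
  0 <= t -> (family_gamma H <= #|J|)%N ->
  #|[set u | t * #|G|%:R < #|mis f u|%:R]|%:R <= t * #|G|%:R ->
  (#|J|%:R + c%:R + k.+1%:R * c%:R + 1) * (t * #|G|%:R) + c%:R <= d * #|G|%:R ->
  exists i, #|part f i :&: cnbr J|%:R <= d * #|G|%:R.
Proof.
move=> Hc pE k0 g0 free t0 gJ hT hd.
set n : R := #|G|%:R in hT hd *.
have tn0 : 0 <= t * n by rewrite mulr_ge0.
apply: contrapT => nex.
have gt i : d * n < #|part f i :&: cnbr J|%:R.
  by rewrite ltNge; apply/negP => h; apply: nex; exists i.
pose T := [set u | #|mis f u|%:R <= t * n].
pose B i := part f i :&: cnbr J :&: T.
have Bp i : B i \subset part f i by rewrite /B -setIA subsetIl.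
have BJ i : B i \subset cnbr J by rewrite /B setIAC subsetIr.
have BT i : B i \subset T by apply: subsetIr.
have Bc i : (#|J|%:R + c%:R + k.+1%:R * c%:R) * (t * n) + c%:R <= #|B i|%:R.
  have : #|part f i :&: cnbr J|%:R <= #|B i|%:R + #|[set u | t * n < #|mis f u|%:R]|%:R :> R.
    rewrite -natrD ler_nat -(cardsID T) leq_add2l; apply: subset_leq_card.
    by apply/subsetP => u; rewrite !inE ltNge => /andP[].
  by have := gt i; move: hT hd tn0; clear; lra.
pose M := Num.truncn (t * n).
have MP u : u \in T -> (#|mis f u| <= M)%N by rewrite inE /M truncn_ge_nat.
have Bcn i : ((#|J| + c + k.+1 * c) * M + c <= #|B i|)%N.
  rewrite -(ler_nat R); apply: le_trans (Bc i); rewrite natrD natrM lerD2r (natrD _ (#|J| + c)) (natrD _ #|J|) natrM.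
  apply: ler_wpM2l; first by rewrite !addr_ge0 // mulr_ge0.
  by rewrite truncn_le.
have [S0 /subsetP S0B S0c] : exists2 S0 : {set G}, S0 \subset B ord0 & #|S0| = c.
  by apply: subset_of_card; have := Bcn ord0; apply: leq_trans; rewrite leq_addl.
have BJ' i u v : u \in J -> v \in B i -> adj u v.
  by move=> uJ /(subsetP (BJ i))/cnbrP; apply.
have hJ j u : j != ord0 -> u \in J -> (#|nonadj (B j) u| <= M)%N.
  move=> _ uJ; rewrite (_ : nonadj _ _ = set0) ?cards0 //.
  apply/setP => v; rewrite [LHS]inE [RHS]inE.
  by apply/negbTE/negP => /andP[/(BJ' _ _ _ uJ) ->].
have hB i j u : i != j -> u \in B i -> (#|nonadj (B j) u| <= M)%N.
  move=> ij uB; apply: leq_trans (MP u (subsetP (BT i) u uB)).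
  apply: (nonadj_mis (Bp j)); have := subsetP (Bp i) u uB; rewrite inE => /eqP ->.
  exact: ij.
have hS0 j u : j != ord0 -> u \in S0 -> (#|nonadj (B j) u| <= M)%N.
  by move=> jo /S0B; apply: hB; rewrite eq_sym.
have [S [pS SE SJ]] := @greedy_partite G k.+1 c ord0 J S0 B M hJ hS0
  (fun i j u _ _ ij => hB i j u ij) S0c (fun j _ => Bcn j).
apply: (no_gamma_join Hc pE k0 g0 free gJ pS) => i u v uJ.
have [->|io] := eqVneq i ord0; last exact: SJ.
by rewrite SE => /S0B; apply: BJ'.
Qed.

Definition dpart G k (f : G -> 'I_k.+1) (u : G) i : R :=
  #|[set v | adj u v && (f v == i)]|%:R.

(** The product counts the transversals of the parts that lie in the neighbourhood of [u]. *)
Lemma dpart_prod G k (f : G -> 'I_k.+1) (u : G) :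
  \prod_i dpart f u i =
  \sum_(Q : {ffun 'I_k.+1 -> G} | [forall i, f (Q i) == i])
     ([forall i, adj u (Q i)])%:R.
Proof.
rewrite (eq_bigr (fun i => \sum_v (adj u v && (f v == i))%:R)) => [|i _]; last first.
  by rewrite /dpart -sum_indicator; apply: eq_bigr => v _; rewrite inE.
rewrite bigA_distr_bigA [RHS]big_mkcond /=; apply: eq_bigr => Q _.
have [fQ|nfQ] := boolP [forall i, f (Q i) == i].
  have [aQ|naQ] := boolP [forall i, adj u (Q i)].
    by rewrite big1 // => i _; rewrite (forallP aQ) (forallP fQ).
  move: naQ; rewrite negb_forall => /existsP[i /negbTE ni].
  by rewrite (bigD1 i) //= ni mul0r.
move: nfQ; rewrite negb_forall => /existsP[i /negbTE ni].
by rewrite (bigD1 i) //= ni andbF mul0r.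
Qed.

Lemma cnbr_prod G k (f : G -> 'I_k.+1) (J : {set G}) :
  \prod_i #|part f i :&: cnbr J|%:R =
  \sum_(Q : {ffun 'I_k.+1 -> G} | [forall i, f (Q i) == i])
     ([forall u in J, forall i, adj u (Q i)])%:R :> R.
Proof.
rewrite (eq_bigr (fun i => \sum_v ((v \in cnbr J) && (f v == i))%:R)) => [|i _]; last first.
  by rewrite -sum_indicator; apply: eq_bigr => v _; rewrite !inE andbC.
rewrite bigA_distr_bigA [RHS]big_mkcond /=; apply: eq_bigr => Q _.
have [fQ|nfQ] := boolP [forall i, f (Q i) == i].
  have [/forall_inP aQ|naQ] := boolP [forall u in J, forall i, adj u (Q i)].
    rewrite big1 // => i _; rewrite (forallP fQ) andbT.
    rewrite (_ : Q i \in cnbr J) //; apply/cnbrP => q /aQ /forallP; exact.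
  move: naQ; rewrite negb_forall => /existsP[u]; rewrite negb_imply negb_forall.
  case/andP => uJ /existsP[i ni]; rewrite (bigD1 i) //=.
  rewrite (_ : Q i \in cnbr J = false) ?mul0r //.
  by apply/negbTE/negP => /cnbrP/(_ u uJ); rewrite (negbTE ni).
move: nfQ; rewrite negb_forall => /existsP[i /negbTE ni].
by rewrite (bigD1 i) //= ni andbF mul0r.
Qed.

Lemma part_prod G k (f : G -> 'I_k.+1) :
  \prod_i #|part f i|%:R =
  \sum_(Q : {ffun 'I_k.+1 -> G} | [forall i, f (Q i) == i]) 1 :> R.
Proof.
have -> : \prod_i #|part f i|%:R = \prod_i #|part f i :&: cnbr set0|%:R :> R.
  apply: eq_bigr => i _; congr (_%:R); apply: eq_card => v; rewrite !inE.
  by rewrite andb_idr // => _; apply/forall_inP => q; rewrite inE.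
rewrite cnbr_prod; apply: eq_bigr => Q _.
by rewrite (_ : [forall u in set0, _]) //; apply/forall_inP => q; rewrite inE.
Qed.

(* A transversal of the parts sees at most [s] vertices of [U], unless it lies
   in the common neighbourhood of some [(s+1)]-subset of [U]. *)
Lemma sum_dpart_prod G k (f : G -> 'I_k.+1) (U : {set G}) s (d : R) :
  0 <= d ->
  (forall J : {set G}, J \subset U -> #|J| = s.+1 ->
     exists i, #|part f i :&: cnbr J|%:R <= d * #|G|%:R) ->
  \sum_(u in U) \prod_i dpart f u i <=
  s%:R * \prod_i #|part f i|%:R + #|U|%:R * 2 ^+ #|U| * d * #|G|%:R ^+ k.+1.
Proof.
move=> d0 hJ; set n : R := #|G|%:R.
pose JJ := [set J : {set G} | (J \subset U) && (#|J| == s.+1)].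
(* A transversal seen by more than [s] vertices of [U] pays [#|U|] for one [(s+1)]-subset of them;
   there are at most [2 ^ #|U|] such subsets. *)
have h1 : \sum_(u in U) \prod_i dpart f u i <=
   \sum_(Q : {ffun 'I_k.+1 -> G} | [forall i, f (Q i) == i])
     (s%:R + #|U|%:R * \sum_(J in JJ) ([forall u in J, forall i, adj u (Q i)])%:R).
  under eq_bigr => u _ do rewrite dpart_prod.
  rewrite exchange_big /=; apply: ler_sum => Q _.
  pose UQ := [set u in U | [forall i, adj u (Q i)]].
  have -> : \sum_(u in U) ([forall i, adj u (Q i)])%:R = #|UQ|%:R :> R.
    rewrite -sum_indicator big_mkcond /=; apply: eq_bigr => u _; rewrite inE.
    by case: (u \in U).
  have s0 : 0 <= \sum_(J in JJ) ([forall u in J, forall i, adj u (Q i)])%:R :> R.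
    by apply: sumr_ge0.
  have [UQs|UQs] := leqP #|UQ| s.
    apply: (@le_trans _ _ s%:R); first by rewrite ler_nat.
    by rewrite lerDl mulr_ge0.
  have [J0 /subsetP J0U J0c] := subset_of_card UQs.
  have J0J : J0 \in JJ.
    rewrite inE J0c eqxx andbT; apply/subsetP => u /J0U; by rewrite inE => /andP[].
  rewrite (bigD1 J0) //= (_ : [forall u in J0, _]); last first.
    by apply/forall_inP => u /J0U; rewrite inE => /andP[].
  have : 0 <= \sum_(i in JJ | i != J0) ([forall u in i, forall i0, adj u (Q i0)])%:R :> R.
    by apply: sumr_ge0.
  have : #|UQ|%:R <= #|U|%:R :> R.
    by rewrite ler_nat subset_leq_card //; apply/subsetP => u; rewrite inE => /andP[].
  have : 0 <= s%:R :> R by [].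
  have : 0 <= #|U|%:R :> R by [].
  by move: (\sum_(i in JJ | _) _) => w /=; clear; nra.
apply: le_trans h1 _.
rewrite big_split /= -big_distrr /= exchange_big /=.
have -> : \sum_(Q : {ffun 'I_k.+1 -> G} | [forall i, f (Q i) == i]) s%:R =
    s%:R * \prod_i #|part f i|%:R :> R.
  by rewrite part_prod big_distrr /=; apply: eq_bigr => Q _; rewrite mulr1.
rewrite lerD2l -!mulrA; apply: ler_wpM2l => //.
under eq_bigr => J _ do rewrite -cnbr_prod.
apply: (@le_trans _ _ (\sum_(J in JJ) d * n ^+ k.+1)).
  apply: ler_sum => J; rewrite inE => /andP[JU /eqP Js].
  have [i hi] := hJ J JU Js.
  rewrite (bigD1 i) //= exprS mulrA; apply: ler_pM => //.
    by apply: prodr_ge0.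
  have -> : n ^+ k = \prod_(j : 'I_k.+1 | j != i) n.
    by rewrite prodr_const cardC1 card_ord.
  apply: ler_prod => j _; rewrite ler0n /= ler_nat; exact: max_card.
rewrite sumr_const -[_ *+ #|_|]mulr_natl; apply: ler_wpM2r.
  by rewrite mulr_ge0 ?exprn_ge0.
rewrite -natrX ler_nat -card_powerset; apply: subset_leq_card; apply/subsetP => J.
by rewrite !inE => /andP[].
Qed.

End RealCounts.

(** * Partitions around a small exceptional set *)

Definition near R G k (U : {set G}) (f : G -> 'I_k.+1) (t : R) :=
  [/\ forall i, `|#|cls U f i|%:R - #|G|%:R / k.+1%:R| <= t * #|G|%:R,
      forall v, v \notin U ->
        #|[set u in ~: U | adj v u && (f u == f v)]|%:R <= t * #|G|%:R &
      forall v, v \notin U ->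
        #|[set u in ~: U | ~~ adj v u && (f u != f v)]|%:R <= t * #|G|%:R].

Lemma card_sub_setU (T : finType) (A B D : {set T}) :
  A \subset B :|: D -> (#|A| <= #|B| + #|D|)%N.
Proof.
by move=> /subset_leq_card h; apply: leq_trans h (leq_card_setU _ _).
Qed.

(** A typical vertex sees nearly all of every other part, so only its own part can contain few
    neighbours of it: [f'] differs from [f] at most on [U] and on atypical vertices. Few inner
    neighbours together with the degree bound leave few missing cross neighbours. *)
Lemma near_of_partition R G k (f f' : G -> 'I_k.+1)
    (U : {set G}) (t h : R) :
  (0 < #|G|)%N -> 0 < h -> 4 * h <= t -> t + 2 * h < k.+1%:R^-1 ->
  (forall i, `|#|part f i|%:R - #|G|%:R / k.+1%:R| <= h * #|G|%:R) ->
  (forall v : G, (1 - k.+1%:R^-1 - h) * #|G|%:R <= rdeg R v) ->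
  #|[set u | h * #|G|%:R < #|mis f u|%:R]|%:R <= h * #|G|%:R ->
  #|U|%:R <= h * #|G|%:R ->
  (forall v, v \notin U -> dpart R f v (f' v) <= t * #|G|%:R) ->
  near U f' (2 * t).
Proof.
move=> G0 h0 ht tp hn hdeg hT hU hf'.
set n : R := #|G|%:R in hn hdeg hT hU hf' *.
have n0 : 0 < n by rewrite ltr0n.
pose ip : R := k.+1%:R^-1.
have hn' i : (ip - h) * n <= #|part f i|%:R /\ #|part f i|%:R <= (ip + h) * n.
  have := hn i; rewrite ler_norml -/ip => /andP[]; clear; move: (ip) => ip'.
  by move=> a b; split; lra.
pose D := [set v | (v \in U) || (f' v != f v)].
have DE : D \subset U :|: [set u | h * n < #|mis f u|%:R].
  apply/subsetP => v; rewrite !inE; case: (boolP (v \in U)) => //= vU ne.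
  rewrite ltNge; apply/negP => hm.
  have sub : part f (f' v) \subset [set u | adj v u && (f u == f' v)] :|: mis f v.
    apply/subsetP => u; rewrite !inE => /eqP fu; rewrite fu eqxx andbT eq_sym ne.
    by case: (adj v u).
  have := card_sub_setU sub; rewrite -(ler_nat R) natrD -/(dpart R f v _).
  have := hf' v vU; have [h1 _] := hn' (f' v).
  have : (t + 2 * h) * n < ip * n by rewrite ltr_pM2r.
  by move: hm h1; clear; move: (ip) => ip'; lra.
have Dn : #|D|%:R <= 2 * h * n.
  have := card_sub_setU DE; rewrite -(ler_nat R) natrD.
  by move: hT hU; clear; lra.
have hn2 : h * n > 0 by rewrite mulr_gt0.
have tn : 4 * h * n <= t * n by rewrite ler_pM2r.
have inD u : u \notin U -> (f' u == f u) || (u \in D).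
  by move=> _; rewrite inE; case: (u \in U); case: (f' u == f u).
split=> [i|v vU|v vU].
- have s1 : part f i \subset cls U f' i :|: D.
    apply/subsetP => u; rewrite !inE => /eqP fu.
    by case: (boolP (u \in U)) => //= uU; rewrite fu; case: (f' u == i).
  have s2 : cls U f' i \subset part f i :|: D.
    apply/subsetP => u; rewrite !inE => /andP[/negbTE -> /eqP <-] /=.
    by rewrite eq_sym; case: (f' u == f u).
  have := card_sub_setU s1; have := card_sub_setU s2.
  rewrite -!(ler_nat R) !natrD; have [h1 h2] := hn' i => h3 h4.
  rewrite ler_norml -/ip; move: h1 h2 h3 h4 Dn tn hn2; clear; move: (ip) => ip'.
  by move=> *; apply/andP; split; lra.
- have s1 : [set u in ~: U | adj v u && (f' u == f' v)] \subset
     [set u | adj v u && (f u == f' v)] :|: D.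
    apply/subsetP => u; rewrite inE in_setC => /and3P[/inD + avu /eqP fu].
    by rewrite !inE avu fu; case/orP => [/eqP <-|->]; rewrite ?eqxx ?orbT.
  have := card_sub_setU s1; rewrite -(ler_nat R) natrD -/(dpart R f v _).
  have := hf' v vU; move: Dn tn hn2; clear; lra.
- have s1 : [set u in ~: U | ~~ adj v u && (f' u != f' v)] \subset
     [set u | ~~ adj v u && (f u != f' v)] :|: D.
    apply/subsetP => u; rewrite inE in_setC => /and3P[/inD + avu fu].
    by rewrite !inE avu; case/orP => [/eqP <-|->]; rewrite ?fu ?orbT.
  have e : #|[set u | ~~ adj v u && (f u != f' v)]|%:R + rdeg R v + #|part f (f' v)|%:R
      = n + dpart R f v (f' v).
    rewrite /rdeg /dpart -!natrD; congr _%:R; rewrite -!sum1_card.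
    rewrite ![\sum_(i in _) 1%N]big_mkcond /= -!big_split /=; apply: eq_bigr => u _.
    by rewrite !inE; case: (adj v u); case: (_ == _).
  have := card_sub_setU s1; rewrite -(ler_nat R) natrD.
  have := hf' v vU; have := hdeg v; have [h1 h2] := hn' (f' v).
  move: e h1 Dn tn hn2; rewrite -/ip; clear; move: (ip) => ip'; lra.
Qed.

(** A matching of [m] edges inside a class, a part of the same class avoiding it, and parts chosen
    greedily in the other classes would contradict [no_matching_join]. *)
Lemma near_cover R H G m c k
    (U : {set G}) (f : G -> 'I_k.+1) (t : R) :
  (forall F, H F -> (#|F| <= c)%N) -> family_p H = k.+1 -> (0 < k)%N ->
  decomposition H (matching_graph m) -> (0 < c)%N -> graph_free H G ->
  0 <= t -> near U f t ->
  (2 * m%:R + c%:R + k.+1%:R * c%:R + 1) * (t * #|G|%:R) + c%:R + 2 * m%:R <=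
     #|G|%:R / k.+1%:R ->
  forall i, exists2 C : {set G}, (C \subset cls U f i) && (#|C| <= 2 * m)%N &
    forall u v, u \in cls U f i -> v \in cls U f i -> adj u v -> (u \in C) || (v \in C).
Proof.
move=> Hc pE k0 dm c0 free t0 [hn _ hmis] hb i.
have [[psi [psi_inj psiA] psi_adj]|//] := matching_or_cover (cls U f i) m.
exfalso; set n : R := #|G|%:R in hn hmis hb.
have tn0 : 0 <= t * n by rewrite mulr_ge0.
pose q : R := 2 * m%:R + c%:R + k.+1%:R * c%:R.
have qtn : 0 <= q * (t * n) by rewrite mulr_ge0 // !addr_ge0 // mulr_ge0.
rewrite -/q in hb.
pose J := [set psi b | b in [set: 'I_m * bool]].
have Jc : #|J| = (2 * m)%N.
  by rewrite card_imset // cardsT card_prod card_ord card_bool mulnC.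
have clsn j : n / k.+1%:R - t * n <= #|cls U f j|%:R.
  by have := hn j; rewrite ler_norml => /andP[]; move: (n / _) => w; clear; lra.
have JA u : u \in J -> u \in cls U f i by case/imsetP => b _ ->.
pose M := Num.truncn (t * n).
have hM u j : u \notin U -> f u != j -> (#|nonadj (cls U f j) u| <= M)%N.
  move=> uU uj; rewrite truncn_ge_nat //; apply: le_trans (hmis u uU).
  rewrite ler_nat; apply: subset_leq_card; apply/subsetP => v; rewrite !inE.
  by case/andP => /andP[-> /eqP fv] ->; rewrite fv /= eq_sym.
have clsU u j : u \in cls U f j -> u \notin U /\ f u = j.
  by rewrite inE => /andP[-> /eqP].
have [S0 /subsetP S0B S0c] : exists2 S0 : {set G}, S0 \subset cls U f i :\: J & #|S0| = c.
  apply: subset_of_card; rewrite -(leq_add2l #|J|) -(ler_nat R) natrD.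
  apply: (@le_trans _ _ #|cls U f i|%:R).
    apply: le_trans (clsn i); rewrite Jc natrM.
    move: hb qtn; rewrite mulrDl mul1r.
    move: (n / k.+1%:R) => w1; move: (t * n) => w2; clearbody q; clear; lra.
  rewrite ler_nat -(cardsID J (cls U f i)) leq_add2r.
  by apply: subset_leq_card; apply: subsetIr.
have hJ j u : j != i -> u \in J -> (#|nonadj (cls U f j) u| <= M)%N.
  by move=> ji /JA/clsU[uU fu]; apply: hM => //; rewrite fu eq_sym.
have hS0 j u : j != i -> u \in S0 -> (#|nonadj (cls U f j) u| <= M)%N.
  move=> ji /S0B/setDP[/clsU[uU fu] _]; apply: hM => //; by rewrite fu eq_sym.
have hB a j u : a != i -> j != i -> a != j -> u \in cls U f a ->
    (#|nonadj (cls U f j) u| <= M)%N.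
  by move=> _ _ aj /clsU[uU fu]; apply: hM => //; rewrite fu.
have hc j : j != i -> ((#|J| + c + k.+1 * c) * M + c <= #|cls U f j|)%N.
  move=> _; rewrite -(ler_nat R); apply: le_trans (clsn j); rewrite Jc.
  rewrite natrD natrM (natrD _ (2 * m + c)) (natrD _ (2 * m)) !natrM.
  have : q * M%:R <= q * (t * n).
    apply: ler_wpM2l; first by rewrite /q !addr_ge0 // mulr_ge0.
    by rewrite truncn_le.
  have m0 : 0 <= m%:R :> R by [].
  move: hb; rewrite mulrDl mul1r -/q; move: m0.
  move: (n / k.+1%:R) => w1; move: (t * n) => w2; clearbody q; clear; lra.
have [S [pS SE SJ]] := greedy_partite hJ hS0 hB S0c hc.
apply: (no_matching_join Hc pE k0 dm c0 free psi_inj psi_adj pS (i0 := i)).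
  move=> b; rewrite SE; apply/negP => /S0B/setDP[_].
  by rewrite imset_f.
move=> b j y ji yS; apply: (SJ j) => //; exact: imset_f.
Qed.

(** The inner edges are covered by [2 m] vertices in each of the [k+1] classes, each with at most
    [t n] inner neighbours, so their weight is linear in [n]. The factor 64 is [4 * 4] for the
    entries, 2 for the two orders of a pair, and 2 from [2 * m]. *)
Lemma inner_sum_le R G m k (U : {set G})
    (f : G -> 'I_k.+1) (t : R) (x : G -> R) :
  0 <= t -> near U f t ->
  (forall v, 0 <= x v <= 4) ->
  (forall i, exists2 C : {set G}, (C \subset cls U f i) && (#|C| <= 2 * m)%N &
    forall u v, u \in cls U f i -> v \in cls U f i -> adj u v -> (u \in C) || (v \in C)) ->
  \sum_(u | u \notin U) \sum_(v | [&& v \notin U, adj u v & f u == f v]) x u * x v <=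
  64 * k.+1%:R * m%:R * (t * #|G|%:R).
Proof.
move=> t0 [_ hin _] hx hC; set n : R := #|G|%:R in hin *.
have /choice[C {}hC] : forall i, exists C : {set G}, [/\ C \subset cls U f i, (#|C| <= 2 * m)%N &
    forall u v, u \in cls U f i -> v \in cls U f i -> adj u v -> (u \in C) || (v \in C)].
  by move=> i; have [C /andP[h1 h2] h3] := hC i; exists C.
pose CC := \bigcup_i C i.
have CU u : u \in CC -> u \notin U.
  case/bigcupP => i _; have [/subsetP h _ _] := hC i; move/h.
  by rewrite inE => /andP[].
have CCc : (#|CC| <= k.+1 * (2 * m))%N.
  apply: leq_trans (_ : (\sum_(i < k.+1) #|C i| <= _)%N).
    rewrite /CC; elim/big_ind2: _ => [|A a A' a' h h'|] //; first by rewrite cards0.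
    by apply: leq_trans (leq_card_setU _ _) (leq_add h h').
  apply: (@leq_trans (\sum_(i < k.+1) (2 * m))%N); last by rewrite sum_nat_const card_ord.
  by apply: leq_sum => i _; have [] := hC i.
pose e u v : R := ([&& u \notin U, v \notin U, adj u v & f u == f v])%:R.
have esym u v : e u v = e v u by rewrite /e andbCA [f u == _]eq_sym adj_sym.
have cov u v : [&& u \notin U, v \notin U, adj u v & f u == f v] -> (u \in CC) || (v \in CC).
  case/and4P => uU vU auv /eqP fuv; have [_ _ h] := hC (f u).
  have := h u v; rewrite !inE uU vU fuv eqxx => /(_ isT isT auv).
  by case/orP => h'; apply/orP; [left|right]; apply/bigcupP; exists (f v); rewrite // -?fuv.
apply: (@le_trans _ _ (\sum_u \sum_v 16 * (((u \in CC)%:R + (v \in CC)%:R) * e u v))).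
  rewrite big_mkcond; apply: ler_sum => u _; case: ifP => uU; last first.
    by apply: sumr_ge0 => v _; rewrite mulr_ge0 // mulr_ge0 // addr_ge0.
  rewrite big_mkcond; apply: ler_sum => v _.
  have := cov u v; rewrite /e uU /=; case: ifP => _ h; last first.
    by rewrite mulr0 mulr0.
  have xx : x u * x v <= 16.
    have /andP[a1 a2] := hx u; have /andP[b1 b2] := hx v.
    by move: (x u) (x v) a1 a2 b1 b2 => a b; clear; nra.
  apply: le_trans xx _; rewrite mulr1; case/orP: (h isT) => ->.
    by rewrite ler_peMr // lerDl.
  by rewrite ler_peMr // lerDr.
have Esum : \sum_u \sum_v (u \in CC)%:R * e u v <= k.+1%:R * (2 * m%:R) * (t * n).
  apply: (@le_trans _ _ (\sum_(u in CC) t * n)).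
    rewrite [leRHS]big_mkcond; apply: ler_sum => u _.
    case: (boolP (u \in CC)) => uC; last by rewrite big1 // => v _; rewrite mul0r.
    apply: le_trans (hin u (CU u uC)); rewrite -sum_indicator; apply: ler_sum => v _.
    by rewrite mul1r /e !inE (CU u uC) [f v == _]eq_sym.
  have tn0 : 0 <= t * n by rewrite mulr_ge0.
  rewrite sumr_const -[_ *+ #|_|]mulr_natl; apply: ler_wpM2r => //.
  by rewrite -!natrM ler_nat.
have -> : \sum_u \sum_v 16 * (((u \in CC)%:R + (v \in CC)%:R) * e u v) =
   32 * \sum_u \sum_v (u \in CC)%:R * e u v.
  have e2 : \sum_u \sum_v (v \in CC)%:R * e u v = \sum_u \sum_v (u \in CC)%:R * e u v.
    rewrite exchange_big /=; apply: eq_bigr => u _; apply: eq_bigr => v _.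
    by rewrite esym.
  have -> : \sum_u \sum_v 16 * (((u \in CC)%:R + (v \in CC)%:R) * e u v) =
     16 * (\sum_u \sum_v (u \in CC)%:R * e u v + \sum_u \sum_v (v \in CC)%:R * e u v).
    rewrite -big_split /= big_distrr; apply: eq_bigr => u _ /=.
    by rewrite -big_split /= big_distrr; apply: eq_bigr => v _ /=; ring.
  by rewrite e2; ring.
by move: Esum; move: (\sum_u _) (t * n) (k.+1%:R : R) (m%:R : R) => w1 w2 w3 w4; clear; lra.
Qed.

(** For numbers in the unit interval, [(1 - a) (1 - p) >= 0] absorbs one more factor. The list has
    [size l + 1] entries. *)
Lemma sum_le_prod_seq R (I : Type) (a : I -> R) (i : I) (l : seq I) :
  (forall i, 0 <= a i <= 1) ->
  \sum_(j <- i :: l) a j <= (size l)%:R + \prod_(j <- i :: l) a j.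
Proof.
move=> ha; elim: l i => [|j l IH] i; first by rewrite !big_seq1 add0r.
rewrite [X in X <= _]big_cons [X in _ <= _ + X]big_cons /= -natr1.
have := IH j; set s := \sum_(k <- j :: l) a k; set p := \prod_(k <- j :: l) a k.
have /andP[i0 i1] := ha i.
have p0 : 0 <= p by apply: prodr_ge0 => k _; case/andP: (ha k).
have p1 : p <= 1.
  suff /andP[] : 0 <= p <= 1 by [].
  apply: (big_ind (fun z => 0 <= z <= 1)) => [|z w /andP[z0 z1] /andP[w0 w1]|k _ //].
    by rewrite ler01 lexx.
  by rewrite mulr_ge0 // mulr_ile1.
have : 0 <= (1 - a i) * (1 - p) by rewrite mulr_ge0 // subr_ge0.
by clearbody s p; clear; lra.
Qed.

Lemma sum_le_prod_ord R k (a : 'I_k.+1 -> R) :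
  (forall i, 0 <= a i <= 1) -> \sum_i a i <= k%:R + \prod_i a i.
Proof.
move=> ha; rewrite ![index_enum _]unlock.
have : size (Finite.enum 'I_k.+1) = k.+1 by rewrite -enumT size_enum_ord.
case: (Finite.enum 'I_k.+1) => // i l [sz].
have -> : k%:R = (size l)%:R :> R by rewrite sz.
exact: sum_le_prod_seq.
Qed.

(** Rows in [U] contribute [r * xi] by the eigenvalue equation, and columns in [U] at most as much.
    Outside [U], pairs between classes give at most [(1 - 1/p) Y ^ 2], and Cauchy-Schwarz bounds
    [Y ^ 2] by the number of remaining vertices times their share of the norm. *)
Lemma spectral_gain R G k (U : {set G}) (f : G -> 'I_k.+1)
    (x : G -> R) (r I : R) :
  perron x r -> (0 < k)%N ->
  \sum_(u | u \notin U) \sum_(v | [&& v \notin U, adj u v & f u == f v]) x u * x v <= I ->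
  r * #|G|%:R <= (1 - k.+1%:R^-1) * (#|G|%:R - #|U|%:R) *
      (#|G|%:R - \sum_(u in U) x u ^+ 2) + I + 2 * r * \sum_(u in U) x u ^+ 2.
Proof.
move=> px k0 hI; have [qx _ _] := perron_facts px; have [x0 x1 xe] := px.
set xi := \sum_(u in U) x u ^+ 2.
have p0 : 0 < k.+1%:R :> R by rewrite ltr0n.
pose Y := \sum_(u | u \notin U) x u.
pose Yc i := \sum_(u in cls U f i) x u.
have YE : Y = \sum_i Yc i by rewrite /Y (sum_cls U f).
have Ysq : Y ^+ 2 <= (#|G|%:R - #|U|%:R) * (#|G|%:R - xi).
  apply: le_trans (sqr_sum_le _ _) _.
  have -> : #|[pred u | u \notin U]|%:R = #|G|%:R - #|U|%:R :> R.
    by rewrite -card_notin sumr_const.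
  rewrite le_eqVlt; apply/orP; left; apply/eqP; congr (_ * _).
  by rewrite -x1 [in RHS](bigID (mem U)) /= addrAC subrr add0r.
have YcY : Y ^+ 2 <= k.+1%:R * \sum_i Yc i ^+ 2.
  by rewrite YE; apply: le_trans (sqr_sum_le _ _) _; rewrite card_ord.
pose e u v : R := ([&& v \notin U, u \notin U & f u == f v])%:R.
have crossE : \sum_(u | u \notin U) \sum_(v | (v \notin U) && (f u != f v)) x u * x v
    = Y ^+ 2 - \sum_i Yc i ^+ 2.
  have -> : \sum_i Yc i ^+ 2 = \sum_(u | u \notin U) \sum_(v | (v \notin U) && (f u == f v)) x u * x v.
    rewrite (sum_cls U f); apply: eq_bigr => i _.
    rewrite expr2 big_distrl /=; apply: eq_bigr => u; rewrite inE => /andP[_ /eqP <-].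
    rewrite big_distrr /=; apply: eq_bigl => v; by rewrite inE [f v == _]eq_sym.
  rewrite expr2 big_distrl /= -sumrB; apply: eq_bigr => u _.
  by rewrite /Y big_distrr /= [X in _ = X - _](bigID (fun v => f u == f v)) /= addrAC subrr add0r.
have key : qform x <= (Y ^+ 2 - \sum_i Yc i ^+ 2) + I + 2 * (r * xi).
  have e1 : r * xi = \sum_(u in U) \sum_(v | adj u v) x u * x v.
    rewrite /xi big_distrr /=; apply: eq_bigr => u _.
    by rewrite -big_distrr /= -/(nb x u) xe expr2; ring.
  have e2 : \sum_(u | u \notin U) \sum_(v | adj u v && (v \in U)) x u * x v <= r * xi.
    rewrite e1.
    have -> : \sum_(u in U) \sum_(v | adj u v) x u * x v = \sum_v \sum_(u | adj v u && (u \in U)) x v * x u.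
      rewrite [LHS]big_mkcond /=.
      rewrite [LHS](eq_bigr (fun u => \sum_v if adj u v && (u \in U) then x v * x u else 0)).
        rewrite exchange_big /=; apply: eq_bigr => v _; rewrite [RHS]big_mkcond /=.
        by apply: eq_bigr => u _; rewrite adj_sym.
      move=> u _; case: (u \in U); last by rewrite big1 // => v _; rewrite andbF.
      by rewrite big_mkcond; apply: eq_bigr => v _; rewrite andbT mulrC.
    rewrite [leLHS]big_mkcond; apply: ler_sum => u _; case: ifP => // _.
    by apply: sumr_ge0 => v _; apply: mulr_ge0.
  rewrite qformE (bigID (mem U)) /= -e1.
  have -> : \sum_(u | u \notin U) \sum_(v | adj u v) x u * x v =
    \sum_(u | u \notin U) \sum_(v | adj u v && (v \in U)) x u * x v +
    \sum_(u | u \notin U) \sum_(v | adj u v && (v \notin U)) x u * x v.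
    by rewrite -big_split /=; apply: eq_bigr => u _; rewrite (bigID (mem U)).
  have e3 : \sum_(u | u \notin U) \sum_(v | adj u v && (v \notin U)) x u * x v <=
     (Y ^+ 2 - \sum_i Yc i ^+ 2) + I.
    rewrite -crossE; apply: le_trans (lerD (lexx _) hI).
    rewrite -big_split /=; apply: ler_sum => u _.
    rewrite (bigID (fun v => f u == f v)) /= addrC; apply: lerD.
      rewrite big_mkcond [leRHS]big_mkcond; apply: ler_sum => v _.
      have := mulr_ge0 (x0 u) (x0 v).
      by case: (adj u v); case: (v \notin U); case: (f u == f v).
    rewrite le_eqVlt; apply/orP; left; apply/eqP; apply: eq_bigl => v.
    by case: (adj u v); case: (v \notin U); case: (f u == f v).
  by move: e2 e3; clear; lra.
rewrite -qx; apply: le_trans key _.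
have h1 : Y ^+ 2 - \sum_i Yc i ^+ 2 <= (1 - k.+1%:R^-1) * Y ^+ 2.
  have : k.+1%:R^-1 * Y ^+ 2 <= \sum_i Yc i ^+ 2 by rewrite mulrC ler_pdivrMr // mulrC.
  move: (\sum_i _) (Y ^+ 2) (k.+1%:R^-1 : R) => w1 w2 w3; clear; lra.
have h2 : (1 - k.+1%:R^-1) * Y ^+ 2 <= (1 - k.+1%:R^-1) * ((#|G|%:R - #|U|%:R) * (#|G|%:R - xi)).
  by apply: ler_wpM2l => //; rewrite subr_ge0 invf_le1 // (ler_nat R 1).
move: h1 h2; move: (1 - k.+1%:R^-1) => a h1 h2.
by rewrite -[a * _ * _]mulrA -[2 * r * _]mulrA; lra.
Qed.

(* [s] is the largest possible value of [sum pi^2] subject to [sum pi <= s],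
   and is attained only if every [pi] is 0 or 1. *)
Lemma weights_dichotomy R (T : finType) (U : {set T}) (pi : T -> R) s (d : R) :
  (forall u, 0 <= pi u <= 1) ->
  \sum_(u in U) pi u <= s%:R + d ->
  s%:R - d <= \sum_(u in U) pi u ^+ 2 ->
  0 < d -> d * (5 * (s%:R + 1)) < 1 ->
  exists W : {set T}, [/\ W \subset U, #|W| = s,
    forall u, u \in W -> 1 - 4 * d <= pi u &
    forall u, u \in U -> u \notin W -> pi u <= 4 * d].
Proof.
move=> hp h1 h2 d0 ds.
(* The two sums differ by at most [2 * d], so [pi u * (1 - pi u) <= 2 * d] for each [u] in [U], and
   [pi u] is within [4 * d] of 0 or 1. *)
have sumq : \sum_(u in U) (pi u * (1 - pi u)) <= 2 * d.
  rewrite (eq_bigr (fun u => pi u - pi u ^+ 2)) => [|u _]; last by ring.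
  by rewrite sumrB; move: h1 h2; clear; lra.
have q0 u : 0 <= pi u * (1 - pi u).
  by have /andP[a b] := hp u; rewrite mulr_ge0 // subr_ge0.
have single u : u \in U -> pi u * (1 - pi u) <= 2 * d.
  move=> uU; apply: le_trans sumq; rewrite (bigD1 u) //= lerDl.
  by apply: sumr_ge0.
pose W := [set u in U | 2^-1 <= pi u].
have WU : W \subset U by apply/subsetP => u; rewrite inE => /andP[].
have big u : u \in W -> 1 - 4 * d <= pi u.
  rewrite inE => /andP[/single h a]; have /andP[_ b] := hp u.
  by move: (pi u) h a b => w; clear; nra.
have sml u : u \in U -> u \notin W -> pi u <= 4 * d.
  move=> uU; rewrite inE uU /= -ltNge => a; have h := single u uU.
  by have /andP[b _] := hp u; move: (pi u) h a b => w; clear; nra.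
have split (F : T -> R) : \sum_(u in U) F u = \sum_(u in W) F u + \sum_(u in U | u \notin W) F u.
  rewrite (bigID (mem W)) /=; congr (_ + _); apply: eq_bigl => u.
  by rewrite inE; case: (u \in U).
have rest : \sum_(u in U | u \notin W) pi u <= 4 * d.
  apply: (@le_trans _ _ (\sum_(u in U | u \notin W) 2 * (pi u * (1 - pi u)))).
    apply: ler_sum => u /andP[uU]; rewrite inE uU /= -ltNge => a.
    by have /andP[b _] := hp u; move: (pi u) a b => w; clear; nra.
  rewrite -big_distrr /=.
  have : \sum_(u in U | u \notin W) pi u * (1 - pi u) <= 2 * d.
    by apply: le_trans sumq; rewrite split lerDr sumr_ge0.
  by clear; lra.
exists W; split=> //; apply/eqP; rewrite eqn_leq; apply/andP; split.
  rewrite leqNgt; apply/negP => lt.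
  have : (s%:R + 1) * (1 - 4 * d) <= s%:R + d.
    apply: le_trans h1; rewrite split.
    apply: (@le_trans _ _ (\sum_(u in W) (1 - 4 * d))).
      rewrite sumr_const -[_ *+ #|_|]mulr_natl; apply: ler_wpM2r.
        by move: ds d0; have : 0 <= s%:R :> R by []; move: (s%:R : R) => w; clear; nra.
      by rewrite natr1 ler_nat.
    apply: (@le_trans _ _ (\sum_(u in W) pi u)); first exact: ler_sum.
    by rewrite lerDl; apply: sumr_ge0 => u _; case/andP: (hp u).
  have : 0 <= s%:R :> R by [].
  by move: ds d0; move: (s%:R : R) => w; clear; nra.
rewrite leqNgt; apply/negP => lt.
have : s%:R - d <= #|W|%:R + 4 * d.
  apply: le_trans h2 _; rewrite split; apply: lerD.
    apply: (@le_trans _ _ (\sum_(u in W) 1)); last by rewrite sumr_const.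
    apply: ler_sum => u _; have /andP[a b] := hp u.
    by move: (pi u) a b => w; clear; nra.
  apply: le_trans rest; apply: ler_sum => u _; have /andP[a b] := hp u.
  by move: (pi u) a b => w; clear; nra.
have : #|W|%:R + 1 <= s%:R :> R by rewrite natr1 ler_nat.
have : 0 <= s%:R :> R by [].
by move: ds d0; move: (s%:R : R) (#|W|%:R : R) => w1 w2; clear; nra.
Qed.

(** * Identification of the set [W] *)

Record family_data H k c m : Prop := FamilyData {
  fd_card : forall F, H F -> (#|F| <= c)%N;
  fd_p : family_p H = k.+1;
  fd_k : (0 < k)%N;
  fd_matching : decomposition H (matching_graph m);
  fd_c : (0 < c)%N;
  fd_gamma : (0 < family_gamma H)%N }.

(** The fraction of all transversals of the parts that lie in the neighbourhood of [u]: near 1 for a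
    vertex of [W], near 0 for a vertex with few neighbours in some part. *)
Definition pweight R G k (f : G -> 'I_k.+1) (u : G) : R :=
  \prod_i (dpart R f u i / #|part f i|%:R).

Lemma dpart_le R G k (f : G -> 'I_k.+1) (u : G) i :
  dpart R f u i <= #|part f i|%:R.
Proof.
by rewrite ler_nat; apply: subset_leq_card; apply/subsetP => v; rewrite !inE => /andP[].
Qed.

Lemma dpart_ratio R G k (f : G -> 'I_k.+1) (u : G) i :
  0 <= dpart R f u i / #|part f i|%:R <= 1.
Proof.
apply/andP; split; first by rewrite divr_ge0 // /dpart ler0n.
have := dpart_le R f u i; case: (eqVneq #|part f i| 0%N) => [->|n0 h].
  by rewrite invr0 mulr0.
by rewrite ler_pdivrMr ?mul1r // ltr0n lt0n.
Qed.

Lemma pweight_itv R G k (f : G -> 'I_k.+1) (u : G) :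
  0 <= pweight R f u <= 1.
Proof.
apply: (big_ind (fun z => 0 <= z <= 1)) => [|z w /andP[z0 z1] /andP[w0 w1]|i _].
- by rewrite ler01 lexx.
- by rewrite mulr_ge0 // mulr_ile1.
- exact: dpart_ratio.
Qed.

Lemma pweight_le R G k (f : G -> 'I_k.+1) (u : G) i :
  pweight R f u <= dpart R f u i / #|part f i|%:R.
Proof.
rewrite /pweight (bigD1 i) //=; have /andP[a0 _] := dpart_ratio R f u i.
rewrite ler_piMr //.
suff /andP[] : 0 <= \prod_(j | j != i) (dpart R f u j / #|part f j|%:R) <= 1 by [].
apply: (big_ind (fun z => 0 <= z <= 1)) => [|z w /andP[z0 z1] /andP[w0 w1]|j _].
- by rewrite ler01 lexx.
- by rewrite mulr_ge0 // mulr_ile1.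
- exact: dpart_ratio.
Qed.

Lemma sum_dpart R G k (f : G -> 'I_k.+1) (u : G) :
  \sum_i dpart R f u i = rdeg R u.
Proof.
rewrite rdegE (partition_big f predT) //=; apply: eq_bigr => i _.
by rewrite sumr_const /dpart cardsE.
Qed.

(** [K] such vertices would see at least [K t^(k+1) n^(k+1)] transversals with multiplicity, whereas
    [sum_dpart_prod] allows at most [(s + 1) n^(k+1)]. *)
Lemma rich_bound R G k (f : G -> 'I_k.+1) s K (t d : R) :
  (0 < #|G|)%N -> 0 < t -> 0 <= d ->
  (forall J : {set G}, #|J| = s.+1 -> exists i, #|part f i :&: cnbr J|%:R <= d * #|G|%:R) ->
  s%:R + 1 < K%:R * t ^+ k.+1 -> K%:R * 2 ^+ K * d <= 1 ->
  (#|[set v | [forall i, (t * #|G|%:R <= dpart R f v i)%R]]| < K)%N.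
Proof.
move=> G0 t0 d0 hJ hK hd; rewrite ltnNge; apply/negP => h.
have [U0 /subsetP U0U U0c] := subset_of_card h.
have n0 : 0 < #|G|%:R :> R by rewrite ltr0n.
have := sum_dpart_prod (U := U0) d0 (fun J _ => hJ J).
rewrite U0c; set n : R := #|G|%:R in n0 U0U *.
have np : 0 < n ^+ k.+1 by rewrite exprn_gt0.
have h1 : K%:R * t ^+ k.+1 * n ^+ k.+1 <= \sum_(u in U0) \prod_i dpart R f u i.
  have -> : K%:R * t ^+ k.+1 * n ^+ k.+1 = \sum_(u in U0) (t * n) ^+ k.+1.
    by rewrite sumr_const U0c -[RHS]mulr_natl exprMn mulrA.
  apply: ler_sum => u /U0U; rewrite inE => /forallP hu.
  rewrite -[X in _ ^+ X]card_ord -prodr_const; apply: ler_prod => i _.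
  by rewrite hu mulr_ge0 // ltW.
have h2 : \prod_i #|part f i|%:R <= n ^+ k.+1.
  rewrite -[X in _ ^+ X]card_ord -prodr_const; apply: ler_prod => i _.
  by rewrite ler0n ler_nat max_card.
have h3 : s%:R * \prod_i #|part f i|%:R <= s%:R * n ^+ k.+1 by rewrite ler_wpM2l.
have h4 : K%:R * 2 ^+ K * d * n ^+ k.+1 <= 1 * n ^+ k.+1 by rewrite ler_pM2r.
have h5 : (s%:R + 1) * n ^+ k.+1 < K%:R * t ^+ k.+1 * n ^+ k.+1 by rewrite ltr_pM2r.
move: h1 h3 h4 h5; set A := n ^+ _; set B := K%:R * 2 ^+ K * d * A.
by clear; lra.
Qed.

Lemma pweight_sum R G k (f : G -> 'I_k.+1) (U : {set G}) s K (d b : R) :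
  (0 < #|G|)%N -> 0 <= d -> 0 < b ->
  (forall J : {set G}, #|J| = s.+1 -> exists i, #|part f i :&: cnbr J|%:R <= d * #|G|%:R) ->
  (forall i, b * #|G|%:R <= #|part f i|%:R) -> (#|U| <= K)%N ->
  \sum_(u in U) pweight R f u <= s%:R + K%:R * 2 ^+ K * d / b ^+ k.+1.
Proof.
move=> G0 d0 b0 hJ hb UK; have := sum_dpart_prod (U := U) d0 (fun J _ => hJ J).
have n0 : 0 < #|G|%:R :> R by rewrite ltr0n.
set n : R := #|G|%:R in n0 hb *.
have pp i : 0 < #|part f i|%:R :> R by apply: lt_le_trans (hb i); rewrite mulr_gt0.
set P := \prod_i #|part f i|%:R.
have P0 : 0 < P by apply: prodr_gt0.
have PE u : pweight R f u = (\prod_i dpart R f u i) / P.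
  by rewrite /pweight big_split /= -prodfV.
have Pb : (b * n) ^+ k.+1 <= P.
  rewrite -[X in _ ^+ X]card_ord -prodr_const; apply: ler_prod => i _.
  by rewrite hb mulr_ge0 // ltW.
have b1 : 0 < b ^+ k.+1 by rewrite exprn_gt0.
have UK2 : #|U|%:R * 2 ^+ #|U| * d <= K%:R * 2 ^+ K * d.
  apply: ler_wpM2r => //; rewrite -!natrX -!natrM ler_nat.
  by apply: leq_mul => //; rewrite leq_exp2l.
move=> h; rewrite (eq_bigr (fun u => (\prod_i dpart R f u i) / P)) => [|u _] //.
rewrite -big_distrl /= ler_pdivrMr //; apply: le_trans h _; rewrite mulrDl lerD2l.
set A := K%:R * 2 ^+ K * d in UK2 *.
have A0 : 0 <= A by rewrite mulr_ge0 // mulr_ge0 // exprn_ge0.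
have np : 0 < n ^+ k.+1 by rewrite exprn_gt0.
apply: (@le_trans _ _ (A * n ^+ k.+1)); first by rewrite ler_pM2r.
clearbody A.
rewrite -mulrA ler_wpM2l // mulrC ler_pdivlMr // mulrC -exprMn //.
Qed.

(** The degree of [u] is about [n / p] times the sum of its [k+1] density ratios, which is at most
    [k + pi]. Dividing by [r], about [k n / p], gives [1 + pi / k]. *)
Lemma perron_upper R G k (f : G -> 'I_k.+1) (x : G -> R) (r h : R) (u : G) :
  perron x r -> (0 < k)%N -> 0 < h -> h <= 4^-1 ->
  (1 - k.+1%:R^-1 - h) * #|G|%:R <= r ->
  \sum_v `|x v - 1| <= h * #|G|%:R ->
  (forall i, #|part f i|%:R <= (k.+1%:R^-1 + h) * #|G|%:R) ->
  (0 < #|G|)%N -> (forall i, 0 < #|part f i|)%N ->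
  x u <= 1 + k%:R^-1 * pweight R f u + 4 * (k.+1%:R + 3) * h.
Proof.
move=> px k0 h0 h4 hr hD hp G0 pp.
have n0 : 0 < #|G|%:R :> R by rewrite ltr0n.
set n : R := #|G|%:R in n0 hr hD hp *.
have := degree_close u px; rewrite ler_norml => /andP[_ hd].
set pi := pweight R f u.
have /andP[pi0 pi1] : 0 <= pi <= 1 by apply: pweight_itv.
have k1 : 1 <= k%:R :> R by rewrite (ler_nat R 1).
have p0 : 0 < k.+1%:R :> R by rewrite ltr0n.
have kE : k.+1%:R = k%:R + 1 :> R by rewrite natr1.
set ip : R := k.+1%:R^-1 in hr hp.
have ipE : ip * (k%:R + 1) = 1 by rewrite /ip -kE mulVf // gt_eqF.
have ip0 : 0 < ip by rewrite invr_gt0.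
have degle : rdeg R u <= (k%:R + pi) * (ip + h) * n.
  rewrite -(sum_dpart R f); apply: (@le_trans _ _ (\sum_i (dpart R f u i / #|part f i|%:R) * ((ip + h) * n))).
    apply: ler_sum => i _; rewrite mulrAC ler_pdivlMr ?ltr0n // mulrC.
    rewrite [leRHS]mulrC; apply: ler_pM => //; rewrite /dpart ?ler0n //.
  rewrite -big_distrl /= -mulrA; apply: ler_wpM2r.
    by rewrite mulr_ge0 ?addr_ge0 // ltW.
  by apply: sum_le_prod_ord => i; apply: dpart_ratio.
set iq : R := k%:R^-1.
have iqE : iq * k%:R = 1 by rewrite mulVf // gt_eqF //; move: k1; clear; lra.
have iq0 : 0 < iq by rewrite invr_gt0; move: k1; clear; lra.
set g := 1 + iq * pi + _.
have r0 : 0 < r.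
  apply: lt_le_trans hr; rewrite mulr_gt0 //.
  by move: ipE k1 h4 ip0; clear; nra.
rewrite -(ler_pM2l r0).
have b1 : r * x u <= ((k%:R + pi) * (ip + h) + h) * n.
  by move: hd hD degle; rewrite mulrDl; clear; lra.
apply: le_trans b1 _.
have g0 : 0 <= g.
  rewrite /g !addr_ge0 // mulr_ge0 // ?mulr_ge0 // ltW //.
  by move: p0; clear; lra.
apply: (@le_trans _ _ ((1 - ip - h) * n * g)); last by apply: ler_wpM2r.
rewrite mulrAC ler_pM2r //.
have iq1 : iq <= 1 by move: iqE k1 iq0; clear; nra.
have e1 : (1 - ip) * (1 + iq * pi) = (k%:R + pi) * ip.
  have -> : 1 - ip = ip * k%:R by move: ipE; clear; lra.
  have -> : ip * k%:R * (1 + iq * pi) = ip * k%:R + ip * (iq * k%:R) * pi by ring.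
  by rewrite iqE; ring.
have ip2 : ip <= 2^-1 by move: ipE k1 ip0; clear; nra.
have kip : k%:R * ip <= 1 by move: ipE ip0; clear; lra.
have iqp : iq * pi <= 1 by move: iq0 iq1 pi0 pi1; clear; nra.
have iqp0 : 0 <= iq * pi by rewrite mulr_ge0 // ltW.
rewrite /g kE; set z := iq * pi in e1 iqp iqp0 *.
have e2 : (1 - ip - h) * (1 + z + 4 * (k%:R + 1 + 3) * h) =
  (k%:R + pi) * ip - h * (1 + z) + (1 - ip - h) * (4 * (k%:R + 4) * h).
  by rewrite -e1; ring.
rewrite e2.
have e3 : (k%:R + 4) * h <= (1 - ip - h) * (4 * (k%:R + 4) * h).
  have w0 : 0 < (k%:R + 4) * h by rewrite mulr_gt0 //; move: k1; clear; lra.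
  rewrite -[4 * _ * h]mulrA; move: ip2 h4 w0; move: ((k%:R + 4) * h) => w; clearbody ip.
  by clear; nra.
by move: e3 iqp pi1 h0; move: ((1 - ip - h) * _) => w; clear; nra.
Qed.

(** [s] stands for the total gain in the lower bound on [r]. Inserting that bound cancels the terms
    in [n ^ 2]; what remains is linear in [n], with an error of at most [3 * e * n]. *)
Lemma gain_numeric R (a r n m xi I s K e : R) :
  0 < n -> 0 <= a <= 1 -> 0 <= s -> 0 <= m <= K -> 0 <= xi <= 16 * K ->
  r * n <= a * (n - m) * (n - xi) + I + 2 * r * xi ->
  a * n + s - e <= r -> 0 <= e ->
  32 * K <= n ->
  16 * K ^+ 2 + 32 * K * s <= e * n -> I <= e * n ->
  s <= a * (xi - m) + 3 * e.
Proof.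
move=> n0 /andP[a0 a1] s0 /andP[m0 mK] /andP[x0 xK] h hr e0 hn1 hn2 hI.
have h1 : (a * n + s - e) * (n - 2 * xi) <= r * (n - 2 * xi).
  by apply: ler_wpM2r => //; move: xK hn1; clear; lra.
have mx : a * (m * xi) <= 16 * K ^+ 2.
  have mx : m * xi <= K * (16 * K) by apply: ler_pM.
  have mx0 : 0 <= m * xi by rewrite mulr_ge0.
  by move: mx mx0 a0 a1; move: (m * xi) => w; clear; nra.
have sx : 2 * s * xi <= 32 * K * s by move: s0 xK; clear; nra.
have ex : 0 <= 2 * e * xi by rewrite !mulr_ge0.
rewrite -(ler_pM2r n0).
by move: h h1 mx sx ex hn2 hI; clear; lra.
Qed.

(** [x u ^ 2 - 1] is at most [2 q pi + q^2 pi^2] up to [5 * e1]. As the sum of [pi] is at most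
    [s + e2], the linear part is limited, and the required surplus pushes the sum of [pi ^ 2] up to
    nearly [s]. *)
Lemma gain_pi R (T : finType) (U : {set T}) (x pi : T -> R) (s q e1 e2 err : R) :
  0 < q <= 1 -> 0 <= e1 <= 1 -> 0 <= e2 ->
  (forall u, 0 <= pi u <= 1) -> (forall u, 0 <= x u) ->
  (forall u, x u <= 1 + q * pi u + e1) ->
  \sum_(u in U) pi u <= s + e2 ->
  s * (2 * q + q ^+ 2) <= \sum_(u in U) x u ^+ 2 - #|U|%:R + err ->
  q ^+ 2 * (s - \sum_(u in U) pi u ^+ 2) <= 2 * e2 + 5 * e1 * #|U|%:R + err.
Proof.
move=> /andP[q0 q1] /andP[e10 e11] e20 hp hx0 hx hs hg.
have : \sum_(u in U) x u ^+ 2 <= #|U|%:R + 2 * q * \sum_(u in U) pi u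
    + q ^+ 2 * \sum_(u in U) pi u ^+ 2 + 5 * e1 * #|U|%:R.
  have -> : #|U|%:R = \sum_(u in U) 1 :> R by rewrite sumr_const.
  rewrite !big_distrr /= -!big_split /=; apply: ler_sum => u _.
  have /andP[p0 p1] := hp u; have x1 := hx u; have x0 := hx0 u.
  have sq : x u ^+ 2 <= (1 + q * pi u + e1) ^+ 2.
    by rewrite ler_pXn2r // nnegrE // (le_trans x0).
  apply: le_trans sq _.
  have qp : q * pi u <= 1 by move: q0 q1 p0 p1; clear; nra.
  have qp0 : 0 <= q * pi u by rewrite mulr_ge0 // ltW.
  have -> : 1 + 2 * q * pi u + q ^+ 2 * pi u ^+ 2 = 1 + 2 * (q * pi u) + (q * pi u) ^+ 2 by ring.
  by rewrite mulr1; move: qp qp0 e10 e11; move: (q * pi u) => w; clear; nra.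
have : 2 * q * \sum_(u in U) pi u <= 2 * q * (s + e2).
  by rewrite ler_wpM2l // mulr_ge0 // ltW.
have : q * e2 <= e2 by rewrite ler_piMl.
move: hg; move: (\sum_(u in U) x u ^+ 2) (\sum_(u in U) pi u) (\sum_(u in U) pi u ^+ 2).
by move=> w1 w2 w3; clear; lra.
Qed.

Lemma near_mono R G k (U : {set G}) (f : G -> 'I_k.+1) (t t' : R) :
  t <= t' -> near U f t -> near U f t'.
Proof.
move=> tt [h1 h2 h3]; have tn : t * #|G|%:R <= t' * #|G|%:R by rewrite ler_wpM2r.
by split=> [i|v vU|v vU]; apply: le_trans tn; [apply: h1 | apply: h2 | apply: h3].
Qed.

Lemma sqr_le_norm R (y h e n : R) :
  0 <= h -> 0 <= n -> 4 * e <= h ^+ 2 -> y ^+ 2 <= 4 * e * n ^+ 2 -> `|y| <= h * n.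
Proof.
move=> h0 n0 he hy; rewrite -(@ler_pXn2r _ 2) ?nnegrE ?mulr_ge0 //.
rewrite real_normK ?num_real // exprMn; apply: le_trans hy _.
by rewrite ler_wpM2r // exprn_ge0.
Qed.

Definition rough R G k (f : G -> 'I_k.+1) (x : G -> R) (h : R) :=
  [/\ \sum_v `|x v - 1| <= h * #|G|%:R,
      forall i, `|#|part f i|%:R - #|G|%:R / k.+1%:R| <= h * #|G|%:R,
      #|[set u | h * #|G|%:R < #|mis f u|%:R]|%:R <= h * #|G|%:R &
      forall v : G, (1 - k.+1%:R^-1 - 5 * h) * #|G|%:R <= rdeg R v].

Lemma free_no_partite H k c m : family_data H k c m ->
  forall G, graph_free H G -> ~ has_complete_partite G k.+2 (c + family_gamma H).
Proof.
move=> fd G fr; apply: (no_complete_partite (fd_card fd) (fd_p fd) (fd_k fd) (fd_gamma fd) fr).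
  exact: leq_addr.
exact: leq_addl.
Qed.

Lemma SPEX_rough R H k c m (h : R) :
  family_data H k c m -> 0 < h ->
  (exists N, forall n, (N <= n)%N -> forall G, SPEX R n H G ->
     (1 - k.+1%:R^-1) * n%:R - 1 <= spectral_radius R G) ->
  exists N, forall n, (N <= n)%N -> forall G (x : G -> R), SPEX R n H G ->
    perron x (spectral_radius R G) -> exists f : G -> 'I_k.+1, rough f x h.
Proof.
move=> fd h0 [N1 hN1].
have ip0 : 0 < k.+1%:R^-1 :> R by rewrite invr_gt0.
have c10 : 0 < c%:R + 1 :> R by rewrite ltr_wpDl.
have [g [g0 gh gc _ _]] := exists_pos_le4 h0 (divr_gt0 ip0 (mulr_gt0 (ltr0n R 4) c10)) h0 h0.
rewrite ler_pdivlMr in gc; last by rewrite mulr_gt0.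
(* [partition_counts] bounds squares by [4 * e * n^2]; the choice [4 * e <= g^2] turns this into
   deviations of at most [g n]. *)
pose e := Num.min (g ^+ 2 / 4) g.
have e0 : 0 < e by rewrite lt_min g0 divr_gt0 // exprn_gt0.
have eg : e <= g by rewrite ge_min lexx orbT.
have e4 : 4 * e <= g ^+ 2.
  have : e <= g ^+ 2 / 4 by rewrite ge_min lexx.
  by clear; lra.
have t0 : (0 < c + family_gamma H)%N by rewrite addn_gt0 (fd_c fd).
have [N2 hN2] := spectral_stability 1 (fd_k fd) t0 e0.
have [N3 hN3] := exists_nat_ge (1 / e).
have [N4 hN4] := exists_nat_ge (4 * (c%:R + 1) / k.+1%:R^-1 : R).
exists (maxn 1 (maxn N1 (maxn N2 (maxn N3 N4)))) => n.
rewrite !geq_max => /and5P[n1 nN1 nN2 nN3 nN4] G x sp px.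
have [Gn fr _] := sp.
have hr := hN1 n nN1 G sp.
rewrite -Gn in n1 nN2 nN3 nN4 hr; set r := spectral_radius R G in px hr.
have [hD _ [f hI]] := hN2 G x r nN2 (free_no_partite fd fr) px hr.
have n0 : 0 < #|G|%:R :> R by rewrite ltr0n.
have en : 1 <= e * #|G|%:R by have := hN3 _ nN3; rewrite ler_pdivrMr // mulrC.
have cn : 4 * (c%:R + 1) <= k.+1%:R^-1 * #|G|%:R :> R.
  by rewrite [leRHS]mulrC -ler_pdivrMr //; apply: hN4.
have ip2 : k.+1%:R^-1 <= 2^-1 :> R by rewrite lef_pV2 ?posrE ?ltr0n // (ler_nat R 2) ltnS (fd_k fd).
have hI' : \sum_u #|inn f u|%:R <= e * #|G|%:R ^+ 2.
  apply: le_trans hI; rewrite le_eqVlt; apply/orP; left; apply/eqP.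
  by apply: eq_bigr => u _; rewrite sumr_const /inn cardsE.
set n' : R := #|G|%:R in hr hD hI' n0 en cn *.
have hr' : (1 - k.+1%:R^-1 - e) * n' <= r.
  by move: hr en; move: (k.+1%:R^-1 : R) => ip; clear; lra.
have [hm hp] := partition_counts px n1 hr' hD hI'; rewrite -/n' in hm hp.
have hp' i : `|#|part f i|%:R - n' / k.+1%:R| <= g * n'.
  by apply: sqr_le_norm (hp i) => //; apply: ltW.
have gn : 0 < g * n' by rewrite mulr_gt0.
have hT : #|[set u | g * n' < #|mis f u|%:R]|%:R <= g * n'.
  have := markov_card (fun u => #|mis f u|) gn => h1.
  rewrite -(ler_pM2r gn); apply: le_trans h1 _; apply: le_trans hm _.
  have -> : g * n' * (g * n') = g ^+ 2 * n' ^+ 2 by ring.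
  by rewrite ler_pM2r // exprn_gt0.
have hD' : \sum_v `|x v - 1| <= g * n' by apply: le_trans hD _; rewrite ler_pM2r.
have r0 : 0 < r.
  apply: lt_le_trans hr; have : k.+1%:R^-1 * n' <= 2^-1 * n' by rewrite ler_pM2r.
  by move: cn (ler0n R c); move: (k.+1%:R^-1 : R) (c%:R : R) => ip c'; clear; lra.
have hp0 := hp' ord0.
have hdeg : forall v : G, (1 - k.+1%:R^-1 - 5 * g) * n' <= rdeg R v.
  move=> v; have h1 : (1 - k.+1%:R^-1 - 4 * g) * n' <= r * x v.
    apply: (min_degree (f := f) (fd_card fd) sp px r0 g0) => //.
    - by apply: le_trans en _; rewrite ler_pM2r.
    - move: hp0; rewrite ler_norml -/n' => /andP[_].
      by move: (k.+1%:R^-1 : R) => ip; clear; lra.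
    - have gcn : g * (4 * (c%:R + 1)) * n' <= k.+1%:R^-1 * n' by rewrite ler_pM2r.
      move: hp0; rewrite ler_norml -/n' => /andP[+ _]; move: gcn cn (ler0n R c).
      by move: (k.+1%:R^-1 : R) (c%:R : R) => ip c'; clear; lra.
  have := degree_close v px; rewrite ler_norml => /andP[_].
  by move: hD' h1; move: (\sum_v _) (k.+1%:R^-1 : R) => D ip; clear; lra.
have ghn : g * n' <= h * n' by rewrite ler_pM2r.
exists f; split=> //.
- exact: le_trans hD' ghn.
- by move=> i; apply: le_trans (hp' i) ghn.
- apply: (le_trans _ ghn); apply: (le_trans _ hT); rewrite ler_nat; apply: subset_leq_card.
  by apply/subsetP => u; rewrite !inE; exact: le_lt_trans ghn.
- move=> v; apply: le_trans (hdeg v); rewrite ler_pM2r //.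
  by move: gh; move: (k.+1%:R^-1 : R) => ip; clear; lra.
Qed.

Lemma pweight_gt R G k (f : G -> 'I_k.+1) (u : G) (t : R) :
  (0 < #|G|)%N -> 0 < t -> (forall i, (0 < #|part f i|)%N) ->
  (forall i, t * #|G|%:R < dpart R f u i) -> t ^+ k.+1 < pweight R f u.
Proof.
move=> G0 t0 pp h; rewrite /pweight -[X in _ ^+ X]card_ord -prodr_const.
have hi i : t < dpart R f u i / #|part f i|%:R.
  rewrite ltr_pdivlMr ?ltr0n //; apply: le_lt_trans (h i).
  by rewrite ler_pM2l // ler_nat max_card.
rewrite (bigD1 ord0) //= [ltRHS](bigD1 ord0) //=.
apply: (@le_lt_trans _ _ (t * \prod_(i < k.+1 | i != ord0) (dpart R f u i / #|part f i|%:R))).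
  rewrite ler_pM2l //; apply: ler_prod => i _; apply/andP; split; apply: ltW => //.
rewrite ltr_pM2r //; apply: prodr_gt0 => i _; exact: lt_trans (hi i).
Qed.

Lemma rough_near R G k (f : G -> 'I_k.+1) (x : G -> R)
    (U : {set G}) (t h : R) :
  (0 < #|G|)%N -> 0 < h -> 20 * h <= t -> t + 10 * h < k.+1%:R^-1 ->
  rough f x h -> #|U|%:R <= h * #|G|%:R ->
  (forall v, v \notin U -> exists i, dpart R f v i <= t * #|G|%:R) ->
  exists f' : G -> 'I_k.+1, near U f' (2 * t).
Proof.
move=> G0 h0 ht tp [_ hn hT hdeg] hU hv.
pose f' v := if [pick i | dpart R f v i <= t * #|G|%:R] is Some i then i else ord0.
have h5 : h * #|G|%:R <= 5 * h * #|G|%:R by rewrite ler_wpM2r //; move: h0; clear; lra.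
exists f'; apply: (@near_of_partition _ _ _ f _ _ t (5 * h)) => //.
- by rewrite mulr_gt0.
- by move: ht; clear; lra.
- by move: tp; move: (k.+1%:R^-1 : R) => ip; clear; lra.
- by move=> i; apply: le_trans (hn i) h5.
- apply: (le_trans _ h5); apply: (le_trans _ hT); rewrite ler_nat; apply: subset_leq_card.
  by apply/subsetP => u; rewrite !inE; exact: le_lt_trans.
- exact: le_trans hU h5.
- move=> v /hv[i hi]; rewrite /f'; case: pickP => // /(_ i).
  by rewrite hi.
Qed.

(** Two exceptional sets appear. [U] collects the vertices with a positive proportion of neighbours
    in every part; its size is bounded, and off [U] the inner edges carry only weight [O(t1 n)]. The
    balance of gains then selects [W] inside [U]. *)
Lemma SPEX_near R H k c m (th : R) :
  family_data H k c m -> 0 < th ->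
  let a : R := 1 - k.+1%:R^-1 in let s := (family_gamma H).-1 in
  (forall e : R, 0 < e -> exists N, forall n, (N <= n)%N -> forall G, SPEX R n H G ->
     a * n%:R + s%:R * (a^-1 - a) - e <= spectral_radius R G) ->
  exists N, forall n, (N <= n)%N -> forall (G : sgraph) (x : G -> R), SPEX R n H G ->
    perron x (spectral_radius R G) -> exists (W : {set G}) (f : G -> 'I_k.+1),
    [/\ #|W| = s, near W f th & forall w, w \in W -> (1 - th) * n%:R <= rdeg R w].
Proof.
move=> fd th0; set ip : R := k.+1%:R^-1; set a : R := 1 - ip; set s := _.-1 => /= LB.
have gs : family_gamma H = s.+1 by rewrite prednK // (fd_gamma fd).
have k1 : 1 <= k%:R :> R by rewrite (ler_nat R 1) (fd_k fd).
have kE : k.+1%:R = k%:R + 1 :> R by rewrite natr1.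
have ipE : ip * (k%:R + 1) = 1 by rewrite /ip -kE mulVf // pnatr_eq0.
have ip0 : 0 < ip by rewrite invr_gt0 ltr0n.
have ip2 : ip <= 2^-1 by move: ipE k1 ip0; clear; clearbody ip; nra.
pose q : R := k%:R^-1.
have q0 : 0 < q by rewrite invr_gt0; move: k1; clear; lra.
have qE : q * k%:R = 1 by rewrite mulVf // gt_eqF //; move: k1; clear; lra.
have q1 : q <= 1 by move: qE k1 q0; clearbody q; clear; nra.
have aE : a = k%:R * ip by rewrite /a; move: ipE; clearbody ip; clear; lra.
have a0 : 0 < a by rewrite aE mulr_gt0 //; move: k1; clear; lra.
have a1 : a <= 1 by rewrite /a; move: ip0; clearbody ip; clear; lra.
have a2 : 2^-1 <= a by rewrite /a; move: ip2; clearbody ip; clear; lra.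
have aq : a * (1 + q) = 1.
  have -> : a * (1 + q) = ip * (k%:R + q * k%:R) by rewrite aE; ring.
  by rewrite qE.
have ainv : a^-1 = 1 + q.
  by apply: (mulfI (_ : a != 0)); rewrite ?gt_eqF // mulfV ?gt_eqF // aq.
(* A fully joined vertex has weight [a^-1 = 1 + q], so [2 * q + q ^+ 2] is its surplus of [x^2] over
   1; the lower bound on [r] asks for [s] such surpluses. *)
have kap : a^-1 - a = a * (2 * q + q ^+ 2).
  rewrite ainv; have -> : a * (2 * q + q ^+ 2) = a * (1 + q) * (1 + q) - a by ring.
  by rewrite aq mul1r.
have ipD : k.+1%:R^-1 = ip by [].
clearbody ip.
(* Order of choice: [t2] and [de] for the final set [W], then [t1] for the larger set [U], [K]
   bounding [#|U|], [d] small against [K], and [h] last. *)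
have [t2 [t20 t2a t2b _ _]] := exists_pos_le4 (divr_gt0 th0 (ltr0n R 2)) (divr_gt0 ip0 (ltr0n R 8)) th0 th0.
have [de [de0 dea deb dec _]] := exists_pos_le4
  (divr_gt0 (exprn_gt0 k.+1 t20) (ltr0n R 4))
  (divr_gt0 (ltr0n R 1) (mulr_gt0 (ltr0n R 10) (ltr0Sn R s)))
  (divr_gt0 th0 (ltr0n R 8)) th0.
pose D : R := q ^+ 2 * de.
have D0 : 0 < D by rewrite mulr_gt0 // exprn_gt0.
pose cc : R := 2 * m%:R + c%:R + k.+1%:R * c%:R + 1.
have cc0 : 0 < cc by rewrite /cc ltr_wpDl // !addr_ge0 // mulr_ge0.
pose pm : R := 128 * k.+1%:R * m%:R + 1.
have pm0 : 0 < pm by rewrite /pm ltr_wpDl // !mulr_ge0.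
have [t1 [t10 t1a t1b t1c _]] := exists_pos_le4 t20
  (divr_gt0 ip0 (mulr_gt0 (ltr0n R 8) cc0))
  (divr_gt0 D0 (mulr_gt0 (ltr0n R 32) pm0)) th0.
have [K hK] : exists K : nat, s%:R + 1 < K%:R * t1 ^+ k.+1.
  have [K hK] := exists_nat_ge ((s%:R + 2) / t1 ^+ k.+1).
  exists K; have := hK K (leqnn _); rewrite ler_pdivrMr ?exprn_gt0 //.
  by apply: lt_le_trans; rewrite ltrD2l (ltr_nat R 1 2).
have K0 : 0 < K%:R :> R.
  rewrite ltr0n lt0n; apply: contraTneq hK => ->; rewrite mul0r -leNgt.
  by rewrite addr_ge0.
pose KK : R := K%:R * 2 ^+ K.
have KK0 : 0 < KK by rewrite mulr_gt0 // exprn_gt0.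
pose b : R := ip / 2.
have b0 : 0 < b by rewrite divr_gt0.
have bp : 0 < b ^+ k.+1 by rewrite exprn_gt0.
have [d [d0 da db _ _]] := exists_pos_le4 (divr_gt0 (ltr0n R 1) KK0)
  (divr_gt0 (mulr_gt0 D0 bp) (mulr_gt0 (ltr0n R 8) KK0)) th0 th0.
rewrite ler_pdivlMr // in da; rewrite ler_pdivlMr in db; last exact: mulr_gt0.
pose cj : R := s.+1%:R + c%:R + k.+1%:R * c%:R + 1.
have cj0 : 0 < cj by rewrite /cj ltr_wpDl // !addr_ge0 // mulr_ge0.
pose k3 : R := 4 * (k.+1%:R + 3).
have k30 : 0 < k3 by rewrite /k3 mulr_gt0 // ltr_wpDl.
have [h1 [h10 h1a h1b h1c h1d]] := exists_pos_le4 (divr_gt0 t10 (ltr0n R 20))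
  (divr_gt0 d0 (mulr_gt0 (ltr0n R 2) cj0))
  (divr_gt0 D0 (mulr_gt0 (ltr0n R 20) (mulr_gt0 k30 K0)))
  (divr_gt0 (ltr0n R 1) k30).
have [h [h0 ha hb _ _]] := exists_pos_le4 h10 (divr_gt0 ip0 (ltr0n R 32)) th0 th0.
pose S : R := s%:R * (a^-1 - a).
have S0 : 0 <= S.
  rewrite /S kap; apply: mulr_ge0 => //; apply: mulr_ge0; first exact: ltW.
  by apply: addr_ge0; [apply: mulr_ge0 => //; exact: ltW | apply: exprn_ge0; exact: ltW].
have LB1 : exists N, forall n, (N <= n)%N -> forall G, SPEX R n H G ->
    (1 - k.+1%:R^-1) * n%:R - 1 <= spectral_radius R G.
  have [N hN] := LB 1 ltr01; exists N => n nN G sp; apply: le_trans (hN n nN G sp).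
  rewrite ipD -/a.
  by rewrite lerD2r lerDl.
pose e : R := D / 32.
have e0 : 0 < e by rewrite divr_gt0.
have [N1 hN1] := SPEX_rough fd h0 LB1.
have [N2 hN2] := LB e e0.
have [N3 hN3] := exists_nat_ge (K%:R / h).
have [N4 hN4] := exists_nat_ge (2 * (c%:R + 2 * m%:R) / ip).
have [N5 hN5] := exists_nat_ge (2 * c%:R / d).
have [N6 hN6] := exists_nat_ge ((16 * K%:R ^+ 2 + 32 * K%:R * S) / e).
have [N7 hN7] := exists_nat_ge (32 * K%:R : R).
have [N8 hN8] := exists_nat_ge (e / h).
exists (maxn 1 (maxn (maxn N1 N2) (maxn (maxn N3 N4) (maxn (maxn N5 N6) (maxn N7 N8))))) => n.
rewrite !geq_max -!andbA => /and5P[n1 nN1 nN2 nN3 /and5P[nN4 nN5 nN6 nN7 nN8]] G x sp px.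
have [Gn fr _] := sp; have [f rf] := hN1 n nN1 G x sp px; have [hD hp hT hdeg] := rf.
have hr := hN2 n nN2 G sp; rewrite -/S in hr.
set r := spectral_radius R G in px hr.
have G0 : (0 < #|G|)%N by rewrite Gn.
rewrite -Gn in hr *; set n' : R := #|G|%:R in hr hD hp hT hdeg *.
have n0 : 0 < n' by rewrite ltr0n.
have Kn : K%:R <= h * n'.
  by have := hN3 _ nN3; rewrite ler_pdivrMr // -Gn mulrC.
have cmn : 2 * (c%:R + 2 * m%:R) <= ip * n'.
  by rewrite [leRHS]mulrC -ler_pdivrMr // /n' Gn; apply: hN4.
have cdn : 2 * c%:R <= d * n'.
  by rewrite [leRHS]mulrC -ler_pdivrMr // /n' Gn; apply: hN5.
have eKn : 16 * K%:R ^+ 2 + 32 * K%:R * S <= e * n'.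
  by rewrite [leRHS]mulrC -ler_pdivrMr // /n' Gn; apply: hN6.
have K32 : 32 * K%:R <= n' by rewrite /n' Gn; apply: hN7.
have ehn : e <= h * n'.
  by rewrite [leRHS]mulrC -ler_pdivrMr // /n' Gn; apply: hN8.
have hr' : (1 - ip - h) * n' <= r.
  move: hr ehn S0; rewrite -/a; move: (S) (e) (a) => S' e' a'.
  by clear; lra.
have hpb i : b * n' <= #|part f i|%:R.
  have := hp i; rewrite ler_norml => /andP[+ _]; rewrite ipD.
  have : 32 * h * n' <= ip * n' by rewrite ler_pM2r //; move: hb; clear; lra.
  have : 0 < ip * n' by rewrite mulr_gt0.
  by rewrite /b; clear; lra.
have hpu i : #|part f i|%:R <= (ip + h) * n'.
  by have := hp i; rewrite ler_norml => /andP[_]; rewrite ipD; clear; lra.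
have pp i : (0 < #|part f i|)%N.
  by rewrite -(ltr_nat R); apply: lt_le_trans (hpb i); rewrite mulr_gt0.
have hJ (J : {set G}) : #|J| = s.+1 -> exists i, #|part f i :&: cnbr J|%:R <= d * n'.
  move=> Js; apply: (common_small (t := h) (fd_card fd) (fd_p fd) (fd_k fd) (fd_gamma fd) fr).
  - exact: ltW.
  - by rewrite Js gs.
  - exact: hT.
  rewrite Js -/cj -/n'.
  have : h * (2 * cj) * n' <= d * n'.
    rewrite ler_pM2r // -ler_pdivlMr ?mulr_gt0 //; exact: le_trans ha h1b.
  by move: cdn; move: (cj) => cj'; clear; lra.
pose U := [set v | [forall i, (t1 * n' <= dpart R f v i)%R]].
have UK : (#|U| < K)%N.
  by apply: (rich_bound G0 t10 (ltW d0) hJ hK); rewrite mulrC -/KK.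
have Ule : #|U|%:R <= K%:R :> R by rewrite ler_nat ltnW.
have [fU nU] : exists fU : G -> 'I_k.+1, near U fU (2 * t1).
  apply: (rough_near G0 h0 _ _ rf) => //.
  - by have := le_trans ha h1a; clear; lra.
  - have := le_trans ha h1a; move: t1a t2b ip0; rewrite ipD; clear; lra.
  - exact: le_trans Ule Kn.
  - move=> v; rewrite inE => vU; apply: contrapT => nex; case/negP: vU.
    apply/forallP => i; rewrite leNgt; apply/negP => /ltW hi.
    by apply: nex; exists i.
have x4 v : 0 <= x v <= 4.
  have [x0 _ xe] := px; rewrite x0 /=.
  have [_ Yn _] := perron_facts px.
  have := nb_le_sum v x0; rewrite xe => h2; have h3 := le_trans h2 Yn; rewrite -/n' in h3.
  have rq : n' / 4 <= r.
    apply: le_trans hr'; have : 32 * h * n' <= ip * n' by rewrite ler_pM2r //; move: hb; clear; lra.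
    have : ip * n' <= 2^-1 * n' by rewrite ler_pM2r.
    by move: n0; clear; lra.
  have : n' / 4 * x v <= n' by apply: le_trans h3; apply: ler_wpM2r.
  by move: n0; move: (x v) => w; clear; nra.
have cov := near_cover (fd_card fd) (fd_p fd) (fd_k fd) (fd_matching fd) (fd_c fd) fr
  (mulr_ge0 (ler0n R 2) (ltW t10)) nU.
have covh : cc * (2 * t1 * n') + c%:R + 2 * m%:R <= n' / k.+1%:R.
  rewrite ipD; have : t1 * (8 * cc) * n' <= ip * n'.
    by rewrite ler_pM2r // -ler_pdivlMr // mulr_gt0.
  have : 0 < ip * n' by rewrite mulr_gt0.
  by move: cmn (ler0n R m) (ler0n R c); move: (cc) => cc'; clear; lra.
have I_le := inner_sum_le (mulr_ge0 (ler0n R 2) (ltW t10)) nU x4 (cov covh).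
have := spectral_gain px (fd_k fd) I_le; rewrite ipD -/a -/n'.
set xi := \sum_(u in U) x u ^+ 2; set I := 64 * _ * _ * _ => gain.
have xi0 : 0 <= xi <= 16 * K%:R.
  apply/andP; split; first by apply: sumr_ge0 => u _; apply: sqr_ge0.
  apply: (@le_trans _ _ (\sum_(u in U) 16)).
    apply: ler_sum => u _; have /andP[w0 w4] := x4 u.
    by move: (x u) w0 w4 => w; clear; nra.
  by rewrite sumr_const -[_ *+ #|_|]mulr_natl mulrC ler_pM2l.
have Ie : I <= e * n'.
  have : t1 * (32 * pm) * n' <= D * n'.
    by rewrite ler_pM2r // -ler_pdivlMr // mulr_gt0.
  have : 0 < t1 * n' by rewrite mulr_gt0.
  rewrite /I /e /pm -/n'; move: (D) (k.+1%:R : R) (m%:R : R) => D' p' m'.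
  by clear; lra.
have U0K : 0 <= (#|U|%:R : R) <= K%:R by rewrite ler0n Ule.
have a01 : 0 <= a <= 1 by rewrite ltW.
have hg := gain_numeric n0 a01 S0 U0K xi0 gain hr (ltW e0) K32 eKn Ie.
have hg' : s%:R * (2 * q + q ^+ 2) <= xi - #|U|%:R + 6 * e.
  rewrite -(ler_pM2l a0); move: hg; rewrite /S kap => hg.
  have ae : e <= 2 * (a * e).
    have : 2^-1 * e <= a * e by rewrite ler_pM2r.
    by move: (a * e) (e) => w1 w2; clear; lra.
  by move: hg ae; move: (a) (e) (xi) => a' e' xi'; clear; lra.
have part0 : forall i, b * n' <= #|part f i|%:R by [].
have hs : \sum_(u in U) pweight R f u <= s%:R + D / 8.
  apply: le_trans (pweight_sum G0 (ltW d0) b0 hJ part0 (ltnW UK)) _.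
  rewrite lerD2l -/KK ler_pdivrMr // [KK * d]mulrC.
  by move: db; move: (D) (KK) (b ^+ _) => D' KK' b'; clear; lra.
have h4 : h <= 4^-1 by move: hb ip2; clear; lra.
have k3h : 0 <= k3 * h <= 1.
  apply/andP; split; first by rewrite mulr_ge0 // ltW.
  by rewrite mulrC -ler_pdivlMr //; exact: le_trans ha h1d.
have hx u : x u <= 1 + q * pweight R f u + k3 * h.
  apply: (perron_upper u px (fd_k fd) h0 h4 _ hD _ G0 pp).
    by rewrite ipD.
  by move=> i; rewrite ipD.
have q01 : 0 < q <= 1 by rewrite q0.
have D80 : 0 <= D / 8 by rewrite divr_ge0 // ltW.
have x0 u : 0 <= x u by case/andP: (x4 u).
have := gain_pi q01 k3h D80 (@pweight_itv R G k f) x0 hx hs hg'.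
set P2 := \sum_(u in U) _ => hP2.
have sP2 : s%:R - de <= P2.
  have hh : h * (20 * (k3 * K%:R)) <= D.
    have p0 : 0 < 20 * (k3 * K%:R) by rewrite mulr_gt0 // mulr_gt0.
    by rewrite -ler_pdivlMr //; exact: le_trans ha h1c.
  have kU : 5 * (k3 * h) * #|U|%:R <= 5 * (k3 * h) * K%:R.
    by apply: ler_wpM2l => //; apply: mulr_ge0 => //; case/andP: k3h.
  have q2 : 0 < q ^+ 2 by rewrite exprn_gt0.
  suff : q ^+ 2 * (s%:R - P2) <= q ^+ 2 * de by rewrite ler_pM2l //; move: (P2) => w; clear; lra.
  apply: le_trans hP2 _; rewrite -/D; move: hh kU D0; rewrite /e.
  by move: (D) (k3) (K%:R : R) (#|U|%:R : R) => D' k3' K' U'; clear; lra.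
have Dde : D / 8 <= de.
  have : q ^+ 2 * de <= 1 * de by rewrite ler_pM2r // exprn_ile1 // ltW.
  by rewrite -/D; move: (D) D0 de0 => D'; clear; lra.
have hs' : \sum_(u in U) pweight R f u <= s%:R + de by apply: le_trans hs _; rewrite lerD2l.
have des : de * (5 * (s%:R + 1)) < 1.
  have : de * (10 * s.+1%:R) <= 1 by rewrite -ler_pdivlMr ?mulr_gt0 ?ltr0n.
  by rewrite -[s.+1%:R]natr1; move: (ler0n R s) de0; move: (s%:R : R) => s'; clear; lra.
have [W [WU Ws Wbig Wsml]] := weights_dichotomy (@pweight_itv R G k f) hs' sP2 de0 des.
(* A vertex of [U] outside [W] has [pweight] at most [4 * de <= t2 ^+ k.+1], so it has at most
   [t2 n] neighbours in some part. *)
have [fW nW] : exists fW : G -> 'I_k.+1, near W fW (2 * t2).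
  apply: (rough_near G0 h0 _ _ rf) => //.
  - by have := le_trans ha h1a; move: t1a; clear; lra.
  - have := le_trans ha h1a; move: t1a t2b ip0; rewrite ipD; clear; lra.
  - apply: le_trans Kn; apply: le_trans Ule; rewrite ler_nat; exact: subset_leq_card.
  - move=> v vW; apply: contrapT => nex.
    have hgt i : t2 * n' < dpart R f v i.
      by rewrite ltNge; apply/negP => h'; apply: nex; exists i.
    have vU : v \in U.
      rewrite inE; apply/forallP => i; apply: ltW; apply: le_lt_trans (hgt i).
      by rewrite ler_pM2r.
    have := pweight_gt G0 t20 pp hgt; have := Wsml v vU vW.
    by move: dea; move: (t2 ^+ k.+1) (pweight R f v) => w1 w2; clear; lra.
exists W, fW; split=> //.
  by apply: near_mono nW; move: t2a; clear; lra.
move=> w wW; have hw := Wbig w wW.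
(* A product of ratios in the unit interval that is at least [1 - 4 * de] has every factor at least
   that large, so [w] sees almost all of each part. *)
rewrite -(sum_dpart R f) /n' -(card_part_sum R f) big_distrr /=; apply: ler_sum => i _.
have := le_trans hw (pweight_le R f w i); rewrite ler_pdivlMr ?ltr0n //.
apply: le_trans; rewrite ler_pM2r ?ltr0n //.
by move: dec th0; clear; lra.
Qed.

(** * Exact structure of spectral extremal graphs *)

Definition near_full R G k (W : {set G}) (f : G -> 'I_k.+1) (t : R) :=
  near W f t /\ forall w, w \in W -> (1 - t) * #|G|%:R <= rdeg R w.

Lemma near_cls R G k (W : {set G}) (f : G -> 'I_k.+1) (t : R) i :
  near W f t -> #|G|%:R / k.+1%:R - t * #|G|%:R <= #|cls W f i|%:R.
Proof.
case=> /(_ i) + _ _; rewrite ler_norml => /andP[+ _].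
by move: (_ / _) => w; clear; lra.
Qed.

Lemma near_nonadj R G k (W : {set G}) (f : G -> 'I_k.+1) (t : R) q j :
  near_full W f t -> (q \in W) || (f q != j) ->
  #|nonadj (cls W f j) q|%:R <= t * #|G|%:R.
Proof.
case=> [[_ _ hmis] hdeg]; have [qW _|qW /= fq] := boolP (q \in W).
  have h : (#|[set v | adj q v]| + #|nonadj (cls W f j) q| <= #|G|)%N.
    rewrite -cardsUI (_ : _ :&: _ = set0) ?cards0 ?addn0 ?max_card //.
    by apply/setP => v; rewrite !inE; case: (adj q v); rewrite ?andbF.
  have := hdeg q qW; move: h; rewrite -(ler_nat R) natrD -/(rdeg R q).
  by move: (rdeg R q) => w; clear; lra.
apply: le_trans (hmis q qW); rewrite ler_nat; apply: subset_leq_card.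
apply/subsetP => v; rewrite !inE => /andP[/andP[-> /eqP ->] ->] /=.
by rewrite eq_sym.
Qed.

(** Supplies the condition for rewiring: the common neighbours of [Q] are found in a class [j] that
    every vertex of [Q] sees almost completely. *)
Lemma near_common R G k (W : {set G}) (f : G -> 'I_k.+1) (t : R) c
    (Q : {set G}) j :
  0 <= t -> near_full W f t -> (#|Q| <= c)%N ->
  (forall q, q \in Q -> (q \in W) || (f q != j)) ->
  c.+1%:R * (t * #|G|%:R) + c%:R < #|G|%:R / k.+1%:R ->
  (c < #|cnbr Q|)%N.
Proof.
move=> t0 nW Qc hQ hc; have tn0 : 0 <= t * #|G|%:R by rewrite mulr_ge0.
have h := card_cnbr_real tn0 (fun q qQ => near_nonadj (j := j) nW (hQ q qQ)).
have h2 := near_cls j (proj1 nW).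
have Qc' : #|Q|%:R * (t * #|G|%:R) <= c%:R * (t * #|G|%:R) by rewrite ler_wpM2r // ler_nat.
have : c%:R < #|cls W f j :&: cnbr Q|%:R :> R.
  move: h h2 Qc' hc; rewrite -[c.+1%:R]natr1; move: (t * _) (_ / _) => w1 w2.
  by move: (c%:R : R) => c'; clear; lra.
by rewrite ltr_nat => /leq_trans -> //; apply: subset_leq_card; apply: subsetIr.
Qed.

(** The vertices of [J] see the other classes almost completely, so [c] common neighbours in class
    [i] would extend greedily to [k+1] parts joined to all of [J]. *)
Lemma near_few_common R H G m c k
    (W : {set G}) (f : G -> 'I_k.+1) (t : R) (J : {set G}) i :
  family_data H k c m -> graph_free H G -> 0 <= t -> near_full W f t ->
  ((family_gamma H)%:R + c%:R + k.+1%:R * c%:R + 1) * (t * #|G|%:R) + c%:R <=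
     #|G|%:R / k.+1%:R ->
  J \subset W :|: cls W f i -> #|J| = family_gamma H ->
  (#|cls W f i :&: cnbr J| < c)%N.
Proof.
move=> fd free t0 nW hb JW Jg; rewrite ltnNge; apply/negP => /subset_of_card[S0 /subsetP S0B S0c].
set n : R := #|G|%:R in hb.
have tn0 : 0 <= t * n by rewrite mulr_ge0.
pose M := Num.truncn (t * n).
have hM u j : (u \in W) || (f u != j) -> (#|nonadj (cls W f j) u| <= M)%N.
  by move=> hu; rewrite truncn_ge_nat //; exact: near_nonadj.
have hJ j u : j != i -> u \in J -> (#|nonadj (cls W f j) u| <= M)%N.
  move=> ji uJ; apply: hM; have := subsetP JW u uJ; rewrite !inE.
  by case/orP => [->//|/andP[_ /eqP ->]]; rewrite eq_sym ji orbT.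
have hS0 j u : j != i -> u \in S0 -> (#|nonadj (cls W f j) u| <= M)%N.
  move=> ji /S0B; rewrite inE => /andP[uc _]; apply: hM; move: uc.
  by rewrite inE => /andP[_ /eqP ->]; rewrite eq_sym ji orbT.
have hB a j u : a != i -> j != i -> a != j -> u \in cls W f a ->
    (#|nonadj (cls W f j) u| <= M)%N.
  by move=> _ _ aj; rewrite inE => /andP[_ /eqP fu]; apply: hM; rewrite fu aj orbT.
have hc j : j != i -> ((#|J| + c + k.+1 * c) * M + c <= #|cls W f j|)%N.
  move=> _; rewrite -(ler_nat R); apply: le_trans (near_cls j (proj1 nW)); rewrite Jg.
  rewrite natrD natrM (natrD _ (_ + c)) (natrD _ (family_gamma H)) natrM.
  move: hb; rewrite -/n mulrDl mul1r; pose q : R := (family_gamma H)%:R + c%:R + k.+1%:R * c%:R.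
  rewrite -/q.
  have : q * M%:R <= q * (t * n).
    apply: ler_wpM2l; first by rewrite /q !addr_ge0 // mulr_ge0.
    by rewrite truncn_le.
  by move: (n / k.+1%:R) => w1; move: (t * n) => w2; clearbody q; clear; lra.
have [S [pS SE SJ]] := greedy_partite hJ hS0 hB S0c hc.
have gJ : (family_gamma H <= #|J|)%N by rewrite Jg.
apply: (no_gamma_join (fd_card fd) (fd_p fd) (fd_k fd) (fd_gamma fd) free gJ pS) => j u v uJ.
have [->|ji] := eqVneq j i; last exact: SJ.
by rewrite SE => /S0B; rewrite inE => /andP[_ /cnbrP]; apply.
Qed.

(** A vertex with [g] neighbours in [D] is a common neighbour of some [g]-subset of [D], and there
    are at most [2 ^ #|D|] subsets. *)
Lemma few_rich G (B D : {set G}) g c :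
  (forall J : {set G}, J \subset D -> #|J| = g -> (#|B :&: cnbr J| <= c)%N) ->
  (#|[set z in B | (g <= #|[set v in D | adj z v]|)%N]| <= 2 ^ #|D| * c)%N.
Proof.
move=> h; pose P := [set J : {set G} | (J \subset D) && (#|J| == g)].
apply: (@leq_trans #|\bigcup_(J in P) (B :&: cnbr J)|).
  apply: subset_leq_card; apply/subsetP => z; rewrite inE => /andP[zB zg].
  have [J JD Jg] := subset_of_card zg.
  apply/bigcupP; exists J.
    rewrite inE Jg eqxx andbT; apply: subset_trans JD _.
    by apply/subsetP => v; rewrite inE => /andP[].
  rewrite inE zB; apply/cnbrP => q /(subsetP JD); rewrite inE => /andP[_].
  by rewrite adj_sym.
have hP : (#|P| <= 2 ^ #|D|)%N.
  rewrite -card_powerset; apply: subset_leq_card; apply/subsetP => J.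
  by rewrite !inE => /andP[].
apply: leq_trans (leq_mul hP (leqnn c)); rewrite -sum_nat_const.
apply: (@leq_trans (\sum_(J in P) #|B :&: cnbr J|)).
  elim/big_rec2: _ => [|J a A _ hA]; first by rewrite cards0.
  by apply: leq_trans (leq_card_setU _ _) _; rewrite leq_add2l.
by apply: leq_sum => J; rewrite inE => /andP[JD /eqP Jg]; exact: h.
Qed.

(* Joining [z] to everything outside its class shows that the non-neighbours of [z]
   there weigh at most as much as the neighbours of [z] inside its class. The latter
   are at most as many as the non-neighbours of [z] in [W], which weigh more each. *)
Lemma near_clean R H G n m c k
    (W : {set G}) (f : G -> 'I_k.+1) (x : G -> R) (t : R) :
  family_data H k c m -> SPEX R n H G ->
  perron x (spectral_radius R G) -> 0 < spectral_radius R G ->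
  0 <= t -> near_full W f t -> #|W| = (family_gamma H).-1 ->
  \sum_v `|x v - 1| <= t * #|G|%:R ->
  ((family_gamma H)%:R + 2 * m%:R + c%:R + k.+1%:R * c%:R + 6) * (t * #|G|%:R)
     + 2 * c%:R + 2 * m%:R + (family_gamma H)%:R < #|G|%:R / k.+1%:R ->
  exists2 X : {set G}, clean W X f &
    (#|X| <= k.+1 * (2 * m + 2 ^ ((family_gamma H).-1 + 2 * m) * c))%N.
Proof.
move=> fd sp px r0 t0 nW Ws hD hb; have [Gn free _] := sp.
set r := spectral_radius R G in px r0.
set N : R := #|G|%:R in hD hb.
set g := family_gamma H in Ws hb *.
have gs : g = #|W|.+1 by rewrite Ws prednK // (fd_gamma fd).
have tn0 : 0 <= t * N by rewrite mulr_ge0.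
have q0 : 0 <= (g%:R + 2 * m%:R + c%:R + k.+1%:R * c%:R) * (t * N).
  by rewrite mulr_ge0 // !addr_ge0 // mulr_ge0.
have nn : [/\ 0 <= g%:R * (t * N), 0 <= m%:R * (t * N), 0 <= c%:R * (t * N) & 0 <= k.+1%:R * c%:R * (t * N)].
  by split; rewrite !mulr_ge0.
have nn2 : [/\ 0 <= g%:R :> R, 0 <= m%:R :> R & 0 <= c%:R :> R] by [].
case: nn nn2 => nn1 nn2 nn3 nn4 [nn5 nn6 nn7].
have hb1 : (2 * m%:R + c%:R + k.+1%:R * c%:R + 1) * (t * N) + c%:R + 2 * m%:R <= N / k.+1%:R.
  move: hb tn0 nn1 nn2 nn3 nn4 nn5 nn6 nn7.
  move: (N / _) (t * N) (k.+1%:R * c%:R : R) => w1 w2 w3.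
  by move: (g%:R : R) (m%:R : R) (c%:R : R) => g' m' c'; clear; lra.
have hb2 : (g%:R + c%:R + k.+1%:R * c%:R + 1) * (t * N) + c%:R <= N / k.+1%:R.
  move: hb tn0 nn1 nn2 nn3 nn4 nn5 nn6 nn7.
  move: (N / _) (t * N) (k.+1%:R * c%:R : R) => w1 w2 w3.
  by move: (g%:R : R) (m%:R : R) (c%:R : R) => g' m' c'; clear; lra.
have hb3 : c.+1%:R * (t * N) + c%:R < N / k.+1%:R.
  rewrite -[c.+1%:R]natr1.
  move: hb tn0 nn1 nn2 nn3 nn4 nn5 nn6 nn7.
  move: (N / _) (t * N) (k.+1%:R * c%:R : R) => w1 w2 w3.
  by move: (g%:R : R) (m%:R : R) (c%:R : R) => g' m' c'; clear; lra.
have hb4 : 6 * (t * N) + g%:R < N / k.+1%:R.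
  move: hb tn0 nn1 nn2 nn3 nn4 nn5 nn6 nn7.
  move: (N / _) (t * N) (k.+1%:R * c%:R : R) => w1 w2 w3.
  by move: (g%:R : R) (m%:R : R) (c%:R : R) => g' m' c'; clear; lra.
have cov := near_cover (fd_card fd) (fd_p fd) (fd_k fd) (fd_matching fd) (fd_c fd) free
  t0 (proj1 nW) hb1.
pose C i : {set G} := projT1 (cid2 (cov i)).
have Ccls i : C i \subset cls W f i by rewrite /C; case: cid2 => Z /= /andP[].
have Cm i : (#|C i| <= 2 * m)%N by rewrite /C; case: cid2 => Z /= /andP[].
have CP i u v : u \in cls W f i -> v \in cls W f i -> adj u v -> (u \in C i) || (v \in C i).
  by rewrite /C; case: cid2 => Z /= _; apply.
(* A vertex of class [i] outside [C i] has its inner neighbours in [C i]. If it is also outside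
   [Z i], it has at most [gamma - 1 = #|W|] neighbours in [W :|: C i], so its inner neighbours are
   no more than its non-neighbours in [W]. *)
pose Z i := [set z in cls W f i | (g <= #|[set v in W :|: C i | adj z v]|)%N].
have WC0 i : [disjoint W & C i].
  apply/pred0P => v /=; apply/negbTE/negP => /andP[vW /(subsetP (Ccls i))].
  by rewrite inE vW.
have Zc i : (#|Z i| <= 2 ^ ((#|W|) + 2 * m) * c)%N.
  apply: leq_trans (few_rich (c := c) _) _.
    move=> J JD Jg; apply: ltnW.
    apply: (near_few_common fd free t0 nW hb2 _ Jg).
    by apply: subset_trans JD _; rewrite setUS.
  rewrite leq_mul2r leq_exp2l // ; apply/orP; right.
  by apply: leq_trans (leq_card_setU _ _) _; rewrite leq_add2l.
pose X := \bigcup_i (C i :|: Z i).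
have XW : [disjoint W & X].
  apply/pred0P => v /=; apply/negbTE/negP => /andP[vW /bigcupP[i _]].
  case/setUP => [/(subsetP (Ccls i))|]; first by rewrite inE vW.
  by rewrite !inE vW.
exists X; last first.
  rewrite -Ws; apply: (@leq_trans (\sum_(i < k.+1) #|C i :|: Z i|)).
    rewrite /X; elim/big_rec2: _ => [|j a A _ hA]; first by rewrite cards0.
    by apply: leq_trans (leq_card_setU _ _) _; rewrite leq_add2l.
  rewrite -[X in (_ <= X * _)%N]card_ord -sum_nat_const; apply: leq_sum => i _.
  by apply: leq_trans (leq_card_setU _ _) _; apply: leq_add.
split=> // z zW zX.
set i := f z.
have zi : z \in cls W f i by rewrite inE zW eqxx.
have zC : z \notin C i.
  by apply: contra zX => zC; apply/bigcupP; exists i => //; rewrite inE zC.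
have zZ : z \notin Z i.
  by apply: contra zX => zZ; apply/bigcupP; exists i => //; rewrite inE zZ orbT.
pose A := ~: cls W f i.
have zA : z \notin A by rewrite inE zi.
have AE u : (u \in A) = (u \in W) || (f u != i).
  by rewrite !inE negb_and negbK.
have Acn (Q : {set G}) : Q \subset A -> (#|Q| <= c)%N -> (c < #|cnbr Q|)%N.
  move=> /subsetP QA Qc; apply: (near_common t0 nW Qc (j := i) _ hb3) => q /QA.
  by rewrite AE.
have hrew := SPEX_rewire (fd_card fd) sp px r0 zA Acn; rewrite -/r in hrew.
have [x0 _ xe] := px.
have xdeg u : `|r * x u - rdeg R u| <= t * N by exact: le_trans (degree_close u px) hD.
have xlow w : w \in W -> (1 - 2 * t) * N <= r * x w.
  move=> wW; have := xdeg w; rewrite ler_norml => /andP[+ _].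
  by have := proj2 nW w wW; rewrite -/N; clear; lra.
have xhi v : v \notin W -> r * x v <= N - N / k.+1%:R + 3 * (t * N) + g%:R.
  move=> vW; have := xdeg v; rewrite ler_norml => /andP[_].
  suff : rdeg R v <= N - N / k.+1%:R + 2 * (t * N) + g%:R by clear; move: (N / _) => w; lra.
  have [_ hin _] := proj1 nW; have hin' := hin v vW; have hcl := near_cls (f v) (proj1 nW).
  have : (#|[set u | adj v u]| + #|cls W f (f v)| <=
      #|G| + #|[set u in ~: W | adj v u && (f u == f v)]| + #|W|)%N.
    rewrite -cardsUI -addnA leq_add ?max_card //.
    apply: leq_trans (leq_addr _ _); apply: subset_leq_card.
    by apply/subsetP => u; rewrite !inE => /and3P[-> -> ->].
  have gW : #|W|%:R <= g%:R :> R by rewrite gs ler_nat.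
  rewrite -(ler_nat R) !natrD -/(rdeg R v) -/N; move: hin' hcl gW; rewrite -/N.
  by move: (N / _) (rdeg R v) (#|W|%:R : R) => w1 w2 w3; clear; lra.
have xpos v : 0 < x v.
  have N6 : 0 < N / k.+1%:R by apply: le_lt_trans hb4; rewrite addr_ge0 // mulr_ge0.
  have NN : N / k.+1%:R <= N by rewrite ler_pdivrMr ?ltr0n // ler_peMr ?(ler_nat R 1) // /N.
  rewrite -(pmulr_rgt0 _ r0); have [vW|vW] := boolP (v \in W).
    apply: lt_le_trans (xlow v vW); move: hb4 N6 NN nn5.
    by move: (N / _) (g%:R : R) => w1 w2; clear; lra.
  have [j jv] : exists j, j != f v.
    have [->|h] := eqVneq (f v) ord0; last by exists ord0; rewrite eq_sym.
    by exists (lift ord0 (Ordinal (fd_k fd))).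
  have h1 := near_nonadj (q := v) (j := j) nW; rewrite eq_sym jv orbT in h1.
  have {}h1 := h1 isT; have hcl := near_cls j (proj1 nW).
  have : (#|cls W f j| <= #|[set u | adj v u]| + #|nonadj (cls W f j) v|)%N.
    apply: card_sub_setU; apply/subsetP => u; rewrite !inE.
    by case: (adj v u); rewrite ?andbT //= => /andP[-> ->].
  rewrite -(ler_nat R) natrD -/(rdeg R v); have := xdeg v; rewrite ler_norml => /andP[+ _].
  move: h1 hcl hb4 nn5 tn0; rewrite -/N.
  by move: (N / _) (rdeg R v) (g%:R : R) (t * N) => w1 w2 w3 w4; clear; lra.
pose I := [set v in cls W f i | adj z v].
pose Mi := [set v in A | ~~ adj z v].
have IC : I \subset C i.
  apply/subsetP => v; rewrite inE => /andP[vi zv].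
  by have := CP i z v zi vi zv; rewrite (negbTE zC).
have hI : (#|I| <= #|W :\: [set v | adj z v]|)%N.
  have : (#|[set v in W :|: C i | adj z v]| < g)%N.
    by move: zZ; rewrite inE zi /= -ltnNge.
  rewrite gs ltnS => h.
  rewrite -(leq_add2l #|W :&: [set v | adj z v]|) cardsID; apply: leq_trans h.
  rewrite -cardsUI (_ : (W :&: [set v | adj z v]) :&: I = set0) ?cards0 ?addn0.
    apply: subset_leq_card; apply/subsetP => v; rewrite !inE => /orP[/andP[-> ->]//|/andP[vi zv]].
    by rewrite zv andbT (subsetP IC) ?orbT // !inE vi zv.
  apply/setP => v; rewrite !inE; by case: (v \in W); rewrite ?andbF.
have hsum : \sum_(v in Mi) x v <= \sum_(v in I) x v.
  move: hrew; rewrite -xe /nb (bigID (fun v => adj z v)) /= [leRHS](bigID (mem A)) /=.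
  have -> : \sum_(v | (v \in A) && adj z v) x v = \sum_(v | adj z v && (v \in A)) x v.
    by apply: eq_bigl => v; rewrite andbC.
  rewrite lerD2l.
  have -> : \sum_(v in Mi) x v = \sum_(v | (v \in A) && ~~ adj z v) x v.
    by apply: eq_bigl => v; rewrite inE.
  have -> // : \sum_(v in I) x v = \sum_(v | adj z v && (v \notin A)) x v.
  by apply: eq_bigl => v; rewrite inE [in RHS]inE negbK andbC.
(* Entries on [W] exceed all others, as degrees near [n] exceed degrees near [n - n / p]. *)
have gap : N - N / k.+1%:R + 3 * (t * N) + g%:R < (1 - 2 * t) * N.
  by move: hb4 tn0; move: (N / _) => w; clear; lra.
set L := (1 - 2 * t) * N in xlow gap; set Up := _ + g%:R in xhi gap.
have Up0 : 0 <= Up.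
  by have := xhi z zW; apply: le_trans; rewrite mulr_ge0 // ltW.
have W0 : W :\: [set v | adj z v] = set0.
  apply/eqP; rewrite -cards_eq0 -leqn0 leqNgt; apply/negP => Wp.
  have : r * \sum_(v in Mi) x v <= r * \sum_(v in I) x v by rewrite ler_pM2l.
  apply/negP; rewrite -ltNge !big_distrr /=.
  apply: (@le_lt_trans _ _ (#|W :\: [set v | adj z v]|%:R * Up)).
    apply: (@le_trans _ _ (\sum_(v in I) Up)).
      by apply: ler_sum => v; rewrite inE => /andP[]; rewrite inE => /andP[vW _] _; apply: xhi.
    by rewrite sumr_const -[_ *+ #|_|]mulr_natl ler_wpM2r // ler_nat.
  apply: (@lt_le_trans _ _ (#|W :\: [set v | adj z v]|%:R * L)).
    by rewrite ltr_pM2l // ltr0n.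
  apply: (@le_trans _ _ (\sum_(v in W :\: [set v | adj z v]) r * x v)).
    rewrite mulr_natl -sumr_const; apply: ler_sum => v; rewrite inE => /andP[_ vW].
    exact: xlow.
  rewrite [leRHS](bigID (mem W)) /=.
  rewrite [X in X + _](eq_bigl (fun v => v \in W :\: [set v | adj z v])); last first.
    by move=> v; rewrite !inE; case: (v \in W); rewrite ?andbF ?andbT.
  rewrite lerDl; apply: sumr_ge0 => v _; rewrite mulr_ge0 // ltW //.
have I0 : I = set0 by apply/eqP; rewrite -cards_eq0 -leqn0; move: hI; rewrite W0 cards0.
have M0 : Mi = set0.
  apply/setP => v; rewrite [RHS]inE; apply/negbTE/negP => vM.
  move: hsum; rewrite I0 big_set0; apply/negP; rewrite -ltNge.
  by rewrite (bigD1 v) //= ltr_pwDl // sumr_ge0 // => u _; rewrite ltW.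
move=> u; rewrite -AE; apply/idP/idP => [zu|uA].
  apply: contraT => uA; have : u \in I by rewrite inE zu andbT; move: uA; rewrite inE negbK.
  by rewrite I0 inE.
apply: contraT => zu; have : u \in Mi by rewrite inE uA zu.
by rewrite M0 inE.
Qed.

Definition perron_close R G k (x : G -> R) (r t : R) :=
  \sum_v `|x v - 1| <= t * #|G|%:R /\
  `|r - (1 - k.+1%:R^-1) * #|G|%:R| <= t * #|G|%:R.

Definition spectral_lower R H k :=
  forall e : R, 0 < e -> exists N, forall n, (N <= n)%N -> forall G, SPEX R n H G ->
     (1 - k.+1%:R^-1) * n%:R +
     (family_gamma H).-1%:R * ((1 - k.+1%:R^-1)^-1 - (1 - k.+1%:R^-1)) - e <=
     spectral_radius R G.

Lemma turan_density R k : (0 < k)%N ->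
  let a : R := 1 - k.+1%:R^-1 in [/\ 2^-1 <= a, a <= 1, 1 <= a^-1 & a^-1 <= 2].
Proof.
move=> k0 a.
have ip0 : 0 < k.+1%:R^-1 :> R by rewrite invr_gt0 ltr0n.
have ip2 : k.+1%:R^-1 <= 2^-1 :> R by rewrite lef_pV2 ?posrE ?ltr0n // (ler_nat R 2).
have a2 : 2^-1 <= a by rewrite /a; move: (k.+1%:R^-1 : R) ip2 => ip; clear; lra.
have a1 : a <= 1 by rewrite /a; move: (k.+1%:R^-1 : R) ip0 => ip; clear; lra.
have a0 : 0 < a by apply: lt_le_trans a2; rewrite invr_gt0 ltr0n.
split=> //; first by rewrite invf_ge1.
by rewrite -[leRHS]invrK lef_pV2 // posrE invr_gt0.
Qed.

Lemma SPEX_lower R H k : (0 < k)%N ->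
  spectral_lower R H k ->
  exists N, forall n, (N <= n)%N -> forall G, SPEX R n H G ->
    (1 - k.+1%:R^-1) * n%:R - 1 <= spectral_radius R G.
Proof.
move=> k0 LB; have [N hN] := LB 1 ltr01; exists N => n nN G sp.
apply: le_trans (hN n nN G sp); rewrite lerD2r lerDl mulr_ge0 //.
have [_ a1 a2 _] := turan_density R k0; move: a1 a2.
by move: (1 - _ : R) => a; move: (a^-1) => b; clear; lra.
Qed.

(** [K] is fixed before [th], so the accuracy of the eigenvector can later be chosen in terms of the
    size of the core. *)
Lemma SPEX_clean R H k c m :
  family_data H k c m -> spectral_lower R H k ->
  exists K, forall th : R, 0 < th -> exists N, forall n, (N <= n)%N ->
    forall G (x : G -> R), SPEX R n H G -> perron x (spectral_radius R G) ->
    exists (W X : {set G}) (f : G -> 'I_k.+1),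
    [/\ clean W X f, #|W| = (family_gamma H).-1, (#|X| <= K)%N, near_full W f th &
        perron_close k x (spectral_radius R G) th].
Proof.
move=> fd LB; set g := family_gamma H.
exists (k.+1 * (2 * m + 2 ^ (g.-1 + 2 * m) * c))%N => th th0.
pose b : R := g%:R + 2 * m%:R + c%:R + k.+1%:R * c%:R + 6.
have b0 : 0 < b by rewrite /b ltr_wpDl // !addr_ge0 // mulr_ge0.
have ip0 : 0 < k.+1%:R^-1 :> R by rewrite invr_gt0 ltr0n.
have [t [t0 tth tb _ _]] := exists_pos_le4 th0 (divr_gt0 ip0 (mulr_gt0 (ltr0n R 2) b0)) th0 th0.
have [N1 hN1] := SPEX_near fd t0 LB.
have [N2 hN2] := SPEX_lower (fd_k fd) LB.
have g0 : (0 < c + g)%N by rewrite addn_gt0 (fd_c fd).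
have [N3 hN3] := spectral_stability 1 (fd_k fd) g0 t0.
have [N4 hN4] := exists_nat_ge (2 * (2 * c%:R + 2 * m%:R + g%:R + 1) / k.+1%:R^-1 : R).
have [N5 hN5] := exists_nat_ge (1 / t).
exists (maxn 3 (maxn N1 (maxn N2 (maxn N3 (maxn N4 N5))))) => n.
rewrite !geq_max => /and5P[n3 nN1 nN2 nN3 /andP[nN4 nN5]] G x sp px.
have [Gn free _] := sp.
have [W [f [Ws nW dW]]] := hN1 n nN1 G x sp px.
have hr := hN2 n nN2 G sp; rewrite -Gn in hr n3 nN3 dW nN4 nN5.
have [hD hr2 _] := hN3 G x _ nN3 (free_no_partite fd free) px hr.
have n4 := hN4 _ nN4; rewrite ler_pdivrMr // in n4.
have n5 := hN5 _ nN5; rewrite ler_pdivrMr // in n5.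
have r0 : 0 < spectral_radius R G.
  apply: lt_le_trans hr; have [a2 _ _ _] := turan_density R (fd_k fd).
  have : 3 <= #|G|%:R :> R by rewrite (ler_nat R 3).
  have : 2^-1 * #|G|%:R <= (1 - k.+1%:R^-1) * #|G|%:R :> R by rewrite ler_wpM2r.
  by move: ((1 - _) * #|G|%:R) => w; clear; lra.
have fW : near_full W f t by split.
have [|X cX Xc] := near_clean fd sp px r0 (ltW t0) fW Ws hD.
  rewrite -/g -/b; have : t * (2 * b) * #|G|%:R <= k.+1%:R^-1 * #|G|%:R.
    by rewrite ler_wpM2r // -ler_pdivlMr // mulr_gt0.
  move: n4 (ler0n R g) (ler0n R m) (ler0n R c); move: (k.+1%:R^-1 : R) (b) => ip b'.
  move: (g%:R : R) (m%:R : R) (c%:R : R) (#|G|%:R : R) => g' m' c' n'.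
  by clear; lra.
have tn : t * #|G|%:R <= th * #|G|%:R by rewrite ler_wpM2r.
exists W, X, f; split=> //.
  split; first exact: near_mono nW.
  move=> w wW; apply: le_trans (dW w wW); move: tn; clear; lra.
split; first exact: le_trans hD tn.
rewrite [_ * #|G|%:R]mulrDl in hr2; rewrite ler_norml; move: hr hr2 n5 tn.
move: ((1 - _) * #|G|%:R) (th * #|G|%:R) => w1 w2.
by clear; move=> *; apply/andP; split; lra.
Qed.

(** Only pairs inside [W :|: X] can break the pattern, so a vertex has at most [#|W| + #|X|]
    defects. *)
Lemma clean_near_full R G k (W X : {set G}) (f : G -> 'I_k.+1) (t : R) :
  clean W X f -> #|W|%:R + #|X|%:R <= t * #|G|%:R ->
  (forall i, `|#|cls W f i|%:R - #|G|%:R / k.+1%:R| <= t * #|G|%:R) ->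
  near_full W f t.
Proof.
move=> [_ cl] hWX hc.
have Xle : #|X|%:R <= t * #|G|%:R by apply: le_trans hWX; rewrite lerDr.
split; [split=> // v vW|move=> w wW].
- apply: le_trans Xle; rewrite ler_nat; apply: subset_leq_card; apply/subsetP => u.
  rewrite !inE => /and3P[uW vu /eqP fu]; apply: contraLR vu => uX.
  by rewrite adj_sym (cl u uW uX) negb_or vW fu eqxx.
- apply: le_trans Xle; rewrite ler_nat; apply: subset_leq_card; apply/subsetP => u.
  rewrite !inE => /and3P[uW vu fu]; apply: contraLR vu => uX.
  by rewrite adj_sym (cl u uW uX) negbK eq_sym fu orbT.
have : (#|G| <= #|[set v | adj w v]| + (#|W| + #|X|))%N.
  apply: leq_trans (leq_add (leqnn _) (leq_card_setU W X)); rewrite -cardsT.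
  apply: card_sub_setU; apply/subsetP => u _; rewrite !inE.
  have [//|uW] := boolP (u \in W); first by rewrite orbT.
  have [_|uX] := boolP (u \in X); first by rewrite !orbT.
  by rewrite adj_sym (cl u uW uX) wW.
rewrite -(ler_nat R) !natrD -/(rdeg R w).
by move: hWX; move: (rdeg R w) => d; clear; lra.
Qed.

(** By [degree_close] an entry is nearly the degree divided by [r], and [r] is near [a n]; degrees
    are near [a n] off [W] and near [n] on [W]. The constant 32 comes from an error [8 * (t * N)]
    divided by [r >= N / 4]. *)
Lemma near_full_weights R G k (W : {set G}) (f : G -> 'I_k.+1)
    (x : G -> R) (r t : R) :
  (0 < k)%N -> (0 < #|G|)%N -> near_full W f t -> perron x r -> perron_close k x r t ->
  t <= 8^-1 -> #|W|%:R <= t * #|G|%:R ->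
  (forall u, u \notin W -> `|x u - 1| <= 32 * t) /\
  (forall u, u \in W -> `|x u - (1 - k.+1%:R^-1)^-1| <= 32 * t).
Proof.
move=> k0 G0 nW px [hD hr] t8 Wt.
have [a2 a1 ai1 ai2] := turan_density R k0.
set N : R := #|G|%:R in hD hr Wt *.
have N0 : 0 < N by rewrite ltr0n.
have nk : N / k.+1%:R = N - (1 - k.+1%:R^-1) * N by ring.
set a : R := 1 - _ in hr a2 a1 ai1 ai2 nk *.
have a0 : 0 < a by apply: lt_le_trans a2; rewrite invr_gt0 ltr0n.
have aN : 2^-1 * N <= a * N by rewrite ler_pM2r.
have tN : t * N <= 8^-1 * N by rewrite ler_pM2r.
have rN : N / 4 <= r.
  by move: hr; rewrite ler_norml => /andP[+ _]; move: aN tN N0; move: (a * N) (t * N) => w1 w2; clear; lra.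
have r0 : 0 < r by apply: lt_le_trans rN; rewrite divr_gt0.
have xdeg u : `|r * x u - rdeg R u| <= t * N by exact: le_trans (degree_close u px) hD.
have fin y b : `|r * y - r * b| <= 8 * (t * N) -> `|y - b| <= 32 * t.
  rewrite -mulrBr normrM (gtr0_norm r0) => h; rewrite -(ler_pM2l r0); apply: le_trans h _.
  have : 0 <= t * N by apply: le_trans Wt; rewrite ler0n.
  rewrite pmulr_lge0 // => t0.
  have : t * (N / 4) <= t * r by apply: ler_wpM2l.
  by clear; lra.
have [[hc hin hmis] hW] := nW.
split=> u uW; apply: fin; rewrite ler_norml.
  rewrite mulr1; have := xdeg u; have := hr; rewrite !ler_norml => /andP[r1 r2] /andP[x1 x2].
  have hin' := hin u uW; have hmis' := hmis u uW; have hcl := hc (f u).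
  rewrite -/N in hin' hmis' hcl; move: hcl; rewrite ler_norml nk => /andP[c1 c2].
  have up : (#|[set v | adj u v]| + #|cls W f (f u)| <=
      #|G| + #|[set v in ~: W | adj u v && (f v == f u)]| + #|W|)%N.
    rewrite -cardsUI -addnA leq_add ?max_card //.
    apply: leq_trans (leq_addr _ _); apply: subset_leq_card.
    by apply/subsetP => v; rewrite !inE => /and3P[-> -> ->].
  have lo : (#|G| <= #|[set v | adj u v]| + (#|cls W f (f u)| + (#|W| +
      #|[set v in ~: W | ~~ adj u v && (f v != f u)]|)))%N.
    rewrite -cardsT; apply: (@leq_trans #|[set v | adj u v] :|: (cls W f (f u) :|: (W :|:
      [set v in ~: W | ~~ adj u v && (f v != f u)]))|).
      apply: subset_leq_card; apply/subsetP => v _; rewrite !inE.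
      by case: (adj u v); case: (v \in W); case: (f v == f u).
    do 2 (apply: leq_trans (leq_card_setU _ _) _; rewrite leq_add2l).
    exact: leq_card_setU.
  move: up lo; rewrite -!(ler_nat R) !natrD -/(rdeg R u) -/N.
  move: r1 r2 x1 x2 hin' hmis' c1 c2 Wt; move: (rdeg R u) (r * x u) (a * N) (t * N) => d w1 w2 w3.
  move: (#|W|%:R : R) (#|[set v in _ | adj _ _ && _]|%:R : R) => W' I'.
  move: (#|[set v in _ | ~~ adj _ _ && _]|%:R : R) (#|cls _ _ _|%:R : R) => M' C'.
  by clear; move=> *; apply/andP; split; lra.
have := xdeg u; have := hr; rewrite !ler_norml => /andP[r1 r2] /andP[x1 x2].
have up : rdeg R u <= N by rewrite /rdeg ler_nat max_card.
have lo := hW u uW; rewrite -/N in lo.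
have aE : N = a * N * a^-1 by rewrite mulrAC mulfV ?mul1r // gt_eqF.
have p1 : a^-1 * (- (t * N)) <= a^-1 * (r - a * N) by rewrite ler_wpM2l // invr_ge0 ltW.
have p2 : a^-1 * (r - a * N) <= a^-1 * (t * N) by rewrite ler_wpM2l // invr_ge0 ltW.
have p3 : a^-1 * (t * N) <= 2 * (t * N).
  by rewrite ler_wpM2r //; apply: le_trans Wt; rewrite ler0n.
move: aE p1 p2 p3 x1 x2 up lo; move: (a^-1) (r * x u) (rdeg R u) (a * N) => b w1 d w2.
by clear; move=> *; apply/andP; split; lra.
Qed.

(** * Balancing the class sizes *)

Lemma clean_nb R G k (W X : {set G}) (f : G -> 'I_k.+1)
    (x : G -> R) (u : G) : clean W X f -> u \notin W -> u \notin X ->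
  nb x u = \sum_v x v - \sum_(v in cls W f (f u)) x v.
Proof.
move=> [_ cl] uW uX; rewrite [\sum_v x v](bigID (mem (cls W f (f u)))) /= addrC addrK.
rewrite /nb; apply: eq_bigl => v; rewrite (cl u uW uX) [in RHS]inE.
by rewrite negb_and negbK.
Qed.

(** Vertices of one class outside [X] have equal entries, so a class sum is its size times that
    entry, up to the contribution of [X]. The eigenvalue equations at [u] and [v] express
    [r * (x v - x u)] as the difference of the class sums, and eliminating [x v] gives the bound. *)
Lemma clean_class_gap R G k (W X : {set G}) (f : G -> 'I_k.+1)
    (x : G -> R) (r e : R) (K d : nat) (u v : G) :
  perron x r -> 0 < r -> clean W X f -> (#|X| <= K)%N ->
  (forall w, w \notin W -> `|x w - 1| <= e) ->
  u \notin W -> u \notin X -> v \notin W -> v \notin X ->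
  (#|cls W f (f v)| + d <= #|cls W f (f u)|)%N ->
  r * (d%:R * x u - 4 * e * K%:R) <=
  (\sum_(w in cls W f (f u)) x w - \sum_(w in cls W f (f v)) x w) *
  (r + #|cls W f (f v)|%:R).
Proof.
move=> px r0 cl XK he uW uX vW vX hd; have [x0 _ xe] := px.
have e0 : 0 <= e by apply: le_trans (he u uW).
have close w w' : w \notin W -> w' \notin W -> `|x w - x w'| <= 2 * e.
  move=> wW wW'; move: (he w wW) (he w' wW'); rewrite !ler_norml.
  by clear; move=> /andP[h1 h2] /andP[h3 h4]; apply/andP; split; lra.
have rn : r != 0 by rewrite gt_eqF.
have same w w' : w \in cls W f (f w') -> w \notin X -> w' \notin W -> w' \notin X -> x w = x w'.
  rewrite inE => /andP[wW /eqP fw] wX w'W w'X; apply: (mulfI rn).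
  by rewrite -!xe (clean_nb x cl wW wX) (clean_nb x cl w'W w'X) fw.
have near_sum w' : w' \notin W -> w' \notin X ->
    `|\sum_(w in cls W f (f w')) x w - #|cls W f (f w')|%:R * x w'| <= 2 * e * K%:R.
  move=> w'W w'X; rewrite mulr_natl -sumr_const -sumrB.
  apply: le_trans (ler_norm_sum _ _ _) _.
  apply: (@le_trans _ _ (\sum_(w in X) 2 * e)).
    rewrite [leRHS]big_mkcond [leLHS]big_mkcond /=; apply: ler_sum => w _.
    case: ifP => [wc|_]; last by case: ifP => // _; rewrite mulr_ge0.
    case: ifP => [_|wX]; first by apply: close w'W; move: wc; rewrite inE => /andP[].
    by rewrite (same w w') ?subrr ?normr0 // wX.
  by rewrite sumr_const -[_ *+ #|_|]mulr_natr ler_wpM2l ?mulr_ge0 // ler_nat.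
have hu := near_sum u uW uX; have hv := near_sum v vW vX.
have nu : r * x u = \sum_w x w - \sum_(w in cls W f (f u)) x w by rewrite -xe (clean_nb x cl).
have nv : r * x v = \sum_w x w - \sum_(w in cls W f (f v)) x w by rewrite -xe (clean_nb x cl).
set Yu := \sum_(w in cls W f (f u)) x w in hu nu *.
set Yv := \sum_(w in cls W f (f v)) x w in hv nv *.
have D : Yu - Yv = r * x v - r * x u by rewrite nu nv; ring.
set nU := #|cls W f (f u)| in hd hu *; set nV := #|cls W f (f v)| in hd hv *.
have h1 : d%:R * x u <= (nU%:R - nV%:R) * x u.
  by apply: ler_wpM2r => //; rewrite lerBrDl -natrD ler_nat.
have h2 : d%:R * x u - 4 * e * K%:R <= Yu - Yv + nV%:R * (x v - x u).
  move: hu hv h1; rewrite !ler_norml => /andP[u1 _] /andP[_ v2].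
  move: u1 v2; move: (x u) (x v) (nV%:R : R) (nU%:R : R) => xu xv p q.
  by clear; lra.
have -> : (Yu - Yv) * (r + nV%:R) = r * (Yu - Yv) + nV%:R * (Yu - Yv) by ring.
rewrite [X in _ + nV%:R * X]D -mulrBr [nV%:R * _]mulrCA -mulrDr.
by rewrite ler_pM2l.
Qed.

Definition recolor (T : eqType) k (f : T -> 'I_k.+1) (z : T) (j : 'I_k.+1) (u : T) :=
  if u == z then j else f u.

Definition off_class G k (W : {set G}) (f : G -> 'I_k.+1) (z : G) (j : 'I_k.+1) :
  {set G} := [set u | (u \notin cls W f j) && (u != z)].

Lemma clean_move G k (W X : {set G}) (f : G -> 'I_k.+1) (z : G) (j : 'I_k.+1) :
  clean W X f -> z \notin W -> f z != j ->
  @clean (rewire z (off_class W f z j)) k W X (recolor f z j).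
Proof.
move=> cl zW fz; set A := off_class W f z j; set f' := recolor f z j.
case: cl => WX cl'.
suff h (v u : G) : v \notin W -> v \notin X ->
    rewire_adj z A v u = (u \in W) || (f' u != f' v) by split=> // v vW vX u; exact: h.
move=> vW vX; rewrite /rewire_adj /f' /recolor /A !inE.
have [_|vz] := eqVneq v z.
  have [->|uz] := eqVneq u z; first by rewrite (negbTE zW) eqxx.
  by rewrite andbT negb_and negbK.
have [->|uz] := eqVneq u z; last exact: cl'.
by rewrite (negbTE zW) vW andbT /= eq_sym.
Qed.

Lemma cls_move_to G k (W : {set G}) (f : G -> 'I_k.+1) (z : G) (j : 'I_k.+1) :
  z \notin W -> cls W (recolor f z j) j = z |: cls W f j.
Proof.
move=> zW; apply/setP => u; rewrite !inE /recolor; have [->|uz] := eqVneq u z.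
  by rewrite zW eqxx.
by [].
Qed.

Lemma cls_move_from G k (W : {set G}) (f : G -> 'I_k.+1) (z : G) (j : 'I_k.+1) :
  f z != j -> cls W (recolor f z j) (f z) = cls W f (f z) :\ z.
Proof.
move=> fz; apply/setP => u; rewrite !inE /recolor; have [->|uz] := eqVneq u z.
  by rewrite eq_sym (negbTE fz) andbF.
by [].
Qed.

Lemma cls_move_other G k (W : {set G}) (f : G -> 'I_k.+1) (z : G) (j : 'I_k.+1) i :
  i != j -> i != f z -> cls W (recolor f z j) i = cls W f i.
Proof.
move=> ij iz; apply/setP => u; rewrite !inE /recolor; have [->|uz] // := eqVneq u z.
by rewrite eq_sym (negbTE ij) eq_sym (negbTE iz).
Qed.

(* [r' - r] has the sign of [x z * D' + y z * D], where [D] and [D'] are the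
   differences of the two class sums, of [x] before and of [y] after the move. *)
Lemma move_gain R G k (W X : {set G}) (f : G -> 'I_k.+1) (z : G) (j : 'I_k.+1) (x y : G -> R) (r r' e : R) (K : nat) (u v : G) :
  clean W X f -> z \notin W -> z \notin X -> f z != j ->
  perron x r -> @perron R (rewire z (off_class W f z j)) y r' -> 0 < r -> 0 < r' -> (#|X| <= K)%N ->
  (forall w, w \notin W -> `|x w - 1| <= e) -> (forall w, w \notin W -> `|y w - 1| <= e) ->
  e <= 100^-1 -> 4 * e * K%:R <= 100^-1 ->
  u \notin W -> u \notin X -> u != z -> f u = f z ->
  v \notin W -> v \notin X -> f v = j ->
  (#|cls W f j| + 2 <= #|cls W f (f z)|)%N ->
  #|cls W f j|%:R <= 2 * r -> r < r'.
Proof.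
move=> cl zW zX fz px py r0 r'0 XK hx hy e1 e2 uW uX uz fu vW vX fv gap hr.
set A := off_class W f z j in py; pose f' := recolor f z j.
have [x0 _ xe] := px; have [y0 _ ye] := py.
have zj : z \notin cls W f j by rewrite !inE negb_and fz orbT.
have zi : z \in cls W f (f z) by rewrite inE zW eqxx.
have zA : z \notin A by rewrite !inE eqxx andbF.
have fvE : f' v = j by rewrite /f' /recolor fv; case: ifP.
have fuE : f' u = f z by rewrite /f' /recolor (negbTE uz).
have fvj : (#|cls W f (f v)| + 2 <= #|cls W f (f z)|)%N by rewrite fv.
have g1 := clean_class_gap px r0 cl XK hx zW zX vW vX fvj; rewrite fv in g1.
(* The move takes one vertex from the larger class to the smaller, so a difference of at least 2
   stays nonnegative; this is why balance is reached only up to 1. *)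
have g2 : (#|cls W f' (f' v)| + 0 <= #|cls W f' (f' u)|)%N.
  rewrite fvE fuE cls_move_to // cls_move_from // cardsU1 zj addn0.
  by move: gap; rewrite (cardsD1 z (cls W f (f z))) zi /= !add1n addn2 ltnS.
have {}g2 : r' * (0%:R * y u - 4 * e * K%:R) <=
    (\sum_(w in cls W f' (f' u)) y w - \sum_(w in cls W f' (f' v)) y w) *
    (r' + #|cls W f' (f' v)|%:R) := @clean_class_gap R (rewire z A) k W X f' y r' e K 0 u v py r'0
  (clean_move cl zW fz) XK hy
  uW uX vW vX g2.
rewrite fvE fuE in g2.
have Yi : \sum_(w in cls W f (f z)) y w = y z + \sum_(w in cls W f' (f z)) y w.
  by rewrite (big_setD1 z zi) cls_move_from.
have Yj : \sum_(w in cls W f' j) y w = y z + \sum_(w in cls W f j) y w.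
  by rewrite cls_move_to // (big_setU1 z zj).
have sA (F : G -> R) : \sum_(w in A) F w = \sum_w F w - \sum_(w in cls W f j) F w - F z.
  rewrite [\sum_w F w](bigID (mem (cls W f j))) /= addrC addrK.
  rewrite [\sum_(w | w \notin _) F w](bigD1 z) //= [F z + _]addrC addrK.
  by apply: eq_bigl => w; rewrite [in LHS]inE.
have form := @rewire_form R G z A x y zA.
have E1 : \sum_u y u * @nb R (rewire z A) x u = r' * \sum_u x u * y u.
  have -> : \sum_u y u * @nb R (rewire z A) x u = \sum_u x u * @nb R (rewire z A) y u.
    rewrite /nb; under eq_bigr do rewrite big_distrr /= big_mkcond /=.
    under [RHS]eq_bigr do rewrite big_distrr /= big_mkcond /=.
    rewrite exchange_big /=; apply: eq_bigr => a _; apply: eq_bigr => b _.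
    by rewrite (rewire_sym z A a b) mulrC.
  by rewrite big_distrr; apply: eq_bigr => a _; rewrite ye mulrCA.
have E2 : \sum_u y u * nb x u = r * \sum_u x u * y u.
  by rewrite big_distrr; apply: eq_bigr => a _; rewrite xe mulrCA [y a * _]mulrC.
rewrite E1 E2 !sA (clean_nb x cl zW zX) (clean_nb y cl zW zX) in form.
set S := \sum_u x u * y u in form.
have S0 : 0 <= S by apply: sumr_ge0 => a _; rewrite mulr_ge0.
set D := \sum_(w in cls W f (f z)) x w - \sum_(w in cls W f j) x w in g1.
set D' := \sum_(w in cls W f' (f z)) y w - \sum_(w in cls W f' j) y w in g2.
have hform : (r' - r) * S = x z * (D' + y z) + y z * (D - x z).
  rewrite /D' /D Yj; have -> : \sum_(w in cls W f' (f z)) y w = \sum_(w in cls W f (f z)) y w - y z.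
    by rewrite Yi addrC addKr.
  by rewrite mulrBl form; ring.
have /andP[xz1 xz2] : 99 / 100 <= x z <= 101 / 100.
  have := hx z zW; rewrite ler_norml => /andP[h1 h2].
  by move: h1 h2 e1; clear; move=> *; apply/andP; split; lra.
have /andP[yz1 yz2] : 99 / 100 <= y z <= 101 / 100.
  have := hy z zW; rewrite ler_norml => /andP[h1 h2].
  by move: h1 h2 e1; clear; move=> *; apply/andP; split; lra.
(* [D * (r + nj) >= (19 / 10) * r] and [nj <= 2 * r] give [D >= 19 / 30], while [D'] can be negative
   by at most [1 / 100]. *)
have D1 : 2^-1 <= D.
  have nj0 : 0 <= #|cls W f j|%:R :> R by [].
  move: g1 hr nj0 xz1 e2 r0; move: (#|cls W f j|%:R : R) (4 * e * K%:R) (x z) => nj w xz.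
  move: (D) => d g1 hr nj0 xz1 e2 r0.
  have h : r * (19 / 10) <= d * (r + nj).
    by apply: le_trans g1; rewrite ler_pM2l //; move: xz1 e2; clear; lra.
  rewrite leNgt; apply/negP => dlt.
  have : d * (r + nj) <= 2^-1 * (r + nj).
    by apply: ler_wpM2r; [apply: addr_ge0 => //; exact: ltW | exact: ltW].
  by move: h hr r0; clear; lra.
have D2 : - 100^-1 <= D'.
  have nj0 : 0 <= #|cls W f' j|%:R :> R by [].
  move: g2 nj0 e2 r'0; move: (#|cls W f' j|%:R : R) (4 * e * K%:R) => nj w.
  move: (D') => d; rewrite mul0r sub0r => g2 nj0 e2 rp.
  rewrite leNgt; apply/negP => dlt.
  have h : r' * (- 100^-1) <= d * (r' + nj).
    by apply: le_trans g2; rewrite ler_pM2l // lerN2.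
  have h2 : d * r' < - 100^-1 * r' by rewrite ltr_pM2r.
  have h3 : d * nj <= 0 by rewrite mulr_le0_ge0 //; move: dlt; clear; lra.
  by move: h h2 h3; clear; lra.
have pos : 0 < (r' - r) * S.
  rewrite hform; move: D1 D2 xz1 xz2 yz1 yz2; move: (D) (D') (x z) (y z) => d d' a b.
  clear=> *.
  have : a * (- 100^-1) <= a * d' by rewrite ler_wpM2l //; lra.
  have : b * 2^-1 <= b * d by rewrite ler_wpM2l //; lra.
  by lra.
rewrite -subr_gt0 ltNge; apply/negP => h; move: pos; apply/negP; rewrite -leNgt.
by rewrite mulr_le0_ge0.
Qed.

Lemma exists_outside (T : finType) (A B : {set T}) : (#|B| < #|A|)%N ->
  exists2 z, z \in A & z \notin B.
Proof.
move=> h; have : A :\: B != set0.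
  rewrite -cards_eq0 -lt0n -(ltn_add2l #|A :&: B|) cardsID addn0.
  by apply: leq_ltn_trans h; apply: subset_leq_card; apply: subsetIr.
by case/set0Pn => z /setDP[zA zB]; exists z.
Qed.

(** Testing the rewired graph on [x] loses at most [2 * x z * nb x z], which is at most [4 * #|G|],
    against a squared norm of [#|G|]. *)
Lemma rewire_radius_ge R G (z : G) (A : {set G}) (x : G -> R) (r r' : R) :
  (0 < #|G|)%N -> perron x r -> rayleigh (rewire z A) r' -> z \notin A -> x z <= 2 ->
  r - 4 <= r'.
Proof.
move=> G0 px ra zA xz2; have [x0 x1 xe] := px.
have [_ Yn _] := perron_facts px.
have : \sum_u x u * @nb R (rewire z A) x u <= r' * \sum_v x v ^+ 2 := ra x.
rewrite rewire_form // x1.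
have -> : \sum_u x u * nb x u = r * #|G|%:R.
  by rewrite -x1 big_distrr /=; apply: eq_bigr => u _; rewrite xe expr2 mulrCA.
have nbz := nb_le_sum z x0; have S0 : 0 <= \sum_(v in A) x v by apply: sumr_ge0.
have n0 : 0 < #|G|%:R :> R by rewrite ltr0n.
have p1 : - (2 * #|G|%:R) <= x z * (\sum_(v in A) x v - nb x z).
  have : x z * nb x z <= 2 * #|G|%:R.
    apply: ler_pM => //; last exact: le_trans nbz Yn.
    by rewrite /nb; apply: sumr_ge0.
  have : 0 <= x z * \sum_(v in A) x v by apply: mulr_ge0.
  by rewrite mulrBr; clear; lra.
move=> h; rewrite -(ler_pM2r n0); move: h p1; move: (x z * _) => w; clear.
by lra.
Qed.

(** The graph after a move is not known to be spectral extremal, so its eigenvector is controlled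
    through its own radius, by [rewire_radius_ge] and stability, before [move_gain] can be
    applied. *)
Lemma SPEX_balanced R H k c m :
  family_data H k c m -> spectral_lower R H k ->
  exists K, forall th : R, 0 < th -> exists N, forall n, (N <= n)%N ->
    forall G (x : G -> R), SPEX R n H G -> perron x (spectral_radius R G) ->
    exists (W X : {set G}) (f : G -> 'I_k.+1),
    [/\ clean W X f, balanced W f, #|W| = (family_gamma H).-1 & (#|X| <= K)%N] /\
    near_full W f th /\ perron_close k x (spectral_radius R G) th.
Proof.
move=> fd LB; have [K hK] := SPEX_clean fd LB; exists K => th th0.
set s := (family_gamma H).-1 in hK *.
have [a2 a1 ai1 ai2] := turan_density R (fd_k fd).
have ip0 : 0 < k.+1%:R^-1 :> R by rewrite invr_gt0 ltr0n.
have ip2 : k.+1%:R^-1 <= 2^-1 :> R.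
  by move: a2; move: (k.+1%:R^-1 : R) => ip; clear; lra.
have K1 : 0 < 100 * (100 * (3 * (K%:R + 1))) :> R.
  by rewrite !mulr_gt0 // ltr_wpDl.
have c1 : 0 < 8 * (c%:R + 1) :> R by rewrite mulr_gt0 // ltr_wpDl.
have [t [t0 tth tK tc _]] := exists_pos_le4 th0 (divr_gt0 (ltr0n R 1) K1) (divr_gt0 ip0 c1) th0.
rewrite ler_pdivlMr // in tK; rewrite ler_pdivlMr // in tc.
have tK0 : 0 <= t * K%:R by rewrite mulr_ge0 // ltW.
have tc0 : 0 <= t * c%:R by rewrite mulr_ge0 // ltW.
have t64 : 64 * t <= 100^-1 by move: tK tK0 t0; clear; lra.
have [N1 hN1] := hK t t0.
have t20 : 0 < 2 * t by rewrite mulr_gt0.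
have g0 : (0 < c + family_gamma H)%N by rewrite addn_gt0 (fd_c fd).
(* The constant is [1 + 4]: the lower bound of [SPEX_lower] minus the loss of [rewire_radius_ge]. *)
have [N2 hN2] := spectral_stability 5 (fd_k fd) g0 t20.
have [N3 hN3] := SPEX_lower (fd_k fd) LB.
have [N4 hN4] := exists_nat_ge ((s%:R + K%:R + 9) / t).
have [N5 hN5] := exists_nat_ge (8 * (c%:R + K%:R + 2) / k.+1%:R^-1 : R).
exists (maxn 1 (maxn N1 (maxn N2 (maxn N3 (maxn N4 N5))))) => n.
rewrite !geq_max => /and5P[n1 nN1 nN2 nN3 /andP[nN4 nN5]] G x sp px.
have [W [X [f [cl Ws XK nW pc]]]] := hN1 n nN1 G x sp px.
have [Gn free max] := sp; have hr := hN3 n nN3 G sp.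
rewrite -Gn in n1 nN2 nN4 nN5 hr.
have nN4' := hN4 _ nN4; have nN5' := hN5 _ nN5.
rewrite ler_pdivrMr // in nN4'; rewrite ler_pdivrMr // in nN5'.
have n0 : 0 < #|G|%:R :> R by rewrite ltr0n.
have tn : t * #|G|%:R <= th * #|G|%:R by rewrite ler_pM2r.
exists W, X, f; split; last first.
  split; last first.
    by case: pc => p1 p2; split; [exact: le_trans p1 tn|exact: le_trans p2 tn].
  case: nW => n2 dW; split; first exact: near_mono n2.
  by move=> w wW; apply: le_trans (dW w wW); move: tn; clear; lra.
split=> // i j; rewrite leqNgt; apply/negP => gap.
set r := spectral_radius R G in px hr pc; set N : R := #|G|%:R in n0 nN4' nN5' hr tn.
have tcN : t * (8 * (c%:R + 1)) * N <= k.+1%:R^-1 * N by rewrite ler_pM2r.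
have tcN0 : 0 <= t * N * c%:R by rewrite !mulr_ge0 // ltW.
have tN0 : 0 < t * N by rewrite mulr_gt0.
have ipN : k.+1%:R^-1 * N <= 2^-1 * N by rewrite ler_pM2r.
have nn : [/\ 0 <= s%:R :> R, 0 <= K%:R :> R & 0 <= c%:R :> R] by [].
case: nn => s0 K0 c0.
have clsK l : (K.+1 < #|cls W f l|)%N.
  rewrite -(ltr_nat R); apply: lt_le_trans (near_cls l (proj1 nW)).
  rewrite -/N [N / _]mulrC -[K.+1%:R]natr1; move: tcN nN5' tN0 tcN0 K0 c0.
  move: (k.+1%:R^-1 : R) (K%:R : R) (c%:R : R) => ip K' c'; clear.
  by lra.
have Wt : #|W|%:R <= t * N by rewrite Ws; move: nN4' s0 K0; clear; lra.
have [wx _] := near_full_weights (fd_k fd) n1 nW px pc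
  (ltac:(move: t64 t0; clear; lra)) Wt.
have [z zi zX] := exists_outside (leq_ltn_trans XK (ltnW (clsK i))).
have [v vj vX] := exists_outside (leq_ltn_trans XK (ltnW (clsK j))).
(* A second vertex [u] of class [i] outside [X] is chosen, to represent that class after [z] has
   left it. *)
have zXc : (#|z |: X| <= K.+1)%N by rewrite cardsU1 zX add1n ltnS.
have [u ui uzX] := exists_outside (leq_ltn_trans zXc (clsK i)).
move: zi vj ui uzX; rewrite !inE negb_or => /andP[zW /eqP fz] /andP[vW /eqP fv].
move=> /andP[uW /eqP fu] /andP[uz uX].
have ij : i != j by apply: contraTneq gap => ->; rewrite -leqNgt.
have fzj : f z != j by rewrite fz.
pose A := off_class W f z j; pose G' := rewire z A.
have zA : z \notin A by rewrite !inE eqxx andbF.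
have free' : graph_free H G'.
  apply: (rewire_free (fd_card fd) free zA) => Q /subsetP QA Qc.
  apply: (near_common (j := j) (ltW t0) nW Qc).
    move=> q /QA; rewrite !inE negb_and negbK => /andP[]//.
  rewrite -/N -[c.+1%:R]natr1 [N / _]mulrC; move: tcN nN5' tN0 tcN0 K0 c0.
  move: (k.+1%:R^-1 : R) (K%:R : R) (c%:R : R) => ip K' c'; clear.
  by lra.
have G'0 : (0 < #|G'|)%N by [].
have [ra [y py]] := perron_spectral R G'0.
set r' := spectral_radius R G' in ra py.
have xz2 : x z <= 2.
  have := wx z zW; rewrite ler_norml => /andP[_]; move: t64 t0; clear; lra.
have r'r := rewire_radius_ge n1 px ra zA xz2.
have hr' : (1 - k.+1%:R^-1) * #|G'|%:R - 5 <= r'.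
  by rewrite -[#|G'|]/#|G| -/N; move: hr r'r; move: ((1 - _) * N) => w; clear; lra.
have [hD' hup _] := hN2 G' y r' nN2 (free_no_partite fd free') py hr'.
have pc' : perron_close k y r' (2 * t).
  split=> //; rewrite -[#|G'|]/#|G| in hr' hup *; rewrite [_ * #|G|%:R]mulrDl in hup.
  rewrite ler_norml; move: hr' hup nN4' s0 K0; rewrite -/N; move: ((1 - _) * N) => w.
  by clear; move=> *; apply/andP; split; lra.
have cl' := clean_move cl zW fzj.
have nW' : @near_full R G' k W (recolor f z j) (2 * t).
  apply: (clean_near_full cl').
    rewrite -[#|G'|]/#|G| -/N; move: nN4' Wt tN0; rewrite Ws.
    have : #|X|%:R <= K%:R :> R by rewrite ler_nat.
    by clear; lra.
  move=> l; rewrite -[#|G'|]/#|G| -/N.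
  have [b hb] : exists b : R, #|cls W (recolor f z j) l|%:R = #|cls W f l|%:R + b /\ `|b| <= 1.
    have [->|lj] := eqVneq l j.
      exists 1; rewrite normr1 cls_move_to // cardsU1 natrD addrC.
      by rewrite !inE negb_and fzj orbT.
    have [->|lz] := eqVneq l (f z); last first.
      by exists 0; rewrite normr0 cls_move_other // addr0.
    exists (-1); rewrite normrN normr1 cls_move_from //; split=> //.
    by rewrite (cardsD1 z (cls W f (f z))) inE zW eqxx natrD addrAC subrr add0r.
  case: hb => E b1; rewrite -[#|@cls G' _ _ _ _|]/#|cls W (recolor f z j) l| E.
  have [/(_ l) hl _ _] := proj1 nW; rewrite -/N in hl.
  move: hl b1 nN4' s0 K0; rewrite !ler_norml; move: (N / _) (#|cls W f l|%:R : R) => w1 w2.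
  by clear; move=> /andP[h1 h2] /andP[h3 h4] *; apply/andP; split; lra.
have [wy _] := near_full_weights (fd_k fd) G'0 nW' py pc'
  (ltac:(move: t64 t0; clear; lra)) (ltac:(rewrite -[#|G'|]/#|G| -/N; move: Wt tN0; clear; lra)).
have aN : 2^-1 * N <= (1 - k.+1%:R^-1) * N by rewrite ler_pM2r.
have tN1 : t * N <= 100^-1 * N by rewrite ler_pM2r //; move: t64 t0; clear; lra.
have r40 : N / 4 <= r.
  by move: hr aN tN1 nN4' s0 K0; move: ((1 - _) * N) => w; clear; lra.
have r0 : 0 < r by apply: lt_le_trans r40; rewrite divr_gt0.
have r'0 : 0 < r'.
  by move: hr' aN tN1 nN4' s0 K0 n0; rewrite -[#|G'|]/#|G| -/N; move: ((1 - _) * N) => w; clear; lra.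
have hcj : #|cls W f j|%:R <= 2 * r.
  have [/(_ j) + _ _] := proj1 nW; rewrite ler_norml => /andP[_]; rewrite -/N.
  rewrite [N / _]mulrC; move: hr aN ipN tN1 nN4' s0 K0 n0; rewrite mulrBl mul1r.
  by move: (k.+1%:R^-1 * N) => w; clear; lra.
have gap' : (#|cls W f j| + 2 <= #|cls W f (f z)|)%N by rewrite fz addn2.
have fuz : f u = f z by rewrite fu fz.
have e2 : 4 * (64 * t) * K%:R <= 100^-1 by move: tK t0; clear; lra.
have wx' w : w \notin W -> `|x w - 1| <= 64 * t.
  by move=> wW; apply: le_trans (wx w wW) _; move: t0; clear; lra.
have wy' w : w \notin W -> `|y w - 1| <= 64 * t.
  by move=> wW; apply: le_trans (wy w wW) _; move: t0; clear; lra.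
have := move_gain cl zW zX fzj px py r0 r'0 XK wx' wy' t64 e2 uW uX uz fuz vW vX fv gap' hcj.
by apply/negP; rewrite -leNgt; apply: max => //; rewrite -Gn.
Qed.

(** * Comparison with the extremal graph *)

(** Each [x] goes to the element of equal rank in the corresponding fibre. *)
Lemma fiber_bijection (I : eqType) (T U : finType) (g : T -> I) (h : U -> I) :
  (forall i, #|[set x | g x == i]| = #|[set y | h y == i]|) ->
  exists2 s : T -> U, injective s & forall x, h (s x) = g x.
Proof.
move=> E; pose F x := enum [set y | h y == g x]; pose D x := enum [set x' | g x' == g x].
have idx x : (index x (D x) < size (F x))%N.
  by rewrite /F -cardE -E cardE index_mem mem_enum inE.
have ex x : exists y : U, y \in F x.
  case: (F x) (idx x) => [|y l _]; first by rewrite ltn0.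
  by exists y; rewrite mem_head.
pose s x := nth (projT1 (cid (ex x))) (F x) (index x (D x)).
have hs x : h (s x) = g x.
  have : s x \in F x by apply: mem_nth.
  by rewrite mem_enum inE => /eqP.
exists s => // x y sxy; have gxy : g x = g y by rewrite -!hs sxy.
have := sxy; rewrite /s (set_nth_default (projT1 (cid (ex y))) _ (idx x)).
move: (projT1 _) => d0; have <- : F x = F y by rewrite /F gxy.
have DE : D y = D x by rewrite /D gxy.
have iy : (index y (D x) < size (F x))%N by have := idx y; rewrite DE /F gxy.
rewrite DE => /eqP; rewrite (nth_uniq _ (idx x) iy (enum_uniq _)) => /eqP h1.
have : nth x (D x) (index x (D x)) = nth x (D x) (index y (D x)) by rewrite h1.
by rewrite !nth_index // mem_enum inE ?gxy.
Qed.

Lemma card_cls_sum G k (W : {set G}) (f : G -> 'I_k.+1) :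
  (#|~: W| = \sum_i #|cls W f i|)%N.
Proof.
rewrite -sum1_card (partition_big f predT) //=; apply: eq_bigr => i _.
by rewrite -sum1_card; apply: eq_bigl => u; rewrite !inE.
Qed.

(** Up to order, the class sizes are thus determined by [#|~: W|]: the remainder counts the larger
    classes. *)
Lemma balanced_sizes G k (W : {set G}) (f : G -> 'I_k.+1) : balanced W f ->
  exists2 b : 'I_k.+1 -> bool,
    forall i, (#|cls W f i| = #|~: W| %/ k.+1 + b i)%N &
    (\sum_i b i = #|~: W| %% k.+1)%N.
Proof.
move=> bal; case: (@arg_minnP _ ord0 xpredT (fun i => #|cls W f i|) isT) => i0 _ hmin.
set q := #|cls W f i0| in hmin; pose b i := #|cls W f i| == q.+1.
have cE i : (#|cls W f i| = q + b i)%N.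
  have h1 := bal i i0; have h2 := hmin i isT; rewrite -/q in h1.
  move: h2; rewrite leq_eqVlt /b => /orP[/eqP <-|h3].
    by rewrite [q == _]ltn_eqF ?addn0.
  have -> : #|cls W f i| = q.+1 by apply/eqP; rewrite eqn_leq h1 h3.
  by rewrite eqxx addn1.
have NE : (#|~: W| = q * k.+1 + \sum_i b i)%N.
  by rewrite (card_cls_sum W f) (eq_bigr _ (fun i _ => cE i)) big_split /= sum_nat_const card_ord mulnC.
have lt : (\sum_i b i < k.+1)%N.
  rewrite (bigD1 i0) //= /b -/q ltn_eqF // add0n.
  apply: (@leq_ltn_trans (\sum_(i < k.+1 | i != i0) 1)); first by apply: leq_sum => i _; case: (_ == _).
  by rewrite sum1_card (eq_card (B := predC1 i0)) // cardC1 card_ord.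
exists b.
  by move=> i; rewrite cE NE divnMDl // divn_small // addn0.
by rewrite NE modnMDl modn_small.
Qed.

(** The permutation [tau] of the colours matches larger classes with larger ones. A bijection
    respecting fibres is then taken, with [W] as the fibre of [None]. *)
Lemma balanced_bijection (G G' : sgraph) k (W : {set G}) (f : G -> 'I_k.+1)
    (W' : {set G'}) (f' : G' -> 'I_k.+1) :
  balanced W f -> balanced W' f' -> #|W| = #|W'| -> #|G| = #|G'| ->
  exists s : G -> G', [/\ bijective s, forall u, (s u \in W') = (u \in W) &
    forall u v, u \notin W -> v \notin W -> (f' (s u) == f' (s v)) = (f u == f v)].
Proof.
move=> /balanced_sizes[b cb sb] /balanced_sizes[b' cb' sb'] WW GG.
have CC : #|~: W| = #|~: W'|.
  by have := cardsC W; have := cardsC W'; rewrite -GG WW => <- /eqP; rewrite eqn_add2l => /eqP.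
have cardb (a : 'I_k.+1 -> bool) : (#|[set i | a i]| = \sum_i a i)%N.
  by rewrite -sum1_card big_mkcond; apply: eq_bigr => i _; rewrite inE; case: (a i).
have bb : #|[set i | b i]| = #|[set i | b' i]| by rewrite !cardb sb sb' CC.
have [tau tinj ht] : exists2 tau : 'I_k.+1 -> 'I_k.+1, injective tau & forall i, b' (tau i) = b i.
  apply: fiber_bijection => -[].
    have -> : [set x | b x == true] = [set i | b i] by apply/setP => i; rewrite !inE eqb_id.
    by rewrite bb; apply: eq_card => i; rewrite !inE eqb_id.
  have -> : [set x | b x == false] = ~: [set i | b i] by apply/setP => i; rewrite !inE; case: (b i).
  have -> : [set x | b' x == false] = ~: [set i | b' i] by apply/setP => i; rewrite !inE; case: (b' i).
  by have := cardsC [set i | b i]; rewrite -(cardsC [set i | b' i]) bb => /eqP; rewrite eqn_add2l => /eqP.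
pose g u := if u \in W then None else Some (tau (f u)).
pose h u := if u \in W' then None else Some (f' u).
have [s sinj hs] : exists2 s : G -> G', injective s & forall u, h (s u) = g u.
  apply: fiber_bijection => -[j|]; last first.
    have -> : [set x | g x == None] = W by apply/setP => u; rewrite inE /g; case: ifP.
    by rewrite WW; apply: eq_card => u; rewrite inE /h; case: ifP.
  have [tau' _ tK] := injF_bij tinj; rewrite -(tK j); set i := tau' j.
  have -> : [set x | g x == Some (tau i)] = cls W f i.
    apply/setP => u; rewrite !inE /g; case: ifP => //= _.
    by rewrite (inj_eq (@Some_inj _)) (inj_eq tinj).
  have -> : [set x | h x == Some (tau i)] = cls W' f' (tau i).
    by apply/setP => u; rewrite !inE /h; case: ifP.
  by rewrite cb cb' CC ht.
have sW u : (s u \in W') = (u \in W).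
  by have := hs u; rewrite /h /g; case: ifP; case: ifP.
exists s; split=> //; first by apply: (inj_card_bij sinj); rewrite GG.
move=> u v uW vW; have := hs u; have := hs v.
rewrite /h /g !sW (negbTE uW) (negbTE vW) => -[->] [->].
by rewrite (inj_eq tinj).
Qed.

(* Leading eigenvectors of graphs that agree outside a bounded core pair to give
   [r' - r] as a sum over the core. *)
Lemma compare_radii R (G G' : sgraph) (s : G -> G') (x : G -> R) (y : G' -> R)
    (r r' l e : R) (W Core : {set G}) :
  bijective s -> perron x r -> perron y r' -> 1 <= l <= 2 -> 0 <= e <= 1 ->
  (forall u, u \in W -> `|x u - l| <= e /\ `|y (s u) - l| <= e) ->
  (forall u, u \notin W -> `|x u - 1| <= e /\ `|y (s u) - 1| <= e) ->
  (forall u v, u \notin Core -> adj (s u) (s v) = adj u v) ->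
  (forall u v, u \in W -> v \notin W -> adj (s u) (s v)) ->
  einner R W <= \sum_(u in W) \sum_(v in W) (adj (s u) (s v))%:R ->
  (#|edges G| < #|edges G'|)%N ->
  5 * e * #|Core|%:R ^+ 2 < 2 -> r < r'.
Proof.
move=> sbij px py l12 e01 hW hV hcore hjoin hin hedge hsmall.
have [x0 _ xe] := px; have [y0 _ ye] := py.
have sreindex (F : G' -> R) : \sum_w F w = \sum_u F (s u).
  by rewrite (reindex s) //; exact: onW_bij.
pose g u v : R := (adj (s u) (s v))%:R - (adj u v)%:R.
have gsym u v : g u v = g v u by rewrite /g adj_sym [adj u v]adj_sym.
have gcore u v : (u \notin Core) || (v \notin Core) -> g u v = 0.
  by case/orP => h; last rewrite gsym; rewrite /g hcore // subrr.
have g1 u v : -1 <= g u v <= 1.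
  rewrite /g; case: (adj (s u) (s v)); case: (adj u v) => /=; clear;
    apply/andP; split; lra.
pose om u : R := if u \in W then l else 1.
have omx u : `|x u - om u| <= e.
  by rewrite /om; case: ifPn => [/hW[]|/hV[]].
have omy u : `|y (s u) - om u| <= e.
  by rewrite /om; case: ifPn => [/hW[]|/hV[]].
have om12 u : 1 <= om u <= 2.
  by rewrite /om; case: ifP => // _; rewrite lexx (ler_nat R 1 2).
set S := \sum_u x u * y (s u).
have form : (r' - r) * S = \sum_u \sum_v g u v * (x u * y (s v)).
  have E1 : r' * S = \sum_u \sum_v (adj (s u) (s v))%:R * (x u * y (s v)).
    rewrite /S big_distrr /=; apply: eq_bigr => u _; rewrite mulrCA -ye /nb.
    rewrite big_mkcond sreindex big_distrr; apply: eq_bigr => v _ /=.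
    by case: (adj _ _); rewrite ?mul1r // mul0r mulr0.
  have E2 : r * S = \sum_u \sum_v (adj u v)%:R * (x u * y (s v)).
    rewrite exchange_big /S big_distrr /=; apply: eq_bigr => v _; rewrite mulrA -xe /nb.
    rewrite big_mkcond big_distrl; apply: eq_bigr => u _ /=; rewrite adj_sym.
    by case: (adj _ _); rewrite ?mul1r // !mul0r.
  rewrite mulrBl E1 E2 -sumrB; apply: eq_bigr => u _; rewrite -sumrB.
  by apply: eq_bigr => v _; rewrite -mulrBl.
(* Entries are replaced by their limits [om]. Each product changes by at most
   [e^2 + 4 * e <= 5 * e], and only pairs inside [Core] have [g] different from 0. *)
have low : \sum_u \sum_v g u v * (om u * om v) - 5 * e * #|Core|%:R ^+ 2 <=
    \sum_u \sum_v g u v * (x u * y (s v)).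
  have -> : 5 * e * #|Core|%:R ^+ 2 = \sum_u \sum_v ((u \in Core) && (v \in Core))%:R * (5 * e).
    transitivity (\sum_(u in Core) \sum_(v in Core) 5 * e).
      rewrite !sumr_const; rewrite -[5 * e *+ _]mulr_natr -[_ *+ #|_|]mulr_natr; ring.
    rewrite big_mkcond; apply: eq_bigr => u _; rewrite big_mkcond /=.
    case: ifP => _; last by rewrite big1 // => v _; rewrite mul0r.
    by apply: eq_bigr => v _; case: (v \in Core); rewrite ?mul1r ?mul0r.
  rewrite -sumrB; apply: ler_sum => u _; rewrite -sumrB; apply: ler_sum => v _.
  have [uC|uC] := boolP (u \in Core); last by rewrite gcore ?uC // !mul0r subr0.
  have [vC|vC] := boolP (v \in Core); last by rewrite gcore ?vC ?orbT // !mul0r subr0.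
  rewrite mul1r; have h1 := omx u; have h2 := omy v.
  have hp : `|x u * y (s v) - om u * om v| <= 5 * e.
    have -> : x u * y (s v) - om u * om v =
      (x u - om u) * (y (s v) - om v) + (x u - om u) * om v + om u * (y (s v) - om v) by ring.
    apply: le_trans (ler_normD _ _) _.
    have n1 : `|om u * (y (s v) - om v)| <= 2 * e.
      rewrite normrM ler_pM // ger0_norm; case/andP: (om12 u) => // o1 _.
      exact: le_trans o1.
    have n2 : `|(x u - om u) * om v| <= e * 2.
      rewrite normrM ler_pM // ger0_norm; case/andP: (om12 v) => // o1 _.
      exact: le_trans o1.
    have n3 : `|(x u - om u) * (y (s v) - om v)| <= e * 1.
      rewrite normrM ler_pM //; apply: le_trans h2 _; by case/andP: e01.
    have n4 := ler_normD ((x u - om u) * (y (s v) - om v)) ((x u - om u) * om v).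
    by move: n1 n2 n3 n4; move: `|_| `|_| `|_| `|_|; clear=> *; lra.
  have /andP[ga gb] := g1 u v; move: hp; rewrite ler_norml => /andP[p1 p2].
  move: ga gb p1 p2; move: (g u v) (x u * _) (om u * _) => a b d; clear; nra.
(* All weights are lowered to 1. Pairs inside [W] weigh [l ^+ 2] and have nonnegative total by the
   hypothesis on [einner]; pairs between [W] and the rest weigh [l] and are all edges of [G']. *)
have drop : \sum_u \sum_v g u v <= \sum_u \sum_v g u v * (om u * om v).
  rewrite -subr_ge0 -sumrB.
  apply: (@le_trans _ _ (\sum_u \sum_v (((u \in W) && (v \in W))%:R * ((l ^+ 2 - 1) * g u v)))).
    have -> : \sum_u \sum_v (((u \in W) && (v \in W))%:R * ((l ^+ 2 - 1) * g u v)) =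
      (l ^+ 2 - 1) * \sum_(u in W) \sum_(v in W) g u v.
      rewrite [in RHS]big_mkcond big_distrr /=; apply: eq_bigr => u _.
      rewrite [in RHS]big_mkcond /=.
      case: ifP => _; last by rewrite mulr0 big1 // => v _; rewrite mul0r.
      by rewrite big_distrr; apply: eq_bigr => v _ /=; case: (v \in W); rewrite ?mul1r ?mul0r ?mulr0.
    apply: mulr_ge0; first by case/andP: l12 => l1 _; rewrite subr_ge0 exprn_ege1.
    have -> : \sum_(u in W) \sum_(v in W) g u v =
        \sum_(u in W) \sum_(v in W) (adj (s u) (s v))%:R - einner R W.
      by rewrite /einner -sumrB; apply: eq_bigr => u _; rewrite -sumrB.
    by rewrite subr_ge0.
  apply: ler_sum => u _; rewrite -sumrB; apply: ler_sum => v _.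
  have gWV a b : a \in W -> b \notin W -> 0 <= g a b.
    by move=> aW bW; rewrite /g hjoin //; case: (adj a b); rewrite ?subrr ?subr0.
  rewrite /om; case: ifPn => uW; case: ifPn => vW; rewrite /= ?mul1r ?mul0r ?mulr1.
  - by rewrite le_eqVlt; apply/orP; left; apply/eqP; ring.
  - have := gWV u v uW vW; case/andP: l12 => l1 _; move: l1; move: (g u v) => a; clear; nra.
  - have := gWV v u vW uW; rewrite gsym; case/andP: l12 => l1 _; move: l1; move: (g u v) => a; clear; nra.
  - by rewrite subrr.
have tot : 2 <= \sum_u \sum_v g u v.
  have -> : \sum_u \sum_v g u v = 2 * #|edges G'|%:R - 2 * #|edges G|%:R.
    rewrite -!einner_setT sreindex -sumrB; apply: eq_bigr => u _.
    by rewrite sreindex -sumrB.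
  have : #|edges G|%:R + 1 <= #|edges G'|%:R :> R by rewrite natr1 ler_nat.
  by clear; lra.
have pos : 0 < (r' - r) * S.
  rewrite form; apply: lt_le_trans low; move: hsmall drop tot.
  by move: (\sum_u _) (\sum_u _) (5 * e * _) => *; lra.
rewrite -subr_gt0 ltNge; apply/negP => h; move: pos; apply/negP; rewrite -leNgt.
by rewrite mulr_le0_ge0 //; apply: sumr_ge0 => u _; rewrite mulr_ge0.
Qed.

(** For [gamma = 0] the Turan graph in the definition would have [n + 1] vertices, so [H2] would
    have more vertices than the join containing it. *)
Lemma matching_good_gamma H : matching_good H -> (0 < family_gamma H)%N.
Proof.
case=> _ _ [c [N hN]]; rewrite lt0n; apply/eqP => g0.
have [H1 [H2 []]] := hN N (leqnn N); rewrite g0 => -[cJ _ _] [c1 _ _] [f fb _].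
have := bij_eq_card fb; rewrite card_ord subn0 addn1 => c2.
by move: cJ; rewrite card_sum c1 add0n c2 => /eqP; rewrite eqn_leq ltnn.
Qed.

Lemma matching_good_lower R H k :
  (0 < k)%N -> family_p H = k.+1 -> matching_good H -> spectral_lower R H k.
Proof.
move=> k0 pE mg e e0.
have [K [N1 hN1]] := matching_good_clean R pE (matching_good_gamma mg) mg.
have [N2 hN2] := clean_spectral_lower (family_gamma H).-1 K k0 e0.
exists (maxn N1 N2) => n; rewrite geq_max => /andP[nN1 nN2] G [_ _ max].
have [G' [W [X [f [[ex cl bal] [Ws XK jn _]]]]]] := hN1 n nN1.
have [G'n free _] := ex; apply: le_trans (max G' G'n free).
by rewrite -G'n; apply: (hN2 G' W X f) => //; rewrite G'n.
Qed.

Lemma balanced_cls R G k (W : {set G}) (f : G -> 'I_k.+1) i :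
  balanced W f -> `|#|cls W f i|%:R - #|G|%:R / k.+1%:R| <= #|W|%:R + 1 :> R.
Proof.
case/balanced_sizes => b cb _; rewrite cb; set N := #|~: W|; set q := (N %/ k.+1)%N.
have GN : #|G|%:R = #|W|%:R + N%:R :> R by rewrite -natrD cardsC.
have k0 : 0 < k.+1%:R :> R by rewrite ltr0n.
have h1 : q%:R <= N%:R / k.+1%:R :> R.
  by rewrite ler_pdivlMr // -natrM ler_nat leq_trunc_div.
have h2 : N%:R / k.+1%:R < q%:R + 1 :> R.
  by rewrite ltr_pdivrMr // natr1 -natrM ltr_nat ltn_ceil.
have h3 : 0 <= #|W|%:R / k.+1%:R :> R by rewrite divr_ge0.
have h5 : #|W|%:R / k.+1%:R <= #|W|%:R :> R.
  by rewrite ler_pdivrMr // ler_peMr // (ler_nat R 1).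
have [h4 h6] : 0 <= (b i)%:R :> R /\ (b i)%:R <= 1 :> R.
  by case: (b i) => /=; split; clear; lra.
have W0 : 0 <= #|W|%:R :> R by [].
rewrite GN mulrDl natrD; move: h1 h2 h3 h5 h4 h6 W0; rewrite ler_norml.
move: (N%:R / _) (#|W|%:R / _) => w1 w2; clear.
by move=> *; apply/andP; split; lra.
Qed.

(** The classes without [X] are completely joined to each other and to [W], as [induced_B_free]
    requires. *)
Lemma clean_induced_B_free H G k c m (W X : {set G})
    (f : G -> 'I_k.+1) :
  family_data H k c m -> graph_free H G -> #|W| = (family_gamma H).-1 ->
  clean W X f -> (forall i, (c + #|X| <= #|cls W f i|)%N) ->
  graph_free (B_family H) (induced W).
Proof.
move=> fd free Ws [_ cl] hc.
pose S i := cls W f i :\: X.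
have SP i u : u \in S i -> [/\ u \notin W, u \notin X & f u = i].
  by case/setDP; rewrite inE => /andP[uW /eqP fu] uX.
apply: (induced_B_free (fd_card fd) (fd_p fd) (fd_k fd) (fd_c fd) free (S := S)).
- by rewrite Ws prednK // (fd_gamma fd).
- split=> [i|i j u v ij /SP[uW uX fu] /SP[vW vX fv]].
    rewrite -(leq_add2l #|cls W f i :&: X|) cardsID; apply: leq_trans (hc i).
    by rewrite addnC leq_add2l subset_leq_card // subsetIr.
  by rewrite (cl u uW uX) fu fv eq_sym ij orbT.
move=> i u v uW /SP[vW vX _]; by rewrite adj_sym (cl v vW vX) uW.
Qed.

(** An edge-extremal graph is not known to be spectral extremal, but its clean and balanced
    structure yields the lower bound on its radius that stability requires, and thereby the entries
    of its eigenvector. *)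
Lemma EX_clean_perron R H k c m K (th : R) :
  family_data H k c m -> 0 < th ->
  exists N, forall G (W X : {set G}) (f : G -> 'I_k.+1), (N <= #|G|)%N ->
    graph_free H G -> clean W X f -> balanced W f -> #|W| = (family_gamma H).-1 ->
    (#|X| <= K)%N -> (forall u v, u \in W -> v \notin W -> adj u v) ->
    exists2 y : G -> R, perron y (spectral_radius R G) &
      (forall u, u \notin W -> `|y u - 1| <= 32 * th) /\
      (forall u, u \in W -> `|y u - (1 - k.+1%:R^-1)^-1| <= 32 * th).
Proof.
move=> fd th0; have [t [t0 tth t8 _ _]] := exists_pos_le4 th0
  (divr_gt0 (ltr0n R 1) (ltr0n R 8)) th0 th0.
set s := (family_gamma H).-1.
have g0 : (0 < c + family_gamma H)%N by rewrite addn_gt0 (fd_c fd).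
have [N1 hN1] := spectral_stability 1 (fd_k fd) g0 t0.
have [N2 hN2] := clean_spectral_lower s K (fd_k fd) (ltr01 : 0 < 1 :> R).
have [N3 hN3] := exists_nat_ge ((s%:R + K%:R + 1) / t).
exists (maxn 1 (maxn N1 (maxn N2 N3))) => G W X f.
rewrite !geq_max => /and4P[n1 nN1 nN2 nN3] free cl bal Ws XK jn.
have n3 := hN3 _ nN3; rewrite ler_pdivrMr // mulrC in n3.
have [_ [y py]] := perron_spectral R n1.
have [a2 a1 ai1 ai2] := turan_density R (fd_k fd).
have hr : (1 - k.+1%:R^-1) * #|G|%:R - 1 <= spectral_radius R G.
  apply: le_trans (hN2 G W X f nN2 cl bal Ws XK jn).
  rewrite lerD2r lerDl mulr_ge0 //; move: a1 ai1.
  by move: (1 - _ : R) => a; move: (a^-1) => b; clear; lra.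
have [hD hup _] := hN1 G y _ nN1 (free_no_partite fd free) py hr.
rewrite [_ * #|G|%:R]mulrDl in hup.
have s0 : 0 <= s%:R :> R by []. have K0 : 0 <= K%:R :> R by [].
have pc : perron_close k y (spectral_radius R G) t.
  split=> //; rewrite ler_norml; move: hr hup n3 s0 K0; move: ((1 - _) * _) => w.
  by clear; move=> *; apply/andP; split; lra.
have XK' : #|X|%:R <= K%:R :> R by rewrite ler_nat.
have Wt : #|W|%:R <= t * #|G|%:R by rewrite Ws; move: n3 K0; clear; lra.
have nW : near_full W f t.
  apply: (clean_near_full cl).
    by rewrite Ws -/s; move: n3 XK'; clear; lra.
  by move=> i; apply: le_trans (balanced_cls R i bal) _; rewrite Ws; move: n3 K0; clear; lra.
have t8' : t <= 8^-1 by move: t8; clear; lra.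
have [w1 w2] := near_full_weights (fd_k fd) n1 nW py pc t8' Wt.
by exists y => //; split=> u uW; [apply: le_trans (w1 u uW) _|apply: le_trans (w2 u uW) _];
  rewrite ler_pM2l.
Qed.

Lemma SPEX_edges R H k c m :
  family_data H k c m -> matching_good H ->
  exists N, forall n, (N <= n)%N -> forall G, SPEX R n H G ->
    exists2 G', EX n H G' & (#|edges G'| <= #|edges G|)%N.
Proof.
move=> fd mg; have LB := @matching_good_lower R H k (fd_k fd) (fd_p fd) mg.
have [K hK] := SPEX_balanced fd LB.
have [K' [N0 hN0]] := matching_good_clean R (fd_p fd) (fd_gamma fd) mg.
set s := (family_gamma H).-1 in hK hN0.
pose M : R := (s + K + K')%:R.
have M1 : 0 < 100 * (M ^+ 2 + 1) by rewrite mulr_gt0 // ltr_wpDl // sqr_ge0.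
have ip0 : 0 < k.+1%:R^-1 :> R by rewrite invr_gt0 ltr0n.
(* The core has at most [M] vertices and entries err by at most [32 * th], so
   [5 * (32 * th) * M ^+ 2 < 2] is required; [M] does not depend on [th]. *)
have [th [th0 thM th4 _ _]] := exists_pos_le4 (divr_gt0 (ltr0n R 1) M1)
  (divr_gt0 ip0 (ltr0n R 4)) M1 M1.
rewrite ler_pdivlMr // in thM.
have thM0 : 0 <= th * M ^+ 2 by rewrite mulr_ge0 ?sqr_ge0 // ltW.
have th8 : th <= 8^-1 by move: thM thM0; clear; lra.
have [N1 hN1] := hK th th0.
have [N2 hN2] := EX_clean_perron K' fd th0.
have [N3 hN3] := exists_nat_ge ((s%:R + 1) / th).
have [N4 hN4] := exists_nat_ge (2 * (c%:R + K%:R) / k.+1%:R^-1 : R).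
exists (maxn 1 (maxn N0 (maxn N1 (maxn N2 (maxn N3 N4))))) => n.
rewrite !geq_max => /and5P[n1 nN0 nN1 nN2 /andP[nN3 nN4]] G sp.
have [Gn free max] := sp.
have [G' [W' [X' [f' [[ex cl' bal'] [Ws' XK' jn' maxB]]]]]] := hN0 n nN0.
exists G' => //; rewrite leqNgt; apply/negP => lt_edges.
have [G'n free' _] := ex.
have G0 : (0 < #|G|)%N by rewrite Gn.
have [_ [x px]] := perron_spectral R G0.
have [W [X [f [[cl bal Ws XK] [nW pc]]]]] := hN1 n nN1 G x sp px.
have n3 := hN3 _ nN3; rewrite ler_pdivrMr // mulrC in n3.
have n4 := hN4 _ nN4; rewrite ler_pdivrMr // mulrC in n4.
have Wt : #|W|%:R <= th * #|G|%:R by rewrite Ws Gn; move: n3; clear; lra.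
have [wx1 wx2] := near_full_weights (fd_k fd) G0 nW px pc th8 Wt.
have nG' : (N2 <= #|G'|)%N by rewrite G'n.
have [y py [wy1 wy2]] := hN2 G' W' X' f' nG' free' cl' bal' Ws' XK' jn'.
have WW : #|W| = #|W'| by rewrite Ws Ws'.
have GG : #|G| = #|G'| by rewrite Gn G'n.
have [sg [sbij sW sf]] := balanced_bijection bal bal' WW GG.
have [_ clz] := cl; have [_ clz'] := cl'.
(* Off [Core] both graphs follow the pattern given by [W] and the classes, which [sg] preserves. *)
pose Core := (W :|: X) :|: [set u | sg u \in X'].
have CoreM : #|Core|%:R <= M.
  rewrite /M ler_nat; apply: leq_trans (leq_card_setU _ _) _; apply: leq_add.
    by apply: leq_trans (leq_card_setU _ _) _; rewrite Ws leq_add2l.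
  apply: leq_trans XK'; rewrite -(card_imset _ (bij_inj sbij)); apply: subset_leq_card.
  by apply/subsetP => _ /imsetP[u + ->]; rewrite inE.
have [a2 a1 ai1 ai2] := turan_density R (fd_k fd).
suff : spectral_radius R G < spectral_radius R G'.
  by apply/negP; rewrite -leNgt; apply: max.
apply: (@compare_radii R G G' sg x y _ _ (1 - k.+1%:R^-1)^-1 (32 * th) W Core) => //.
- by rewrite ai1 ai2.
- by apply/andP; split; move: th0 thM thM0; clear; lra.
- by move=> u uW; split; [apply: wx2|apply: wy2; rewrite sW].
- by move=> u uW; split; [apply: wx1|apply: wy1; rewrite sW].
- move=> u v; rewrite !inE !negb_or => /andP[/andP[uW uX] uX'].
  rewrite (clz u uW uX) (clz' (sg u)) ?sW //.
  by have [//|vW] := boolP (v \in W); rewrite sf.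
- by move=> u v uW vW; apply: jn'; rewrite sW.
- have := maxB (induced W); rewrite -einner_induced => hB.
  have -> : \sum_(u in W) \sum_(v in W) (adj (sg u) (sg v))%:R = einner R W'.
    rewrite /einner (reindex sg) /=; last exact: onW_bij.
    apply: eq_big => [u|u _]; first by rewrite sW.
    rewrite [in RHS](reindex sg) /=; last exact: onW_bij.
    by apply: eq_bigl => v; rewrite sW.
  apply: hB; first by rewrite card_sig -Ws; apply: eq_card => u; rewrite inE.
  apply: (clean_induced_B_free fd free Ws cl) => i.
  rewrite -(ler_nat R); apply: le_trans (near_cls i (proj1 nW)).
  rewrite natrD; have XK1 : #|X|%:R <= K%:R :> R by rewrite ler_nat.
  have tn : th * 4 * #|G|%:R <= k.+1%:R^-1 * #|G|%:R.
    by rewrite ler_wpM2r // -ler_pdivlMr.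
  move: n4 XK1 tn; rewrite -Gn [#|G|%:R / _]mulrC.
  by move: (k.+1%:R^-1 * _) (ler0n R c) (ler0n R K) => w; clear; lra.
have C2 : #|Core|%:R ^+ 2 <= M ^+ 2 by rewrite ler_pXn2r ?nnegrE // /M.
have : th * #|Core|%:R ^+ 2 <= th * M ^+ 2 by rewrite ler_pM2l.
by move: thM th0; move: (_ ^+ 2) (_ ^+ 2) => w1 w2; clear; lra.
Qed.

Local Close Scope ring_scope.

Theorem theorem1p2 (R : realType) (H : graph_family) :
  finite_family H -> matching_good H -> spectral_consistent R H.
Proof.
move=> [c0 Hc] mg; have [p2 [m dm] _] := mg.
have pE : family_p H = (family_p H).-1.+1 by rewrite prednK // (leq_trans _ p2).
have k0 : (0 < (family_p H).-1)%N by rewrite -ltnS -pE.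
(* The bound is raised to [c0.+1] because [family_data] asks for a positive one. *)
have fd : family_data H (family_p H).-1 c0.+1 m.
  by split=> //; [move=> F /Hc; apply: leqW | exact: matching_good_gamma].
have [N hN] := SPEX_edges R fd mg; exists N => n nN G sp.
have [G' [_ _ max'] le_edges] := hN n nN G sp; have [Gn free _] := sp.
by split=> // G'' G''n free''; apply: leq_trans le_edges; apply: max'.
Qed.
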